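(* Suppose that $a_n\to\infty$, $\beta_n\to\beta_\infty$ as $n\to\infty$ with $|\beta_\infty|<1$, that $(\alpha_n')\in\ell^1(\mathbb Z_+)$, $(\beta_n')\in\ell^1(\mathbb Z_+)$, $(k_n-1)\in\ell^1$, and that $\sum_{n=0}^\infty a_n^{-1}=\infty$. Then the spectrum of the Jacobi operator $J$ covers the whole line $\mathbb R$ and, for all $n,m\in\mathbb Z_+$ and all $\lambda\in\mathbb R$, $$\frac{d\langle E(\lambda)e_n,e_m\rangle}{d\lambda}=\pi^{-1}\sqrt{1-\beta_\infty^2}\;|\Omega(\lambda\pm i0)|^{-2}P_n(\lambda)P_m(\lambda).$$ In particular, the spectral measure of $J$ equals $d\rho(\lambda):=d\langle E(\lambda)e_0,e_0\rangle=\tau(\lambda)\,d\lambda$ with the weight $$\tau(\lambda)=\pi^{-1}\sqrt{1-\beta_\infty^2}\;|\Omega(\lambda\pm i0)|^{-2}.$$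
   Context: $\mathbb Z_+=\{0,1,2,\dots\}$; $a_n>0$ and $b_n\in\mathbb R$ for $n\in\mathbb Z_+$, and $a_{-1}>0$ is an arbitrary fixed number. For a sequence $x_n$ put $x_n'=x_{n+1}-x_n$. Notation: $$\alpha_n=\frac1{2\sqrt{a_{n-1}a_n}},\quad \beta_n=-\frac{b_n}{2\sqrt{a_{n-1}a_n}},\quad k_n=\frac{a_n}{\sqrt{a_{n-1}a_{n+1}}}.$$ The minimal Jacobi operator $J_{\min}$ acts in $\ell^2(\mathbb Z_+)$ on sequences with finitely many non-zero components by $(J_{\min}u)_0=b_0u_0+a_0u_1$, $(J_{\min}u)_n=a_{n-1}u_{n-1}+b_nu_n+a_nu_{n+1}$ for $n\ge1$. Under the Carleman condition $\sum a_n^{-1}=\infty$ it is essentially self-adjoint; $J$ is its closure and $E(\lambda)$ is the spectral family of $J$. $e_0,e_1,\dots$ is the canonical basis of $\ell^2(\mathbb Z_+)$. The Jacobi equation is $a_{n-1}u_{n-1}+b_nu_n+a_nu_{n+1}=zu_n$, $n\in\mathbb Z_+$, for sequences $(u_n)_{n\ge-1}$. The polynomials $P_n(z)$ are its solution with $P_{-1}(z)=0$, $P_0(z)=1$. The Wronskian is $\{u,v\}=a_n(u_nv_{n+1}-u_{n+1}v_n)$, independent of $n\ge-1$ for solutions $u,v$. The branch of $\sqrt{z^2-1}$ on $\mathbb C\setminus[-1,1]$ is analytic and positive for $z>1$ (so equal to $\pm i\sqrt{1-\lambda^2}$ at $\lambda\pm i0$, $\lambda\in(-1,1)$); $\zeta(z)=z-\sqrt{z^2-1}$,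 $\zeta_n(z)=\zeta(\alpha_nz+\beta_n)$, with $\zeta_n(\lambda\pm i0)=\zeta(\alpha_n\lambda+\beta_n\pm i0)$. Given $\rho_0>0$, fix $0<\varepsilon_0<1-|\beta_\infty|$ and choose $N_0=N_0(\rho_0)\ge1$ such that $|\alpha_nz+\beta_n-\beta_\infty|<\varepsilon_0$ for all $n\ge N_0$, $|z|<\rho_0$. Put $q_n(z)=\zeta_{N_0}(z)\cdots\zeta_{n-1}(z)$. For $|z|<\rho_0$ in the complex plane cut along $\mathbb R$ (edges $\lambda\pm i0$ included), the Jost solution $f_n(z)$, $n\ge-1$, is the unique solution of the Jacobi equation with $f_n(z)=a_n^{-1/2}q_n(z)(1+o(1))$ as $n\to\infty$. $\Omega(z)=\{P(z),f(z)\}=-a_{-1}f_{-1}(z)$. For given $\lambda$ one takes any $\rho_0>|\lambda|$; $|\Omega(\lambda+i0)|=|\Omega(\lambda-i0)|$ does not depend on the choice of $N_0$ or $\rho_0$. *)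

(* Defs.v *)
(* A sequence (u_n)_{n >= 0} is a function u : nat -> T with
   u n = u_n.  A sequence (u_n)_{n >= -1} is a function u : nat -> T shifted by
   one: u 0 = u_{-1} and u n.+1 = u_n.  Such arguments are marked "shifted". *)
From HB Require Import structures.
From mathcomp Require Import all_boot all_order all_algebra.
From mathcomp Require Import complex ring.
From mathcomp Require Import all_classical all_reals all_analysis.

Set Implicit Arguments.
Unset Strict Implicit.
Unset Printing Implicit Defensive.

Import Order.TTheory GRing.Theory Num.Theory.
Import numFieldNormedType.Exports.
Export numFieldNormedType.Exports.

Local Open Scope classical_set_scope.
Local Open Scope ring_scope.
Local Open Scope complex_scope.

Section SquareSummable.
Variable R : realType.

Definition ell1 (x : nat -> R) : Prop := cvgn (series (fun n => `|x n|)).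

Definition cseq := nat -> R[i].

Definition ell2 : set cseq :=
  [set u | cvgn (series (fun n => Normc.normc (u n) ^+ 2))].

Definition ell2_norm (u : cseq) : R :=
  Num.sqrt (limn (series (fun n => Normc.normc (u n) ^+ 2))).

(* linear in the first argument *)
Definition ell2_dot (u v : cseq) : R[i] :=
  limn (series (fun n => complex.Re (u n * (v n)^*)))
  +i* limn (series (fun n => complex.Im (u n * (v n)^*))).

Definition basis_vec (n : nat) : cseq := fun k => (k == n)%:R.

(* derivative at x of a complex-valued function of a real variable *)
Definition is_cderive (F : R -> R[i]) (x : R) (l : R[i]) : Prop :=
  is_derive x 1 (fun t => complex.Re (F t)) (complex.Re l) /\
  is_derive x 1 (fun t => complex.Im (F t)) (complex.Im l).

End SquareSummable.

(* An unbounded operator in ell2 is given by its graph. *)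
Section Operators.
Variable R : realType.
Implicit Types (J : set (cseq R * cseq R)) (E : R -> cseq R -> cseq R).

Definition resolvent_set J : set R[i] :=
  [set z | (forall g, ell2 g ->
              exists! u, J (u, fun n => g n + z * u n)) /\
           exists c : R, forall g u, ell2 g ->
              J (u, fun n => g n + z * u n) -> ell2_norm u <= c * ell2_norm g].

Definition spectrum J : set R[i] := ~` resolvent_set J.

(* mu is the measure d<E(x)u,u> *)
Definition spectral_measure E (u : cseq R)
    (mu : {measure set (measurableTypeR R) -> \bar R}) : Prop :=
  forall x : R, mu `]-oo, x]%classic = (complex.Re (ell2_dot (E x u) u))%:E.

(* E is the spectral family (resolution of the identity, normalized to be
   right-continuous) of the operator J.  The last field says
   J = \int x dE(x): the domain of J consists of the u in ell2 with
   \int x^2 d<E(x)u,u> < oo, and <Ju,u> = \int x d<E(x)u,u> there (which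
   determines <Ju,v> by polarization). *)
Record spectral_family J E : Prop := SpectralFamily {
  sf_ell2 : forall x u, ell2 u -> ell2 (E x u);
  sf_linear : forall x (c : R[i]) u v, ell2 u -> ell2 v ->
    E x (fun n => c * u n + v n) = (fun n => c * E x u n + E x v n);
  sf_selfadjoint : forall x u v, ell2 u -> ell2 v ->
    ell2_dot (E x u) v = ell2_dot u (E x v);
  sf_mul : forall x y u, ell2 u -> E x (E y u) = E (Num.min x y) u;
  sf_right_continuous : forall x u, ell2 u ->
    ell2_norm (fun n => E y u n - E x u n) @[y --> x^'+] --> (0 : R);
  sf_ninfty : forall u, ell2 u -> ell2_norm (E x u) @[x --> -oo] --> (0 : R);
  sf_pinfty : forall u, ell2 u ->
    ell2_norm (fun n => E x u n - u n) @[x --> +oo] --> (0 : R);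
  sf_integral : forall u, ell2 u ->
    exists mu : {measure set (measurableTypeR R) -> \bar R},
      [/\ spectral_measure E u mu,
          (exists w, J (u, w)) <-> (\int[mu]_x (x ^+ 2)%:E < +oo)%E &
          forall w, J (u, w) ->
            ell2_dot w u = (\int[mu]_x x)%R%:C] }.

End Operators.

Section Jacobi.
Variable R : realType.
(* am1 is a_{-1} *)
Variables (a : nat -> R) (am1 : R) (b : nat -> R).

(* a_{n-1} *)
Definition aprev (n : nat) : R := if n is k.+1 then a k else am1.

Definition alpha (n : nat) : R := (2 * Num.sqrt (aprev n * a n))^-1.
Definition beta (n : nat) : R := - b n / (2 * Num.sqrt (aprev n * a n)).
Definition kappa (n : nat) : R := a n / Num.sqrt (aprev n * a n.+1).

Definition jacobi_action (u : cseq R) : cseq R := fun n =>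
  match n with
  | 0%N => (b 0%N)%:C * u 0%N + (a 0%N)%:C * u 1%N
  | k.+1 => (a k)%:C * u k + (b k.+1)%:C * u k.+1 + (a k.+1)%:C * u k.+2
  end.

(* the graph of J, i.e. the closure in ell2 x ell2 of the graph of the
   minimal operator J_min *)
Definition jacobi_operator : set (cseq R * cseq R) :=
  [set p | [/\ ell2 p.1, ell2 p.2 &
    exists v : nat -> cseq R,
      [/\ forall k, \forall n \near \oo, v k n = 0,
          ell2_norm (fun n => v k n - p.1 n) @[k --> \oo] --> (0 : R) &
          ell2_norm (fun n => jacobi_action (v k) n - p.2 n) @[k --> \oo]
            --> (0 : R)]]].

(* u is shifted *)
Definition jacobi_equation (z : R[i]) (u : cseq R) : Prop := forall n,
  (aprev n)%:C * u n + (b n)%:C * u n.+1 + (a n)%:C * u n.+2 = z * u n.+1.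

(* the sequence (P_n(z))_{n >= -1}, shifted *)
Fixpoint orthopoly_shift (z : R[i]) (n : nat) {struct n} : R[i] :=
  match n with
  | 0%N => 0
  | k.+1 => match k with
    | 0%N => 1
    | j.+1 => ((z - (b j)%:C) * orthopoly_shift z k
                 - (aprev j)%:C * orthopoly_shift z j) / (a j)%:C
    end
  end.

Definition orthopoly (n : nat) (z : R[i]) : R[i] := orthopoly_shift z n.+1.

(* a_{n-1} (u_{n-1} v_n - u_n v_{n-1}) for shifted u, v *)
Definition wronskian (u v : cseq R) (n : nat) : R[i] :=
  (aprev n)%:C * (u n * v n.+1 - u n.+1 * v n).

(* Boundary value at x + i0 (s = true) or x - i0 (s = false) of the branch of
   sqrt (z^2 - 1) that is analytic off [-1, 1] and positive for z > 1; this
   branch is odd, hence the sign of x outside [-1, 1]. *)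
Definition sqrt_edge (s : bool) (x : R) : R[i] :=
  if `|x| <= 1 then 0 +i* ((if s then 1 else -1) * Num.sqrt (1 - x ^+ 2))
  else (Num.sg x * Num.sqrt (x ^+ 2 - 1))%:C.

Definition zeta_edge (s : bool) (x : R) : R[i] := x%:C - sqrt_edge s x.

(* q_n(lam +- i0) *)
Definition q_edge (N0 : nat) (s : bool) (lam : R) (n : nat) : R[i] :=
  \prod_(N0 <= k < n) zeta_edge s (alpha k * lam + beta k).

(* f is shifted; the second clause is f_n = a_n^(-1/2) q_n (1 + o(1)) *)
Definition is_jost (N0 : nat) (s : bool) (lam : R) (f : cseq R) : Prop :=
  jacobi_equation lam%:C f /\
  Normc.normc ((Num.sqrt (a n))%:C * f n.+1 / q_edge N0 s lam n - 1)
    @[n --> \oo] --> (0 : R).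

(* "the" Jost solution (f_n(lam +- i0))_{n >= -1}, shifted *)
Definition jost (N0 : nat) (s : bool) (lam : R) : cseq R :=
  xget (fun=> 0) [set f | is_jost N0 s lam f].

(* Omega(lam +- i0).  The Wronskian of two solutions is constant; it is taken
   here at the index -1. *)
Definition Omega (N0 : nat) (s : bool) (lam : R) : R[i] :=
  wronskian (orthopoly_shift lam%:C) (jost N0 s lam) 0.

Definition spectral_weight (beta_inf : R) (N0 : nat) (s : bool) (lam : R) : R :=
  pi^-1 * Num.sqrt (1 - beta_inf ^+ 2) * Normc.normc (Omega N0 s lam) ^- 2.

Lemma Omega_jostN1 N0 s lam : Omega N0 s lam = - am1%:C * jost N0 s lam 0%N.
Proof. by rewrite /Omega /wronskian /= mul0r mul1r sub0r mulrN mulNr. Qed.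

Lemma orthopoly_shiftP z : (forall n, 0 < a n) ->
  jacobi_equation z (orthopoly_shift z).
Proof.
move=> a_gt0 n.
have an0 : (a n)%:C != 0 :> R[i].
  by rewrite (inj_eq (@complexI R) (a n) 0) gt_eqF.
rewrite -[orthopoly_shift z n.+2]/(((z - (b n)%:C) * orthopoly_shift z n.+1
  - (aprev n)%:C * orthopoly_shift z n) / (a n)%:C).
by rewrite [X in _ + X]mulrC divfK//; ring.
Qed.

Lemma wronskian_const z u v n : jacobi_equation z u -> jacobi_equation z v ->
  wronskian u v n = wronskian u v 0.
Proof.
move=> Hu Hv; elim: n => // n <-; apply/eqP; rewrite -subr_eq0 /wronskian.
have -> : aprev n.+1 = a n by [].
have := Hu n; have := Hv n => /eqP; rewrite -subr_eq0 => /eqP ev /eqP.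
rewrite -subr_eq0 => /eqP eu.
apply/eqP; rewrite -[RHS](mulr0 (u n.+1)) -[in RHS]ev.
rewrite -[RHS]subr0 -[X in _ = _ - X](mulr0 (v n.+1)) -[X in _ = _ - _ * X]eu.
ring.
Qed.

End Jacobi.

(* Main.v *)
(* Multiplying a solution u of the Jacobi equation by sqrt(a_n) turns the equation
   into a recurrence whose coefficients have bounded variation, with
   characteristic roots zeta_n and 1 / zeta_n.  Hence the "dominant part"
   q_{n+1} (v_{n+1} - zeta_n v_n), v_n = sqrt(a_n) u_n, converges locally uniformly
   for z in the closed upper half plane near a real point.  Let p(z) and q(z) be
   the limits for P and for the solution Q with Q_{-1} = - 1 / a_{-1}, Q_0 = 0.
   Then Q - (q / p) P is square summable for Im z > 0, so that - q / p is the Weyl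
   function m(z) = <(J - z)^{-1} e_0, e_0>; it extends continuously to the real
   line, where |p| = |Omega| and the Wronskian of P and Q gives
   Im m = sqrt(1 - beta_inf^2) |Omega|^{-2}.  Since Im m is the Poisson integral of
   the spectral measure of e_0, inverting it differentiates <E(x) e_0, e_0>.

   The other matrix elements need no resolvent: on the range of E(y) - E(x) the
   operator J is within y - x of the scalar x, so the recurrence for
   (E(y) - E(x)) e_n forces (E(y) - E(x)) e_n = P_n(lambda) (E(y) - E(x)) e_0 up to
   a relative error of the size of the interval.

   Finally, at a real lambda the solution P is O(a_n^{-1/2}); if u in ell2 solved
   (J - lambda) u = e_0, the constant Wronskian of P and u would bound 1 / a_n by
   a multiple of |u_n|^2 + |u_{n+1}|^2, against the Carleman condition. *)
Require Import Defs.
From HB Require Import structures.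
From mathcomp Require Import all_boot all_order all_algebra.
From mathcomp Require Import complex.
From mathcomp Require Import all_classical all_reals all_analysis.
From mathcomp Require Import measurable_realfun ring lra.

Import Order.TTheory GRing.Theory Num.Theory.
Import numFieldNormedType.Exports.
Local Open Scope classical_set_scope.
Local Open Scope ring_scope.
Local Open Scope complex_scope.

Set Implicit Arguments.
Unset Strict Implicit.
Unset Printing Implicit Defensive.

(** * Complex numbers and square summable sequences *)

(** A spectral family enters only through its projections and the first and second moments of its
    measures, so no functional calculus is at hand. Symmetry of the action and its commutation with
    the projections are extracted from the additivity of spectral measures; the norm of
    [(J - z)^{-1} e_0] is then computed by cutting the line into short bands, on each of which [J]
    is nearly a scalar.

    The square summable solution is found without prior knowledge of its decay. The quotient of the
    dominant parts of [Q] and [P] at a finite index [n], instead of their limits, gives the flux in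
    Green's identity a sign at [n], and this bounds the partial sums by [Im m / Im z].

    The index [N0 (rho0 lam)] may depend on [lam] in any manner, so regularity of the weight cannot
    be read off its formula. The derivative is therefore taken in a two-point sense, with both end
    points moving; such a derivative is automatically continuous, which yields the measurability of
    the weight and the absence of a singular part. *)

Section ComplexNumbers.
Variable R : realType.
Implicit Types (x y : R) (z w : R[i]).

Lemma ReD z w : complex.Re (z + w) = complex.Re z + complex.Re w.
Proof. by case: z w => [? ?] [? ?]. Qed.

Lemma ImD z w : complex.Im (z + w) = complex.Im z + complex.Im w.
Proof. by case: z w => [? ?] [? ?]. Qed.

Lemma ReN z : complex.Re (- z) = - complex.Re z.
Proof. by case: z. Qed.

Lemma ImN z : complex.Im (- z) = - complex.Im z.
Proof. by case: z. Qed.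

Lemma ReM z w : complex.Re (z * w) =
  complex.Re z * complex.Re w - complex.Im z * complex.Im w.
Proof. by case: z w => [? ?] [? ?]. Qed.

Lemma ImM z w : complex.Im (z * w) =
  complex.Re z * complex.Im w + complex.Im z * complex.Re w.
Proof. by case: z w => [? ?] [? ?]. Qed.

Lemma ReJ z : complex.Re z^* = complex.Re z.
Proof. by case: z. Qed.

Lemma ImJ z : complex.Im z^* = - complex.Im z.
Proof. by case: z. Qed.

Lemma ReI z : complex.Re ('i * z) = - complex.Im z.
Proof. by case: z => a b; rewrite /= mul0r mul1r sub0r. Qed.

Definition ReImE := (ReD, ImD, ReN, ImN, ReM, ImM, ReJ, ImJ).

Lemma complexP z w : complex.Re z = complex.Re w ->
  complex.Im z = complex.Im w -> z = w.
Proof. by case: z w => [? ?] [? ?] /= -> ->. Qed.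

Lemma conjc_fixed z : z^* = z -> z = (complex.Re z)%:C.
Proof.
by case: z => x y [] /eqP; rewrite eq_sym -addr_eq0 -mulr2n mulrn_eq0/= => /eqP ->.
Qed.

Lemma normc_ge0 z : 0 <= Normc.normc z.
Proof. by case: z => a b; exact: sqrtr_ge0. Qed.

Lemma sqr_normcE z :
  Normc.normc z ^+ 2 = complex.Re z ^+ 2 + complex.Im z ^+ 2.
Proof. by case: z => a b; rewrite sqr_sqrtr// addr_ge0// sqr_ge0. Qed.

Lemma normc_real x : Normc.normc x%:C = `|x|.
Proof. by rewrite /= expr0n/= addr0 sqrtr_sqr. Qed.

Lemma normcJ z : Normc.normc z^* = Normc.normc z.
Proof. by case: z => a b; rewrite /= sqrrN. Qed.

Lemma normcI z : Normc.normc ('i * z) = Normc.normc z.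
Proof. by rewrite Normc.normcM /= expr0n expr1n add0r sqrtr1 mul1r. Qed.

Lemma normc_gt0 z : (0 < Normc.normc z) = (z != 0).
Proof.
rewrite lt0r normc_ge0 andbT; congr (~~ _); apply/eqP/eqP => [|->].
  exact: Normc.eq0_normc.
exact: Normc.normc0.
Qed.

Lemma normc_eq0 z : (Normc.normc z == 0) = (z == 0).
Proof. by apply/negb_inj; rewrite -normc_gt0 lt0r normc_ge0 andbT. Qed.

Lemma normc_Re z : `|complex.Re z| <= Normc.normc z.
Proof.
rewrite -(@ler_pXn2r _ 2)// ?nnegrE ?normc_ge0// real_normK ?num_real//.
by rewrite sqr_normcE lerDl sqr_ge0.
Qed.

Lemma normc_Im z : `|complex.Im z| <= Normc.normc z.
Proof. by rewrite -normrN -ReI -normcI normc_Re. Qed.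

Lemma normc_le_ReIm z :
  Normc.normc z <= `|complex.Re z| + `|complex.Im z|.
Proof.
rewrite -(@ler_pXn2r _ 2)// ?nnegrE ?normc_ge0 ?addr_ge0//.
rewrite sqr_normcE sqrrD !real_normK ?num_real//.
by rewrite -addrA lerD2l lerDr mulrn_wge0// mulr_ge0.
Qed.

Lemma ler_normcD z w : Normc.normc (z + w) <= Normc.normc z + Normc.normc w.
Proof. exact: le_normcD. Qed.

Lemma ler_normcB z w : Normc.normc (z - w) <= Normc.normc z + Normc.normc w.
Proof. by rewrite -(normcN w) ler_normcD. Qed.

Lemma normc_distC z w : Normc.normc (z - w) = Normc.normc (w - z).
Proof. by rewrite -normcN opprB. Qed.

End ComplexNumbers.

#[global] Arguments Normc.normc : simpl never.

Section SquareSummableSequences.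
Variable R : realType.
Implicit Types (u v w : cseq R) (c : R[i]).

Lemma eq_limn_series (f g : nat -> R) : f =1 g -> limn (series f) = limn (series g).
Proof. by move=> /funext ->. Qed.

Definition cscale c u : cseq R := fun n => c * u n.

(** A real bilinear form: by [ell2_dotE] the imaginary part of the Hermitian product is
    [rdot u (cscale 'i v)], so all inner product estimates can be made over the reals. *)
Definition rdot u v : R := limn (series (fun n => complex.Re (u n * (v n)^*))).

Lemma cvg_rdot u v : ell2 u -> ell2 v ->
  cvgn (series (fun n => complex.Re (u n * (v n)^*))).
Proof.
move=> hu hv; apply: normed_cvg.
apply: (@series_le_cvg _ _ (fun n => Normc.normc (u n) ^+ 2 +
                                     Normc.normc (v n) ^+ 2)) => //=.
- by move=> n; rewrite addr_ge0// sqr_ge0.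
- move=> n; rewrite (le_trans (normc_Re _))// Normc.normcM normcJ.
  have := sqr_ge0 (Normc.normc (u n) - Normc.normc (v n)).
  have := sqr_ge0 (Normc.normc (u n) + Normc.normc (v n)).
  by rewrite !expr2; lra.
- by rewrite seriesD; apply: is_cvgD.
Qed.

Lemma rdot_cvg u v : ell2 u -> ell2 v ->
  series (fun n => complex.Re (u n * (v n)^*)) n @[n --> \oo] --> rdot u v.
Proof. by move=> hu hv; exact: cvg_rdot. Qed.

Lemma ell2_normE u : ell2_norm u = Num.sqrt (rdot u u).
Proof.
rewrite /ell2_norm /rdot; congr Num.sqrt; apply: eq_limn_series => n.
by rewrite sqr_normcE ReM ReJ ImJ; ring.
Qed.

Lemma ell2_dotE u v : ell2_dot u v = rdot u v +i* rdot u (cscale 'i v).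
Proof.
congr (_ +i* _); apply: eq_limn_series => n //.
by rewrite /cscale rmorphM/= !ReImE/=; ring.
Qed.

Lemma ell2D u v : ell2 u -> ell2 v -> ell2 (u + v).
Proof.
move=> hu hv; rewrite /ell2/=.
apply: (@series_le_cvg _ _ (fun n => Normc.normc (u n) ^+ 2 *+ 2 +
                                     Normc.normc (v n) ^+ 2 *+ 2)) => //=.
- by move=> n; rewrite sqr_ge0.
- by move=> n; rewrite addr_ge0// mulrn_wge0// sqr_ge0.
- move=> n; have := ler_normcD (u n) (v n).
  have := normc_ge0 (u n + v n).
  have := sqr_ge0 (Normc.normc (u n) - Normc.normc (v n)).
  rewrite -[(u + v) n]/(u n + v n); nra.
- have -> : (fun n => Normc.normc (u n) ^+ 2 *+ 2 +
       Normc.normc (v n) ^+ 2 *+ 2) =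
      ((fun n => Normc.normc (u n) ^+ 2) + (fun n => Normc.normc (u n) ^+ 2)) +
      ((fun n => Normc.normc (v n) ^+ 2) + (fun n => Normc.normc (v n) ^+ 2)).
    by apply/funext => n; rewrite !mulr2n.
  by rewrite !seriesD; apply: is_cvgD; apply: is_cvgD.
Qed.

Lemma ell2Z c u : ell2 u -> ell2 (cscale c u).
Proof.
move=> hu; rewrite /ell2/= /cscale.
have -> : (fun n => Normc.normc (c * u n) ^+ 2) =
    (Normc.normc c ^+ 2) *: (fun n => Normc.normc (u n) ^+ 2).
  by apply/funext => n; rewrite Normc.normcM exprMn.
by rewrite seriesZ; exact: is_cvgZr.
Qed.

Lemma cscaleN1 u : cscale (-1) u = - u.
Proof. by apply/funext => n; rewrite /cscale mulN1r. Qed.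

Lemma ell2N u : ell2 u -> ell2 (- u).
Proof. by rewrite -cscaleN1; exact: ell2Z. Qed.

Lemma ell2B u v : ell2 u -> ell2 v -> ell2 (u - v).
Proof. by move=> hu hv; apply: ell2D => //; exact: ell2N. Qed.

Lemma ell2_fin u N : (forall n, (N <= n)%N -> u n = 0) -> ell2 u.
Proof.
move=> u0; rewrite /ell2/=; apply/cvg_ex; eexists.
apply: cvg_near_cst; exists N => //= n /= Nn.
rewrite /series/= (@big_cat_nat _ _ _ N)//= [X in _ + X]big_nat_cond.
rewrite [X in _ + X]big1 ?addr0; first by reflexivity.
by move=> i; rewrite andbT => /andP[Ni _]; rewrite u0// Normc.normc0 expr0n.
Qed.

Lemma ell2_0 : ell2 (0 : cseq R).
Proof. exact: (@ell2_fin _ 0). Qed.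

Lemma ell2_basis n : ell2 (basis_vec R n).
Proof.
apply: (@ell2_fin _ n.+1) => k nk; rewrite /basis_vec.
by rewrite (gtn_eqF nk).
Qed.

Lemma rdotC u v : rdot u v = rdot v u.
Proof.
apply: eq_limn_series => n.
by rewrite !ReImE; ring.
Qed.

Lemma rdotDl u v w : ell2 u -> ell2 v -> ell2 w ->
  rdot (u + v) w = rdot u w + rdot v w.
Proof.
move=> hu hv hw; apply: cvg_lim => //.
rewrite (_ : (fun n => _) = (fun n => complex.Re (u n * (w n)^*)) +
    (fun n => complex.Re (v n * (w n)^*))); last first.
  by apply/funext => k; rewrite mulrDl ReD.
by rewrite seriesD; apply: cvgD; exact: rdot_cvg.
Qed.

Lemma rdotDr u v w : ell2 u -> ell2 v -> ell2 w ->
  rdot w (u + v) = rdot w u + rdot w v.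
Proof. by move=> *; rewrite rdotC rdotDl// !(rdotC w). Qed.

Lemma rdot0l v : rdot 0 v = 0.
Proof.
apply: cvg_lim => //; apply: cvg_near_cst; apply: nearW => n.
by rewrite /series/= big1// => i _; rewrite mul0r.
Qed.

Lemma rdotZl (c : R) u v : ell2 u -> ell2 v ->
  rdot (cscale c%:C u) v = c * rdot u v.
Proof.
move=> hu hv; apply: cvg_lim => //.
rewrite (_ : (fun n => _) = c *: (fun n => complex.Re (u n * (v n)^*))).
  by rewrite seriesZ; apply: cvgZl_tmp; exact: rdot_cvg.
apply/funext => k; rewrite -[RHS]/(c * _) /cscale !ReImE/=; ring.
Qed.

Lemma rdotZr (c : R) u v : ell2 u -> ell2 v ->
  rdot v (cscale c%:C u) = c * rdot v u.
Proof. by move=> *; rewrite rdotC rdotZl// rdotC. Qed.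

Lemma rdotNl u v : ell2 u -> ell2 v -> rdot (- u) v = - rdot u v.
Proof.
move=> hu hv; rewrite -cscaleN1.
have -> : (-1 : R[i]) = (-1)%:C by rewrite rmorphN1.
by rewrite rdotZl// mulN1r.
Qed.

Lemma rdotNr u v : ell2 u -> ell2 v -> rdot v (- u) = - rdot v u.
Proof. by move=> *; rewrite rdotC rdotNl// rdotC. Qed.

Lemma rdotBl u v w : ell2 u -> ell2 v -> ell2 w ->
  rdot (u - v) w = rdot u w - rdot v w.
Proof. by move=> *; rewrite rdotDl ?rdotNl//; exact: ell2N. Qed.

Lemma rdotBr u v w : ell2 u -> ell2 v -> ell2 w ->
  rdot w (u - v) = rdot w u - rdot w v.
Proof. by move=> *; rewrite rdotDr ?rdotNr//; exact: ell2N. Qed.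

Lemma rdotII u v : rdot (cscale 'i u) (cscale 'i v) = rdot u v.
Proof.
apply: eq_limn_series => n.
by rewrite /cscale !ReImE/=; ring.
Qed.

Lemma cscaleA c c' u : cscale c (cscale c' u) = cscale (c * c') u.
Proof. by apply/funext => n; rewrite /cscale mulrA. Qed.

Lemma cscale1 u : cscale 1 u = u.
Proof. by apply/funext => n; rewrite /cscale mul1r. Qed.

Lemma cscaleDr c u v : cscale c (u + v) = cscale c u + cscale c v.
Proof. by apply/funext => n; rewrite /cscale mulrDr. Qed.

Lemma cscaleN c u : cscale c (- u) = - cscale c u.
Proof. by apply/funext => n; rewrite /cscale mulrN. Qed.

Lemma cscaleNl c u : cscale (- c) u = - cscale c u.
Proof. by apply/funext => n; rewrite /cscale mulNr. Qed.

Lemma cscaleDl c c' u : cscale (c + c') u = cscale c u + cscale c' u.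
Proof. by apply/funext => n; rewrite /cscale mulrDl. Qed.

Lemma cscaleii u : cscale 'i (cscale 'i u) = - u.
Proof. by rewrite cscaleA -cscaleN1 -expr2 sqr_i. Qed.

Lemma rdotIl u v : ell2 u -> ell2 v ->
  rdot (cscale 'i u) v = - rdot u (cscale 'i v).
Proof.
move=> hu hv; rewrite -[LHS]rdotII cscaleii rdotNl//; exact: ell2Z.
Qed.

Lemma rdot_ge0 u : ell2 u -> 0 <= rdot u u.
Proof.
move=> hu; apply: limr_ge; first exact: cvg_rdot.
apply: nearW => n; apply: sumr_ge0 => i _.
by rewrite !ReImE mulrN opprK -!expr2 addr_ge0// sqr_ge0.
Qed.

Lemma sqr_ell2_norm u : ell2 u -> ell2_norm u ^+ 2 = rdot u u.
Proof. by move=> hu; rewrite ell2_normE sqr_sqrtr// rdot_ge0. Qed.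

Lemma ell2_norm_ge0 u : 0 <= ell2_norm u.
Proof. exact: sqrtr_ge0. Qed.

Lemma rdot_sum_le u n : ell2 u ->
  \sum_(0 <= k < n) Normc.normc (u k) ^+ 2 <= rdot u u.
Proof.
move=> hu; have [->|n0] := posnP n; first by rewrite big_geq// rdot_ge0.
have := @nondecreasing_cvgn_le _
  (series (fun n => complex.Re (u n * (u n)^*))) _ (cvg_rdot hu hu) n.
have nE k : complex.Re (u k * (u k)^*) = Normc.normc (u k) ^+ 2.
  by rewrite sqr_normcE !ReImE; ring.
rewrite /rdot /series/=; under eq_bigr do rewrite nE; apply.
by apply: nondecreasing_series => i _ _; rewrite nE sqr_ge0.
Qed.

Lemma normc_le_ell2_norm u n : ell2 u -> Normc.normc (u n) <= ell2_norm u.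
Proof.
move=> hu; rewrite -(@ler_pXn2r _ 2)// ?nnegrE ?normc_ge0 ?ell2_norm_ge0//.
rewrite sqr_ell2_norm// (le_trans _ (rdot_sum_le n.+1 hu))//.
by rewrite big_nat_recr//= lerDr sumr_ge0// => i _; rewrite sqr_ge0.
Qed.

Lemma rdot_eq0 u : ell2 u -> rdot u u = 0 -> u = 0.
Proof.
move=> hu u0; apply/funext => n; apply/eqP; rewrite -normc_eq0.
rewrite eq_le normc_ge0 andbT (le_trans (normc_le_ell2_norm n hu))//.
by rewrite ell2_normE u0 sqrtr0.
Qed.

Lemma rdot_basis u n : rdot u (basis_vec R n) = complex.Re (u n).
Proof.
apply: cvg_lim => //; apply: cvg_near_cst; exists n.+1 => //= k /= nk.
rewrite /series/= (bigD1_seq n)//= ?mem_index_iota ?iota_uniq//.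
rewrite /basis_vec eqxx rmorph1 mulr1 big1 ?addr0//.
by move=> i /negbTE ->; rewrite rmorph0 mulr0.
Qed.

Lemma rdot_basisI u n : ell2 u ->
  rdot u (cscale 'i (basis_vec R n)) = complex.Im (u n).
Proof.
move=> hu; rewrite -[LHS]opprK -rdotIl//; last exact: ell2_basis.
by rewrite rdot_basis ReI opprK.
Qed.

Lemma rdotDD u v : ell2 u -> ell2 v ->
  rdot (u + v) (u + v) = rdot u u + 2 * rdot u v + rdot v v.
Proof.
move=> hu hv; rewrite rdotDl ?rdotDr//; last exact: ell2D.
by rewrite (rdotC v u); ring.
Qed.

Lemma rdotBB u v : ell2 u -> ell2 v ->
  rdot (u - v) (u - v) = rdot u u - 2 * rdot u v + rdot v v.
Proof.
move=> hu hv; have hv' := ell2N hv.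
by rewrite rdotDD// rdotNr// rdotNl// rdotNr//; ring.
Qed.

Lemma rdot_CS u v : ell2 u -> ell2 v ->
  `|rdot u v| <= ell2_norm u * ell2_norm v.
Proof.
move=> hu hv; rewrite -(@ler_pXn2r _ 2)// ?nnegrE ?mulr_ge0 ?ell2_norm_ge0//.
rewrite real_normK ?num_real// exprMn !sqr_ell2_norm//.
have H t : 0 <= rdot u u - 2 * (t * rdot u v) + t ^+ 2 * rdot v v.
  have htv : ell2 (cscale t%:C v) by exact: ell2Z.
  have := rdot_ge0 (ell2B hu htv); rewrite rdotBB// rdotZr// rdotZl// rdotZr//.
  by rewrite expr2 -mulrA.
have [v0|v0] := eqVneq (rdot v v) 0.
  rewrite v0 mulr0; have -> : rdot u v = 0.
    by rewrite (rdot_eq0 hv v0) rdotC rdot0l.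
  by rewrite expr0n.
have v_gt0 : 0 < rdot v v by rewrite lt0r v0 rdot_ge0.
have := H (rdot u v / rdot v v).
rewrite -(pmulr_rge0 _ v_gt0).
have -> : rdot v v * (rdot u u - 2 * (rdot u v / rdot v v * rdot u v) +
  (rdot u v / rdot v v) ^+ 2 * rdot v v) =
  rdot u u * rdot v v - rdot u v ^+ 2 by field.
by rewrite subr_ge0.
Qed.

Lemma ell2_normD u v : ell2 u -> ell2 v ->
  ell2_norm (u + v) <= ell2_norm u + ell2_norm v.
Proof.
move=> hu hv.
rewrite -(@ler_pXn2r _ 2)// ?nnegrE ?addr_ge0 ?ell2_norm_ge0//.
rewrite sqr_ell2_norm; last exact: ell2D.
rewrite rdotDD// sqrrD !sqr_ell2_norm//.
have := ler_norm (rdot u v); have := rdot_CS hu hv; rewrite mulr2n; lra.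
Qed.

Lemma ell2_normN u : ell2 u -> ell2_norm (- u) = ell2_norm u.
Proof.
by move=> hu; rewrite !ell2_normE rdotNl ?rdotNr ?opprK//; exact: ell2N.
Qed.

Lemma ell2_normZ c u : ell2 u ->
  ell2_norm (cscale c u) = Normc.normc c * ell2_norm u.
Proof.
move=> hu; rewrite !ell2_normE.
have -> : Normc.normc c = Num.sqrt (Normc.normc c ^+ 2).
  by rewrite sqrtr_sqr ger0_norm// normc_ge0.
rewrite -sqrtrM ?sqr_ge0//; congr Num.sqrt.
apply: cvg_lim => //.
rewrite (_ : (fun n => _) =
    (Normc.normc c ^+ 2) *: (fun n => complex.Re (u n * (u n)^*))).
  by rewrite seriesZ; apply: cvgZl_tmp; exact: rdot_cvg.
apply/funext => k; rewrite -[RHS]/(_ * _) sqr_normcE /cscale !ReImE; ring.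
Qed.

Lemma ell2_normB u v : ell2 u -> ell2 v ->
  ell2_norm (u - v) <= ell2_norm u + ell2_norm v.
Proof.
by move=> hu hv; rewrite -(ell2_normN hv) ell2_normD//; exact: ell2N.
Qed.

End SquareSummableSequences.

Arguments ell2Z {R} c {u} _.
Arguments ell2_basis {R} n.

(** * The domain of the Jacobi operator *)

Section Truncation.
Variable R : realType.
Implicit Types (u v w : cseq R).

Lemma rdot_partial u n : \sum_(0 <= k < n) Normc.normc (u k) ^+ 2 =
  series (fun n => complex.Re (u n * (u n)^*)) n.
Proof.
rewrite /series/=; apply: eq_bigr => k _.
by rewrite sqr_normcE !ReImE; ring.
Qed.

Lemma ell2_bound u M :
  (forall n, \sum_(0 <= k < n) Normc.normc (u k) ^+ 2 <= M) ->
  ell2 u /\ rdot u u <= M.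
Proof.
move=> uM; have hu : ell2 u.
  apply: nondecreasing_is_cvgn.
    by apply: nondecreasing_series => i _ _; rewrite sqr_ge0.
  by exists M => _ [n _ <-]; exact: uM.
split => //; apply: limr_le; first exact: cvg_rdot.
by apply: nearW => n; rewrite -rdot_partial.
Qed.

Lemma ell2_dominated u v : ell2 v ->
  (forall n, Normc.normc (u n) <= Normc.normc (v n)) ->
  ell2 u /\ ell2_norm u <= ell2_norm v.
Proof.
move=> hv uv; have [hu uuvv] : ell2 u /\ rdot u u <= rdot v v.
  apply: ell2_bound => n; apply: le_trans (rdot_sum_le n hv).
  by apply: ler_sum => k _; rewrite ler_pXn2r// ?nnegrE ?normc_ge0.
by split=> //; rewrite !ell2_normE ler_wsqrtr.
Qed.

Lemma ell2_norm_dominated u v : ell2 v ->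
  (forall n, Normc.normc (u n) <= Normc.normc (v n)) ->
  ell2_norm u <= ell2_norm v.
Proof. by move=> hv /(ell2_dominated hv)[]. Qed.

(** Passing to moduli turns a pointwise bound by [|v n| + |w n|] into domination by a single
    sequence of ell2, to which the triangle inequality applies. *)
Definition abs_seq u : cseq R := fun n => (Normc.normc (u n))%:C.

Lemma normc_abs_seq u n : Normc.normc (abs_seq u n) = Normc.normc (u n).
Proof. by rewrite normc_real ger0_norm// normc_ge0. Qed.

Lemma ell2_abs u : ell2 u -> ell2 (abs_seq u).
Proof.
by move=> hu; have [] // := @ell2_dominated (abs_seq u) u hu => n;
  rewrite normc_abs_seq.
Qed.

Lemma ell2_norm_abs u : ell2 u -> ell2_norm (abs_seq u) <= ell2_norm u.
Proof.
by move=> hu; apply: ell2_norm_dominated => // n; rewrite normc_abs_seq.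
Qed.

Lemma normc_abs_seqD u v n : Normc.normc ((abs_seq u + abs_seq v) n) =
  Normc.normc (u n) + Normc.normc (v n).
Proof.
rewrite -[(_ + _) n]/(_ + _) -rmorphD normc_real ger0_norm//.
by rewrite addr_ge0// normc_ge0.
Qed.

Lemma ell2_norm_dominatedD u v w : ell2 v -> ell2 w ->
  (forall n, Normc.normc (u n) <= Normc.normc (v n) + Normc.normc (w n)) ->
  ell2_norm u <= ell2_norm v + ell2_norm w.
Proof.
move=> hv hw uvw; have hv' := ell2_abs hv; have hw' := ell2_abs hw.
apply: le_trans (lerD (ell2_norm_abs hv) (ell2_norm_abs hw)).
apply: le_trans (ell2_normD hv' hw').
by apply: ell2_norm_dominated => [|n]; [exact: ell2D|rewrite normc_abs_seqD].
Qed.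

Definition tail (k : nat) u : cseq R := fun n => if (k <= n)%N then u n else 0.

Lemma ell2_tail k u : ell2 u -> ell2 (tail k u).
Proof.
move=> hu; have [] // := @ell2_dominated (tail k u) u hu => n; rewrite /tail.
by case: ifP => // _; rewrite Normc.normc0 normc_ge0.
Qed.

Arguments ell2_tail : clear implicits.

Lemma rdot_tail k u : ell2 u ->
  rdot (tail k u) (tail k u) =
  rdot u u - \sum_(0 <= n < k) Normc.normc (u n) ^+ 2.
Proof.
move=> hu; apply: cvg_lim => //.
have := cvgB (rdot_cvg hu hu)
  (cvg_cst (\sum_(0 <= n < k) Normc.normc (u n) ^+ 2)).
move=> /(_ _ _) H; apply: cvg_trans H; apply: near_eq_cvg; exists k => //= n /= kn.
rewrite !fctE -!rdot_partial [in LHS](@big_cat_nat _ _ _ k)//=.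
rewrite addrAC subrr add0r [RHS](@big_cat_nat _ _ _ k)//=.
rewrite [X in _ = X + _]big_nat_cond [X in _ = X + _]big1 ?add0r => [|i].
  by apply: eq_big_nat => i /andP[ki _]; rewrite /tail ki.
by rewrite andbT /= => ik; rewrite /tail leqNgt ik/= Normc.normc0 expr0n.
Qed.

Lemma cvg_tail u : ell2 u -> ell2_norm (tail k u) @[k --> \oo] --> (0 : R).
Proof.
move=> hu; rewrite -(sqrtr0 R).
rewrite (_ : (fun k => _) = (fun k => Num.sqrt (rdot (tail k u) (tail k u)))).
  apply: continuous_cvg; first exact: sqrt_continuous.
  under eq_fun do rewrite rdot_tail// rdot_partial.
  rewrite -(subrr (rdot u u)); apply: cvgB; first exact: cvg_cst.
  exact: rdot_cvg.
by apply/funext => k; rewrite ell2_normE.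
Qed.

Definition lshift u : cseq R := fun n => u n.+1.
Definition rshift u : cseq R := fun n => if n is m.+1 then u m else 0.

Lemma ell2_lshift u : ell2 u -> ell2 (lshift u) /\ ell2_norm (lshift u) <= ell2_norm u.
Proof.
move=> hu; have [h1 h2] : ell2 (lshift u) /\ rdot (lshift u) (lshift u) <= rdot u u.
  apply: ell2_bound => n; apply: le_trans (rdot_sum_le n.+1 hu).
  by rewrite big_nat_recl//= lerDr sqr_ge0.
by split=> //; rewrite !ell2_normE ler_wsqrtr.
Qed.

Lemma ell2_rshift u : ell2 u -> ell2 (rshift u) /\ ell2_norm (rshift u) <= ell2_norm u.
Proof.
move=> hu; have [h1 h2] : ell2 (rshift u) /\ rdot (rshift u) (rshift u) <= rdot u u.
  apply: ell2_bound => -[|n]; first by rewrite big_geq// rdot_ge0.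
  apply: le_trans (rdot_sum_le n hu).
  by rewrite big_nat_recl//= Normc.normc0 expr0n add0r.
by split=> //; rewrite !ell2_normE ler_wsqrtr.
Qed.

End Truncation.

Arguments ell2_tail {R} k u _.

Section JacobiDomain.
Variables (R : realType) (a b : nat -> R).
Hypothesis a_gt0 : forall n, 0 < a n.
Implicit Types (u v w : cseq R).

Lemma jacobi_actionD u v :
  jacobi_action a b (u + v) = jacobi_action a b u + jacobi_action a b v.
Proof.
by apply/funext => -[|n]; rewrite !fctE /=; ring.
Qed.

Lemma jacobi_actionZ c u :
  jacobi_action a b (cscale c u) = cscale c (jacobi_action a b u).
Proof. by apply/funext => -[|n]; rewrite /cscale /=; ring. Qed.

Lemma jacobi_actionN u : jacobi_action a b (- u) = - jacobi_action a b u.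
Proof. by rewrite -!cscaleN1 jacobi_actionZ. Qed.

Lemma jacobi_actionB u v :
  jacobi_action a b (u - v) = jacobi_action a b u - jacobi_action a b v.
Proof. by rewrite jacobi_actionD jacobi_actionN. Qed.

Lemma normc_jacobi_action u n M : (forall k, Normc.normc (u k) <= M) ->
  Normc.normc (jacobi_action a b u n) <= (a n.-1 + `|b n| + a n) * M.
Proof.
move=> uM; have M0 : 0 <= M by exact: le_trans (normc_ge0 _) (uM 0%N).
have nm (c : R) k : Normc.normc (c%:C * u k) <= `|c| * M.
  by rewrite Normc.normcM normc_real ler_wpM2l.
have a_norm k : `|a k| = a k by rewrite gtr0_norm.
case: n => [|n] /=.
  rewrite (le_trans (ler_normcD _ _))//.
  have := nm (b 0%N) 0%N; have := nm (a 0%N) 1%N; rewrite a_norm.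
  have := mulr_ge0 (ltW (a_gt0 0%N)) M0; lra.
rewrite (le_trans (ler_normcD _ _))//.
have := ler_normcD ((a n)%:C * u n) ((b n.+1)%:C * u n.+1).
have := nm (a n) n; have := nm (b n.+1) n.+1; have := nm (a n.+1) n.+2.
by rewrite !a_norm !mulrDl; lra.
Qed.

(** A coordinate of the action involves at most three coordinates of [u], so it is continuous in the
    norm of ell2; hence the limits [u] and [w] in the closure are still related coordinate by
    coordinate. *)
Lemma jacobi_operator_action u w : jacobi_operator a b (u, w) ->
  [/\ ell2 u, ell2 w & w = jacobi_action a b u].
Proof.
move=> [/= hu hw [v [vfin vu vw]]]; split=> //; apply/funext => n; apply/eqP.
rewrite -subr_eq0 -normc_eq0 eq_le normc_ge0 andbT.
have hv k : ell2 (v k).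
  have [N _ vN] := vfin k; apply: (@ell2_fin _ _ N) => i; exact: vN.
have hJv k : ell2 (jacobi_action a b (v k)).
  have [N _ vN] := vfin k; apply: (@ell2_fin _ _ N.+1) => -[//|i] Ni.
  by rewrite /= !vN ?mulr0 ?addr0//= ?leqW.
set C := a n.-1 + `|b n| + a n.
have lim0 : ell2_norm (jacobi_action a b (v k) - w) +
    C * ell2_norm (v k - u) @[k --> \oo] --> (0 : R).
  rewrite -[X in _ --> X](addr0 0) -[X in _ --> _ + X](mulr0 C).
  by apply: cvgD => //; apply: cvgMl_tmp.
apply: cvgr_to_ge lim0 _; apply: nearW => k.
rewrite [w n - _](_ : _ = jacobi_action a b (v k - u) n -
    (jacobi_action a b (v k) - w) n); last first.
  by rewrite jacobi_actionB !fctE; ring.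
rewrite (le_trans (ler_normcB _ _))// addrC lerD//.
  by apply: normc_le_ell2_norm; exact: ell2B.
rewrite (le_trans (@normc_jacobi_action _ _ (ell2_norm (v k - u)) _))// => i.
by apply: normc_le_ell2_norm; exact: ell2B.
Qed.

(** Constant up to [k], then descending by [1 / a_j] at step [j]. The slope is chosen so that the
    commutator with the action has coefficients bounded by 1 and supported from [k] on; the
    divergence of the sum of [1 / a_j] brings the cutoff down to 0 after finitely many steps. *)
Definition cutoff (k n : nat) : R :=
  Num.max 0 (1 - \sum_(k <= j < n) (a j)^-1).

Lemma cutoff_bound k n : 0 <= cutoff k n <= 1.
Proof.
rewrite /cutoff le_max lexx/= ge_max ler01/= gerBl sumr_ge0// => i _.
by rewrite invr_ge0 ltW.
Qed.

Lemma cutoff1 k n : (n <= k)%N -> cutoff k n = 1.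
Proof. by move=> nk; rewrite /cutoff big_geq// subr0; apply/max_idPr. Qed.

Lemma cutoff_slope k n :
  a n * `|cutoff k n.+1 - cutoff k n| <= (k <= n)%N%:R.
Proof.
case: leqP => kn; last by rewrite !cutoff1 ?subrr ?normr0 ?mulr0// ltnW.
rewrite /cutoff big_nat_recr//=.
set s := \sum_(_ <= _ < _) _; set t := (a n)^-1.
have t0 : 0 < t by rewrite invr_gt0.
have -> : true%:R = a n * t by rewrite mulfV// lt0r_neq0.
rewrite ler_wpM2l ?(ltW (a_gt0 n))//; case: (leP 0 (1 - s)) => h1; case: (leP 0 (1 - (s + t))) => h2;
  rewrite ler_norml; apply/andP; split; lra.
Qed.

Hypothesis carleman : series (fun n => (a n)^-1) n @[n --> \oo] --> +oo.

Lemma cutoff_fin k : \forall n \near \oo, cutoff k n = 0.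
Proof.
have /cvgryPge/(_ (1 + series (fun n => (a n)^-1) k)) [N _ H] := carleman.
exists (maxn N k) => // n /=; rewrite geq_max => /andP[Nn kn].
have := H n Nn; rewrite /series/= (@big_cat_nat _ _ _ k _ n)//= => h.
by apply/max_idPl; lra.
Qed.

(** The truncations by [cutoff k] converge to [u] in the graph norm, because the commutator of the
    cutoff with the action is dominated by two shifted copies of a tail of [u]. This is where
    Carleman's condition makes the closure as large as the maximal operator. *)
Lemma jacobi_operator_max u : ell2 u -> ell2 (jacobi_action a b u) ->
  jacobi_operator a b (u, jacobi_action a b u).
Proof.
move=> hu hw; set w := jacobi_action a b u.
split=> //=; exists (fun k n => (cutoff k n)%:C * u n); split.
- move=> k; have [N _ H] := cutoff_fin k; exists N => //= n Nn.
  by rewrite (H n Nn) mul0r.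
- apply: (@squeeze_cvgr _ _ _ _ (fun=> 0) (fun k => ell2_norm (tail k u))).
  + apply: nearW => k; rewrite ell2_norm_ge0/=.
    apply: ell2_norm_dominated => [|n]; [exact: ell2_tail|rewrite /tail].
    case: leqP => kn; last by rewrite cutoff1 ?mul1r ?subrr// ltnW.
    rewrite -[X in _ - X]mul1r -mulrBl Normc.normcM -[1]/(1%:C) -rmorphB/=.
    rewrite normc_real ler_piMl ?normc_ge0//.
    by have /andP[? ?] := cutoff_bound k n; rewrite ler_norml; apply/andP; split; lra.
  + exact: cvg_cst.
  + exact: cvg_tail.
- have tl k := ell2_lshift (ell2_tail k u hu).
  have tr k := ell2_rshift (ell2_tail k u hu).
  apply: (@squeeze_cvgr _ _ _ _ (fun=> 0) (fun k => ell2_norm (tail k w) +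
    (ell2_norm (tail k u) + ell2_norm (tail k u)))).
  + apply: nearW => k; rewrite ell2_norm_ge0/=.
    have hl := ell2_abs (tl k).1; have hr := ell2_abs (tr k).1.
    set y := abs_seq (lshift (tail k u)) + abs_seq (rshift (tail k u)).
    have ny : ell2_norm y <= ell2_norm (tail k u) + ell2_norm (tail k u).
      apply: le_trans (lerD (tl k).2 (tr k).2).
      apply: ell2_norm_dominatedD (tl k).1 (tr k).1 _ => n.
      by rewrite normc_abs_seqD.
    apply: le_trans (lerD (lexx _) ny).
    apply: ell2_norm_dominatedD (ell2_tail k w hw) (ell2D hl hr) _ => n.
    rewrite normc_abs_seqD.
    have wn : Normc.normc ((cutoff k n - 1)%:C * w n) <= Normc.normc (tail k w n).
      rewrite /tail; case: leqP => kn; last first.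
        by rewrite cutoff1 ?subrr ?mul0r// ltnW.
      rewrite Normc.normcM normc_real ler_piMl ?normc_ge0//.
      by have /andP[? ?] := cutoff_bound k n; rewrite ler_norml; apply/andP; split; lra.
    have Ln m : Normc.normc ((a m * (cutoff k m.+1 - cutoff k m))%:C * u m.+1) <=
        Normc.normc (lshift (tail k u) m).
      rewrite Normc.normcM normc_real normrM gtr0_norm// /lshift /tail.
      case: (leqP k m.+1) => km.
        by rewrite ler_piMl ?normc_ge0// (le_trans (cutoff_slope k m))// lern1 leq_b1.
      by rewrite !cutoff1 ?subrr ?normr0 ?mulr0 ?mul0r ?Normc.normc0// ltnW// ltnW.
    have Rn m : Normc.normc ((a m * (cutoff k m - cutoff k m.+1))%:C * u m) <=
        Normc.normc (rshift (tail k u) m.+1).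
      rewrite Normc.normcM normc_real normrM gtr0_norm// distrC /tail /=.
      rewrite (le_trans (ler_wpM2r (normc_ge0 _) (cutoff_slope k m)))//.
      by case: leqP => km; rewrite ?mul1r// mul0r Normc.normc0.
    (* Leibniz rule: [cutoff - 1] multiplies [w], and each neighbouring value of [u] is weighted by
       an increment of the cutoff; there is no left neighbour at index 0. *)
    case: n wn => [|n] wn.
      rewrite [X in Normc.normc X](_ : _ = (cutoff k 0 - 1)%:C * w 0%N +
          (a 0%N * (cutoff k 1 - cutoff k 0))%:C * u 1%N); last first.
        by rewrite /w /= !(rmorphM, rmorphB, rmorph1) /=; ring.
      rewrite (le_trans (ler_normcD _ _))// lerD//.
      by rewrite (le_trans (Ln 0%N))// lerDl normc_ge0.
    rewrite [X in Normc.normc X](_ : _ = (cutoff k n.+1 - 1)%:C * w n.+1 +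
        ((a n.+1 * (cutoff k n.+2 - cutoff k n.+1))%:C * u n.+2 +
        (a n * (cutoff k n - cutoff k n.+1))%:C * u n)); last first.
      by rewrite /w /= !(rmorphM, rmorphB, rmorph1) /=; ring.
    rewrite (le_trans (ler_normcD _ _))// lerD//.
    by rewrite (le_trans (ler_normcD _ _))// lerD// ?Rn ?Ln.
  + exact: cvg_cst.
  + rewrite -[X in _ --> X](addr0 0) -[X in _ --> _ + X](addr0 0).
    by apply: cvgD; [|apply: cvgD]; exact: cvg_tail.
Qed.

Lemma jacobi_operatorP u w : jacobi_operator a b (u, w) <->
  [/\ ell2 u, ell2 w & w = jacobi_action a b u].
Proof.
split=> [|[hu hw e]]; first exact: jacobi_operator_action.
by rewrite e; apply: jacobi_operator_max => //; rewrite -e.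
Qed.

End JacobiDomain.

(** * The spectral family *)

Section MeasuresOnTheLine.
Variable R : realType.
Implicit Types (m : {measure set (measurableTypeR R) -> \bar R}).

Lemma measure_eq_rays (m1 m2 : {measure set (measurableTypeR R) -> \bar R}) :
  (m1 setT < +oo)%E -> m1 setT = m2 setT ->
  (forall x : R, m1 `]-oo, x]%classic = m2 `]-oo, x]%classic) ->
  forall B, measurable B -> m1 B = m2 B.
Proof.
move=> m1oo m12T m12 B mB.
pose G : set (set (measurableTypeR R)) := range (fun x : R => `]-oo, x]%classic).
apply: (g_sigma_algebra_measure_unique_trace G setT) => //.
- by move=> _ [[x _ <-] _].
- move=> _ _ [[x _ <-] _] [[y _ <-] _]; split => //.
  exists (Num.min x y) => //; apply/seteqP; split => t /=; rewrite !in_itv/=.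
    by rewrite le_min => /andP.
  by rewrite le_min => -[-> ->].
- by move=> _ [[x _ <-] _].
have sG : sigma_algebra setT <<s setT, [set X | G X /\ X `<=` setT] >>.
  exact: smallest_sigma_algebra.
move: B mB; apply: smallest_sub => //= _ [[x y] _ <-].
have -> : `]x, y]%classic =
    setT `\` ((setT `\` `]-oo, y]%classic) `|` `]-oo, x]%classic).
  apply/seteqP; split => t /=; rewrite !in_itv/=.
    move=> /andP[xt ty]; split=> // -[[_]|]; first by rewrite ty.
    by rewrite leNgt xt.
  move=> [_ /not_orP[/not_andP[//|/contrapT ->]]] /negP.
  by rewrite -ltNge => ->.
have hray z : <<s setT, [set X | G X /\ X `<=` setT] >> `]-oo, z]%classic.
  by apply: sub_sigma_algebra; split => //; exists z.
have [s0 sD sU] := sG.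
apply: (sD); rewrite -bigcup2E; apply: sU => -[|[|k]] //=; exact: sD.
Qed.

Lemma integrable_id_sqr (mu : {measure set (measurableTypeR R) -> \bar R}) :
  (mu setT < +oo)%E -> (\int[mu]_x (x ^+ 2)%:E < +oo)%E ->
  mu.-integrable setT (EFin \o (id : measurableTypeR R -> R)).
Proof.
move=> muoo x2; have m1 : mu.-integrable setT (EFin \o (cst 1 : R -> R)).
  by apply: measurable_bounded_integrable => //; exact: bounded_cst.
have m2 : mu.-integrable setT (EFin \o (fun x : measurableTypeR R => x ^+ 2)).
  apply/integrableP; split; first by apply/measurable_EFinP; exact: measurable_funX.
  move: x2; congr (_ < _)%E; apply: eq_integral => x _.
  by rewrite /= ger0_norm ?sqr_ge0.
apply: (le_integrable measurableT _ _ (integrableD measurableT m1 m2)).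
  by apply/measurable_EFinP; exact: measurable_id.
move=> x _ /=; rewrite lee_fin [leRHS]ger0_norm ?addr_ge0 ?sqr_ge0//.
have := sqr_ge0 (`|x| - 1); have := sqr_ge0 (`|x|).
by rewrite -(real_normK (num_real x)); nra.
Qed.

Lemma measurable_lorentzian (l e : R) : 0 < e ->
  measurable_fun setT (fun t : measurableTypeR R => ((t - l) ^+ 2 + e ^+ 2)^-1).
Proof.
move=> e0; apply: continuous_measurable_fun => t; apply: cvgV.
  by rewrite gt_eqF// ltr_wpDl ?sqr_ge0// exprn_gt0.
apply: cvgD; last exact: cvg_cst.
by apply: (@continuous_comp _ _ _ (fun t => t - l) (fun t => t ^+ 2));
  [apply: cvgB; [exact: cvg_id|exact: cvg_cst]|exact: exprn_continuous].
Qed.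

Lemma measureCU (m : {measure set (measurableTypeR R) -> \bar R})
    (B : set (measurableTypeR R)) :
  measurable B -> m setT = (m B + m (~` B))%E.
Proof.
move=> mB; rewrite -measureU ?setUCr ?setICr//; exact: measurableC.
Qed.

(** Intervals of the single length [d] tile []- n d, n d]], so the comparison adds up there and
    passes to the whole line as [n] grows. A local estimate with a constant uniform in the position
    thus becomes global. *)
Lemma measure_le_grid (m1 m2 : {measure set (measurableTypeR R) -> \bar R})
    (k d : R) : 0 <= k -> 0 < d ->
  (forall x : R, m1 `]x, (x + d)%R]%classic <=
    k%:E * m2 `]x, (x + d)%R]%classic)%E ->
  (m1 setT <= k%:E * m2 setT)%E.
Proof.
move=> k0 d0 step.
have grid n (x : R) : (m1 `]x, (x + n%:R * d)%R]%classic <=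
    k%:E * m2 `]x, (x + n%:R * d)%R]%classic)%E.
  elim: n x => [|n IH] x.
    by rewrite mul0r addr0 set_itvoc0 !measure0 mule0.
  have e : `]x, x + n.+1%:R * d]%classic =
      `]x, x + d]%classic `|` `]x + d, x + d + n%:R * d]%classic.
    have d_ge0 : 0 <= n%:R * d by rewrite mulr_ge0// ltW.
    rewrite -natr1 mulrDl mul1r; apply/seteqP; split=> t /=; rewrite !in_itv/=.
      move=> /andP[-> h2]; case: (leP t (x + d)) => h3; [by left|right].
      by rewrite /=; lra.
    by move=> [] /andP[h1 h2]; apply/andP; split; lra.
  have disj : `]x, x + d]%classic `&` `]x + d, x + d + n%:R * d]%classic = set0.
    apply/seteqP; split=> // t /=; rewrite !in_itv/= => -[/andP[_ h1] /andP[h2 _]].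
    by move: (le_lt_trans h1 h2); rewrite ltxx.
  rewrite e !measureU// ge0_muleDr//.
  by apply: leeD; [exact: step|exact: IH].
have cvg1 : m1 `](- n%:R * d)%R, (n%:R * d)%R]%classic @[n --> \oo] --> m1 setT.
  have -> : [set: measurableTypeR R] =
      \bigcup_n `](- n%:R * d)%R, (n%:R * d : R)]%classic.
    apply/seteqP; split=> // x _; exists (Num.bound (`|x| / d)) => //=.
    have /archi_boundP : 0 <= `|x| / d by rewrite divr_ge0// ltW.
    rewrite ltr_pdivrMr// ltr_norml => /andP[h1 h2].
    by rewrite in_itv/= mulNr h1 ltW.
  apply: nondecreasing_cvg_mu; first by [].
    exact: bigcupT_measurable.
  move=> m n mn; apply/subsetPset => x /=; rewrite !in_itv/= !mulNr.
  have mnd : m%:R * d <= n%:R * d by rewrite ler_pM2r// ler_nat.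
  by move=> /andP[h1 h2]; apply/andP; split; lra.
apply: (@cvge_to_le _ _ _ _ _ _ _ cvg1); apply: nearW => n.
have -> : n%:R * d = - n%:R * d + (n + n)%:R * d by rewrite natrD; ring.
apply: (le_trans (grid _ _)); rewrite lee_wpmul2l//.
by apply: le_measure; rewrite ?inE.
Qed.

End MeasuresOnTheLine.

Section Density.
Context d (T : measurableType d) (R : realType).
Variables (mu : {measure set T -> \bar R}) (f : T -> \bar R).
Hypotheses (f0 : forall x, (0 <= f x)%E) (mf : measurable_fun setT f).

Definition density (A : set T) : \bar R := (\int[mu]_(x in A) f x)%E.

Lemma density0 : density set0 = 0%E.
Proof. exact: integral_set0. Qed.

Lemma density_ge0 A : (0 <= density A)%E.
Proof. by apply: integral_ge0 => x _. Qed.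

Lemma density_semi_sigma_additive : semi_sigma_additive density.
Proof.
move=> F mF tF mUF; rewrite /density ge0_integral_bigcup//.
  by apply: is_cvg_nneseries => n _ _; exact: density_ge0.
exact: measurable_funTS.
Qed.

HB.instance Definition _ := isMeasure.Build _ _ _ density
  density0 density_ge0 density_semi_sigma_additive.

Definition density_measure : {measure set T -> \bar R} := density.

End Density.

(** * Commutation of the operator with its spectral family; spectral bands *)

Section SpectralFamily.
Variables (R : realType) (a b : nat -> R).
Hypothesis a_gt0 : forall n, 0 < a n.
Hypothesis carleman : series (fun n => (a n)^-1) n @[n --> \oo] --> +oo.
Variable E : R -> cseq R -> cseq R.
Hypothesis hE : spectral_family (jacobi_operator a b) E.
Implicit Types (u v w g : cseq R) (x y c : R).
Let A := jacobi_action a b.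

Definition jacobi_domain u := ell2 u /\ ell2 (jacobi_action a b u).
Local Notation dom := jacobi_domain.

Lemma dom_ell2 u : dom u -> ell2 u. Proof. by case. Qed.

Lemma dom_action u : dom u -> ell2 (A u). Proof. by case. Qed.

Lemma domD u v : dom u -> dom v -> dom (u + v).
Proof.
by move=> [hu hAu] [hv hAv]; split; rewrite ?jacobi_actionD; exact: ell2D.
Qed.

Lemma domZ (c : R[i]) u : dom u -> dom (cscale c u).
Proof. by move=> [hu hAu]; split; rewrite ?jacobi_actionZ; exact: ell2Z. Qed.

Lemma domN u : dom u -> dom (- u).
Proof. by rewrite -cscaleN1; exact: domZ. Qed.

Lemma domB u v : dom u -> dom v -> dom (u - v).
Proof. by move=> hu hv; apply: domD => //; exact: domN. Qed.

Lemma dom_basis n : dom (basis_vec R n).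
Proof.
split; first exact: ell2_basis.
apply: (@ell2_fin _ _ n.+2) => -[//|k] nk /=.
by rewrite /basis_vec !gtn_eqF ?mulr0 ?addr0// ?leqW.
Qed.

Lemma dom_graph u : (exists w, jacobi_operator a b (u, w)) <-> dom u.
Proof.
split=> [[w /(jacobi_operatorP b a_gt0 carleman)[hu hw e]]|[hu hw]].
  by split; rewrite // -e.
by exists (A u); apply/(jacobi_operatorP b a_gt0 carleman).
Qed.

Lemma E_ell2 x u : ell2 u -> ell2 (E x u).
Proof. exact: sf_ell2 hE _ _. Qed.

Lemma E_D x u v : ell2 u -> ell2 v -> E x (u + v) = E x u + E x v.
Proof.
move=> hu hv; have := sf_linear hE x 1 hu hv.
rewrite (_ : (fun n => 1 * u n + v n) = u + v) => [->|].
  by apply/funext => n; rewrite mul1r.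
by apply/funext => n; rewrite mul1r.
Qed.

Lemma E_0 x : E x 0 = 0.
Proof.
have := E_D x (@ell2_0 R) (@ell2_0 R); rewrite addr0 => /eqP.
by rewrite -[X in X == _]addr0 (inj_eq (addrI _)) eq_sym => /eqP.
Qed.

Lemma E_Z x (c : R[i]) u : ell2 u -> E x (cscale c u) = cscale c (E x u).
Proof.
move=> hu; have := sf_linear hE x c hu (@ell2_0 R).
rewrite (_ : (fun n => c * u n + _ n) = cscale c u) => [->|].
  by rewrite E_0; apply/funext => n; rewrite addr0.
by apply/funext => n; rewrite addr0.
Qed.

Lemma E_N x u : ell2 u -> E x (- u) = - E x u.
Proof. by move=> hu; rewrite -!cscaleN1 E_Z. Qed.

Lemma E_B x u v : ell2 u -> ell2 v -> E x (u - v) = E x u - E x v.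
Proof. by move=> hu hv; rewrite E_D ?E_N//; exact: ell2N. Qed.

Lemma rdot_E x u v : ell2 u -> ell2 v -> rdot (E x u) v = rdot u (E x v).
Proof.
by move=> hu hv; have := sf_selfadjoint hE x hu hv; rewrite !ell2_dotE => -[].
Qed.

Lemma E_min x y u : ell2 u -> E x (E y u) = E (Num.min x y) u.
Proof. exact: sf_mul hE _ _ _. Qed.

Lemma E_E x u : ell2 u -> E x (E x u) = E x u.
Proof. by move=> hu; rewrite E_min// minxx. Qed.

Lemma E_C x y u : ell2 u -> E x (E y u) = E y (E x u).
Proof. by move=> hu; rewrite !E_min// minC. Qed.

Lemma spectral_measureE u (mu : {measure set (measurableTypeR R) -> \bar R}) x :
  spectral_measure E u mu -> mu `]-oo, x]%classic = (rdot (E x u) u)%:E.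
Proof. by move=> ->; rewrite ell2_dotE. Qed.

Lemma spectral_measureT u (mu : {measure set (measurableTypeR R) -> \bar R}) :
  ell2 u -> spectral_measure E u mu -> mu setT = (rdot u u)%:E.
Proof.
move=> hu hmu.
have cvg1 : mu `]-oo, n%:R]%classic @[n --> \oo] --> mu setT.
  have -> : [set: R] = \bigcup_n `]-oo, (n%:R : R)]%classic.
    apply/seteqP; split=> // x _; exists (Num.bound `|x|) => //=.
    by rewrite in_itv/= ltW// (le_lt_trans (ler_norm x))// archi_boundP.
  apply: nondecreasing_cvg_mu; first by [].
    exact: bigcupT_measurable.
  move=> m n mn.
  by apply/subsetPset => x /=; rewrite !in_itv/= => /le_trans; apply; rewrite ler_nat.
have cvg2 : rdot (E n%:R u) u @[n --> \oo] --> rdot u u.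
  apply/cvgrPdist_le => e e0.
  have /cvgrPdist_le/(_ (e / (ell2_norm u + 1))) H := sf_pinfty hE hu.
  have u1 : 0 < ell2_norm u + 1 by rewrite ltr_wpDl// ell2_norm_ge0.
  have [M [_ HM]] := H (divr_gt0 e0 u1).
  have [N _ HN] : \forall n \near \oo, M < n%:R :> R.
    exact: nbhs_infty_gtr.
  exists N => // n /= Nn; have := HM _ (HN _ Nn).
  rewrite sub0r normrN ger0_norm ?ell2_norm_ge0// => h.
  have hd : ell2 (E n%:R u - u) by apply: ell2B => //; exact: E_ell2.
  rewrite distrC -rdotBl//; last exact: E_ell2.
  apply: (le_trans (rdot_CS hd hu)).
  apply: (@le_trans _ _ (e / (ell2_norm u + 1) * (ell2_norm u + 1))).
    by rewrite ler_pM ?ell2_norm_ge0// lerDl.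
  by rewrite divfK// gt_eqF.
apply: (cvg_unique _ cvg1); first exact: ereal_hausdorff.
rewrite (_ : (fun n : nat => _) = (fun n : nat => (rdot (E n%:R u) u)%:E)).
  exact: cvg_EFin (nearW _ _) cvg2.
by apply/funext => n; rewrite (spectral_measureE _ hmu).
Qed.

Lemma spectral_integral u : ell2 u ->
  exists mu : {measure set (measurableTypeR R) -> \bar R},
    [/\ forall x, mu `]-oo, x]%classic = (rdot (E x u) u)%:E,
        mu setT = (rdot u u)%:E,
        dom u <-> (\int[mu]_x (x ^+ 2)%:E < +oo)%E &
        dom u -> rdot (A u) u = (\int[mu]_x x)%R /\
                 rdot (A u) (cscale 'i u) = 0].
Proof.
move=> hu; have [mu [hmu hdom hint]] := sf_integral hE hu; exists mu; split.
- by move=> x; rewrite (spectral_measureE _ hmu).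
- exact: spectral_measureT.
- by rewrite -hdom dom_graph.
- move=> [hu' hAu].
  have /(jacobi_operatorP b a_gt0 carleman)/hint : [/\ ell2 u, ell2 (A u) & A u = A u] by [].
  by rewrite ell2_dotE => -[].
Qed.

(** [<Au, u>] is the integral of a real function, hence real; applied to [u + i v] this gives the
    symmetry by polarization. *)
Lemma action_symmetric u v : dom u -> dom v -> rdot (A u) v = rdot u (A v).
Proof.
have im0 w : dom w -> rdot (A w) (cscale 'i w) = 0.
  by move=> hw; have [mu [_ _ _ /(_ hw)[]]] := spectral_integral (dom_ell2 hw).
move=> hu hv; have hv' := domZ 'i hv.
have hiv := ell2Z 'i (dom_ell2 hv'); have hiu := ell2Z 'i (dom_ell2 hu).
have [hu2 hAu] := hu; have [hv2 hAv] := hv'.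
have := im0 _ (domD hu hv').
rewrite /A jacobi_actionD cscaleDr !rdotDl ?rdotDr ?im0//; do ?exact: ell2D.
rewrite -/A ?im0// ?add0r ?addr0 cscaleii rdotNr//; last exact: dom_ell2.
rewrite /A jacobi_actionZ rdotII -/A => /eqP.
by rewrite addrC subr_eq0 => /eqP <-; rewrite rdotC.
Qed.

(** With [g] in the range of [E x] and [h] in its kernel, the cross terms [<E y g, h>] vanish for
    every [y], because the projections commute. So the values on rays add up, and with them the
    measures. *)
Lemma spectral_additive x g h
    (mu nu ka : {measure set (measurableTypeR R) -> \bar R}) :
  ell2 g -> ell2 h -> E x g = g -> E x h = 0 ->
  (forall y, mu `]-oo, y]%classic = (rdot (E y g) g)%:E) ->
  mu setT = (rdot g g)%:E ->
  (forall y, nu `]-oo, y]%classic = (rdot (E y h) h)%:E) ->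
  nu setT = (rdot h h)%:E ->
  (forall y, ka `]-oo, y]%classic = (rdot (E y (g + h)) (g + h))%:E) ->
  ka setT = (rdot (g + h) (g + h))%:E ->
  forall B, measurable B -> ka B = measure_add mu nu B.
Proof.
move=> hg hh gx hx mur muT nur nuT kar kaT.
have orth y : rdot (E y g) h = 0.
  by rewrite -gx E_C// rdot_E ?hx//; [rewrite rdotC rdot0l|exact: E_ell2].
have orth0 : rdot g h = 0 by rewrite -gx rdot_E// hx rdotC rdot0l.
apply: measure_eq_rays.
- by rewrite kaT ltry.
- rewrite kaT; apply: esym; apply: (eq_trans (measure_addE mu nu _)).
  by rewrite muT nuT rdotDD// orth0 mulr0 addr0 EFinD.
- move=> y; rewrite kar; apply: esym; apply: (eq_trans (measure_addE mu nu _)).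
  rewrite mur nur -EFinD E_D//; congr EFin; apply: esym.
  have hEg := @E_ell2 y _ hg; have hEh := @E_ell2 y _ hh.
  rewrite rdotDl ?rdotDr//; last exact: ell2D.
  by rewrite orth [rdot (E y h) g]rdot_E// [rdot h _]rdotC orth addr0 add0r.
Qed.

(** By additivity the second moment of [u] is the sum of those of [E x u] and [u - E x u], and the
    domain is characterized by finite second moments. *)
Lemma dom_E x u : dom u -> dom (E x u).
Proof.
move=> hu; have hu2 := dom_ell2 hu; have hEu := @E_ell2 x _ hu2.
have hd : ell2 (u - E x u) by exact: ell2B.
have [mu [mur muT mud _]] := spectral_integral hEu.
have [nu [nur nuT _ _]] := spectral_integral hd.
have [ka [kar kaT kad _]] := spectral_integral hu2.
apply/mud; move/kad: (hu); apply: le_lt_trans.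
rewrite [leRHS](eq_measure_integral (measure_add mu nu)); last first.
  move=> B mB _; apply: (@spectral_additive x (E x u) (u - E x u)) mB => //.
  - exact: E_E.
  - by rewrite E_B// E_E// subrr.
  - by move=> y; rewrite addrC subrK.
  - by rewrite addrC subrK.
rewrite ge0_integral_measure_add//.
- by rewrite leeDl// integral_ge0// => y _; rewrite lee_fin sqr_ge0.
- by move=> y _; rewrite lee_fin sqr_ge0.
- by apply/measurable_EFinP; exact: measurable_funX.
Qed.

(** Additivity of the spectral measures gives [<A(g+h), g+h> = <Ag, g> + <Ah, h>]; by symmetry the
    cross terms are [2 <Ag, h>], which must vanish. *)
Lemma action_orth x g h : dom g -> dom h -> E x g = g -> E x h = 0 ->
  rdot (A g) h = 0.
Proof.
move=> hg hh gx hx; have hg2 := dom_ell2 hg; have hh2 := dom_ell2 hh.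
have hgh := domD hg hh.
have [mu [mur muT mud /(_ hg)[muA _]]] := spectral_integral hg2.
have [nu [nur nuT nud /(_ hh)[nuA _]]] := spectral_integral hh2.
have [ka [kar kaT kad /(_ hgh)[kaA _]]] := spectral_integral (dom_ell2 hgh).
have imu := integrable_id_sqr (eq_ind_r (fun z => z < +oo)%E (ltry _) muT) (mud.1 hg).
have inu := integrable_id_sqr (eq_ind_r (fun z => z < +oo)%E (ltry _) nuT) (nud.1 hh).
have : rdot (A (g + h)) (g + h) = rdot (A g) g + rdot (A h) h.
  rewrite kaA muA nuA /Rintegral (eq_measure_integral (measure_add mu nu)); last first.
    by move=> B mB _; exact: (@spectral_additive x g h) mB.
  by rewrite integral_measure_add// fineD// integrable_fin_num.
have hAg := dom_action hg; have hAh := dom_action hh.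
rewrite /A jacobi_actionD rdotDl ?rdotDr// -/A; last exact: ell2D.
rewrite [rdot (A h) g]action_symmetric// [rdot h (A g)]rdotC; lra.
Qed.

(** Orthogonality of [A (E x u)] to [v - E x v], and the same with [u] and [v] exchanged, shows that
    both sides have the same product with every [v] of the domain; the basis vectors and their
    multiples by ['i] then give the coordinates. *)
Lemma action_E x u : dom u -> A (E x u) = E x (A u).
Proof.
move=> hu; have hu2 := dom_ell2 hu; have hAu := dom_action hu.
have hEu := @dom_E x _ hu; have hEu2 := dom_ell2 hEu.
have weak v : dom v -> rdot (A (E x u)) v = rdot (E x (A u)) v.
  move=> hv; have hv2 := dom_ell2 hv.
  have hEv := @dom_E x _ hv; have hEv2 := dom_ell2 hEv.
  have perp w : dom w -> E x (w - E x w) = 0.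
    by move=> hw; have hw2 := dom_ell2 hw; rewrite E_B ?E_E ?subrr//; exact: E_ell2.
  have e1 := action_orth hEu (domB hv hEv) (@E_E x _ hu2) (perp v hv).
  have e2 := action_orth hEv (domB hu hEu) (@E_E x _ hv2) (perp u hu).
  have hAEu := dom_action hEu; have hAEv := dom_action hEv.
  move: e1 e2; rewrite !rdotBr// => /subr0_eq -> /subr0_eq e2.
  rewrite [rdot (A (E x u)) _]action_symmetric// [RHS]rdot_E//.
  by rewrite [RHS]action_symmetric// ![rdot _ (A (E x v))]rdotC e2.
have hdiff := @E_ell2 x _ hAu.
apply/funext => n; apply: complexP.
  by rewrite -!rdot_basis weak//; exact: dom_basis.
rewrite -!rdot_basisI// ?weak//; first exact: domZ (dom_basis n).
exact: dom_action.
Qed.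

Definition band x y u := [/\ ell2 u, E x u = 0 & E y u = u].

Lemma band_E x y u : x <= y -> ell2 u -> band x y (E y u - E x u).
Proof.
move=> xy hu; have hx := @E_ell2 x _ hu; have hy := @E_ell2 y _ hu.
split; first exact: ell2B.
- by rewrite E_B// !E_min// minxx (min_l xy) subrr.
- by rewrite E_B// !E_min// minxx (min_r xy).
Qed.

Lemma band_spectral x y u : band x y u ->
  exists mu : {measure set (measurableTypeR R) -> \bar R},
    [/\ mu (~` `]x, y]%classic) = 0%E,
        mu `]x, y]%classic = (rdot u u)%:E, mu setT = (rdot u u)%:E,
        dom u <-> (\int[mu]_x (x ^+ 2)%:E < +oo)%E &
        dom u -> rdot (A u) u = (\int[mu]_x x)%R].
Proof.
move=> [hu ux uy]; have [mu [mur muT mud muA]] := spectral_integral hu.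
exists mu.
have mx : mu `]-oo, x]%classic = 0%E by rewrite mur ux rdot0l.
have my : mu (~` `]-oo, y]%classic) = 0%E.
  have := measureCU mu (measurable_itv `]-oo, y]).
  rewrite muT mur uy => e.
  have : ((rdot u u)%:E - (rdot u u)%:E = mu (~` `]-oo, y]%classic))%E.
    by rewrite [X in (X - _)%E]e addeAC subee// add0e.
  by rewrite subee.
have mN : mu (~` `]x, y]%classic) = 0%E.
  apply/eqP; rewrite eq_le measure_ge0 andbT.
  apply: (@le_trans _ _ (mu (`]-oo, x]%classic `|` ~` `]-oo, y]%classic))).
    apply: le_measure; rewrite ?inE.
    - by apply: measurableC; exact: measurable_itv.
    - apply: measurableU; first exact: measurable_itv.
      by apply: measurableC; exact: measurable_itv.
    - move=> t /=; rewrite !in_itv/= => /negP; rewrite negb_and -leNgt.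
      by move=> /orP[|/negP]; [left|right].
  rewrite -[leRHS](adde0 0%E) -{1}mx -my; apply: measureU2.
    exact: measurable_itv.
  by apply: measurableC; exact: measurable_itv.
split=> //; last by move=> /muA[].
have := measureCU mu (measurable_itv `]x, y]).
by rewrite muT => ->; rewrite mN adde0.
Qed.

Lemma band_dom x y u : band x y u -> dom u.
Proof.
move=> hb; have [mu [mN mI mT mud _]] := band_spectral hb.
apply/mud; rewrite (@ge0_negligible_integral _ _ _ mu setT (~` `]x, y]%classic))//.
- rewrite setTD setCK; set K := (x ^+ 2 + y ^+ 2)%:E.
  apply: (@le_lt_trans _ _ (\int[mu]_(t in `]x, y]) (cst K t))%E).
    apply: ge0_le_integral => //.
    + by move=> t _; rewrite lee_fin sqr_ge0.
    + by apply/measurable_EFinP; exact: measurable_funX.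
    + move=> t /=; rewrite in_itv/= => /andP[xt ty]; rewrite lee_fin.
      have := sqr_ge0 (x + y - t); have := sqr_ge0 x; have := sqr_ge0 y; nra.
  by rewrite integral_cst// mI -EFinM ltry.
- by apply: measurableC; exact: measurable_itv.
- by apply/measurable_EFinP; exact: measurable_funX.
- by move=> t _; rewrite lee_fin sqr_ge0.
Qed.

Lemma band_form x y u : x <= y -> band x y u ->
  `|rdot (A u) u - x * rdot u u| <= (y - x) * rdot u u.
Proof.
move=> xy hb; have hd := band_dom hb.
have [mu [mN mI mT mud /(_ hd) muA]] := band_spectral hb.
have imu := integrable_id_sqr (eq_ind_r (fun z => z < +oo)%E (ltry _) mT) (mud.1 hd).
have imuI : mu.-integrable `]x, y] (EFin \o (id : measurableTypeR R -> R)).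
  by apply: (integrableS measurableT).
have icst (c : R) : mu.-integrable `]x, y] (EFin \o (cst c : measurableTypeR R -> R)).
  apply: measurable_bounded_integrable => //; last exact: bounded_cst.
  by rewrite mI ltry.
have e : rdot (A u) u = (\int[mu]_(t in `]x, y]) t)%R.
  rewrite muA /Rintegral (@negligible_integral _ _ _ mu setT (~` `]x, y]%classic))//.
    by rewrite setTD setCK.
  by apply: measurableC; exact: measurable_itv.
have h1 : (\int[mu]_(t in `]x, y]) (cst x t) <= \int[mu]_(t in `]x, y]) t)%R.
  apply: le_Rintegral; [exact: measurable_itv|exact: (icst x)|exact: imuI|].
  by move=> t /=; rewrite in_itv/= => /andP[/ltW].
have h2 : (\int[mu]_(t in `]x, y]) t <= \int[mu]_(t in `]x, y]) (cst y t))%R.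
  apply: le_Rintegral; [exact: measurable_itv|exact: imuI|exact: (icst y)|].
  by move=> t /=; rewrite in_itv/= => /andP[].
move: h1 h2; rewrite -e !Rintegral_cst// mI /= => h1 h2.
by rewrite ler_norml; apply/andP; split; have := rdot_ge0 (dom_ell2 hd); nra.
Qed.

Lemma band_D x y u v : band x y u -> band x y v -> band x y (u + v).
Proof.
move=> [hu ux uy] [hv vx vy]; split; first exact: ell2D.
  by rewrite E_D// ux vx addr0.
by rewrite E_D// uy vy.
Qed.

Lemma band_Z x y (c : R[i]) u : band x y u -> band x y (cscale c u).
Proof.
move=> [hu ux uy]; split; first exact: ell2Z.
  by rewrite E_Z// ux; apply/funext => n; rewrite /cscale mulr0.
by rewrite E_Z// uy.
Qed.

Lemma band_action x y u : band x y u -> band x y (A u).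
Proof.
move=> hb; have hd := band_dom hb; have [hu ux uy] := hb.
split; first exact: dom_action.
- rewrite -action_E// ux /A; apply/funext => -[|n] /=; ring.
- by rewrite -action_E// uy.
Qed.

(* A symmetric operator with numerical range in [-d, d] on a subspace that it
   maps to itself has norm at most d there. *)
Lemma band_norm x y u : x <= y -> band x y u ->
  ell2_norm (A u - cscale x%:C u) <= (y - x) * ell2_norm u.
Proof.
move=> xy hb; have hd := band_dom hb; have hu := dom_ell2 hd.
have hw : band x y (A u - cscale x%:C u).
  by apply: band_D; [exact: band_action|rewrite -cscaleNl; exact: band_Z].
set w := A u - cscale x%:C u; have hw2 : ell2 w by case: hw.
have hwd := band_dom hw; have hAu := dom_action hd; have hAw := dom_action hwd.
set N := rdot w w; set U := rdot u u.
have U0 : 0 <= U by exact: rdot_ge0.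
have N0 : 0 <= N by exact: rdot_ge0.
(* Polarization with [w = (A - x) u]: the difference of the form at [u + s w] and at [u - s w] is
   [4 s N], and the parallelogram law turns the sum of the two bounds into
   [2 (y - x) (U + s^2 N)]. *)
have key (s : R) : 2 * s * N <= (y - x) * (U + s ^+ 2 * N).
  have hsw := band_Z s%:C hw.
  have hsw2 := ell2Z s%:C hw2; have hsAw := ell2Z s%:C hAw.
  have hmsw : band x y (u - cscale s%:C w).
    by apply: band_D => //; rewrite -cscaleNl; exact: band_Z.
  have hp := ell2D hu hsw2; have hm := ell2B hu hsw2.
  have := band_form xy (band_D hb hsw); have := band_form xy hmsw.
  rewrite /A jacobi_actionB jacobi_actionD jacobi_actionZ -/A.
  rewrite rdotBB// rdotDD// rdotBl// !rdotBr// rdotDl// !rdotDr//.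
  rewrite !rdotZl// !rdotZr// [rdot (A w) u]action_symmetric// [rdot w (A u)]rdotC.
  have -> : rdot (A u) w = N + x * rdot u w.
    by rewrite /N {2}/w rdotBl// ?rdotZl//; [ring|exact: ell2Z].
  rewrite -/N -/U !ler_norml => /andP[h1 h2] /andP[h3 h4]; nra.
have [xy0|xy0] := eqVneq x y.
  have := key 1; rewrite -xy0 subrr mul0r mulr1 => h.
  have N00 : N = 0 by lra.
  by rewrite mul0r ell2_normE -/N N00 sqrtr0.
have d0 : 0 < y - x by rewrite subr_gt0 lt_neqAle xy0.
rewrite -(@ler_pXn2r _ 2)// ?nnegrE ?mulr_ge0 ?ell2_norm_ge0 ?(ltW d0)//.
rewrite exprMn !sqr_ell2_norm// -/N -/U.
(* This [s] maximizes [2 s N - (y - x) s^2 N]. *)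
have h := ler_wpM2l (ltW d0) (key (y - x)^-1).
have e1 : (y - x) * (2 * (y - x)^-1 * N) = 2 * N by field; exact: lt0r_neq0.
have e2 : (y - x) * ((y - x) * (U + (y - x)^-1 ^+ 2 * N)) = (y - x) ^+ 2 * U + N.
  by field; exact: lt0r_neq0.
by move: h; rewrite e1 e2; lra.
Qed.

Lemma rdot_band x y u v : x <= y -> ell2 u -> ell2 v ->
  rdot (E y u - E x u) (E y v - E x v) = rdot (E y u) v - rdot (E x u) v.
Proof.
move=> xy hu hv; have hE' t g' : ell2 g' -> ell2 (E t g') by exact: E_ell2.
have EE s t : rdot (E s u) (E t v) = rdot (E (Num.min t s) u) v.
  by rewrite -(rdot_E t (hE' s u hu) hv) E_min.
have hxu := hE' x u hu; have hyu := hE' y u hu.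
have hxv := hE' x v hv; have hyv := hE' y v hv.
rewrite (rdotBl hyu hxu (ell2B hyv hxv)) (rdotBr hyv hxv hyu) (rdotBr hyv hxv hxu).
by rewrite !EE !minxx (min_l xy) (min_r xy); ring.
Qed.

Lemma itv_measure u (mu : {measure set (measurableTypeR R) -> \bar R}) x y :
  x <= y -> ell2 u ->
  (forall t, mu `]-oo, t]%classic = (rdot (E t u) u)%:E) ->
  mu `]x, y]%classic = (rdot (E y u - E x u) (E y u - E x u))%:E.
Proof.
move=> xy hu mur; rewrite rdot_band//.
have e : `]-oo, y]%classic = `]-oo, x]%classic `|` `]x, y]%classic :> set R.
  apply/seteqP; split=> t /=; rewrite !in_itv/=.
    by move=> ->; rewrite andbT; apply/orP; case: leP.
  by move=> [/le_trans|/andP[]//]; exact.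
have d : `]-oo, x]%classic `&` `]x, y]%classic = set0 :> set R.
  apply/seteqP; split=> // t /=; rewrite !in_itv/= => -[h /andP[]].
  by rewrite ltNge h.
have h : mu `]-oo, y]%classic = (mu `]-oo, x]%classic + mu `]x, y]%classic)%E.
  apply: etrans (measureU mu (measurable_itv `]-oo, x]) (measurable_itv `]x, y]) d).
  by rewrite -[in RHS]e.
by move: h; rewrite !mur EFinB => ->; rewrite addeAC subee// add0e.
Qed.

(** * The norm of the resolvent as an integral against the spectral measure *)

Section Resolvent.
Variables (l e : R) (u : cseq R).
Hypotheses (e_gt0 : 0 < e) (u_dom : dom u).
Let h : cseq R := A u - cscale (l +i* e) u.
Let n (t : R) : R := Normc.normc (t%:C - (l +i* e)).

Let sqr_n t : n t ^+ 2 = (t - l) ^+ 2 + e ^+ 2.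
Proof. by rewrite /n sqr_normcE /= sub0r sqrrN. Qed.

Let n_ge t : e <= n t.
Proof.
rewrite -(@ler_pXn2r _ 2)// ?nnegrE ?normc_ge0 ?(ltW e_gt0)// sqr_n.
by rewrite lerDr sqr_ge0.
Qed.

Let n_lip t s : n t <= n s + `|t - s|.
Proof.
rewrite /n (_ : t%:C - _ = (s%:C - (l +i* e)) + (t - s)%:C); last first.
  by rewrite rmorphB/=; ring.
by rewrite (le_trans (ler_normcD _ _))// normc_real.
Qed.

Let hu : ell2 u. Proof. exact: dom_ell2. Qed.
Let hh : ell2 h.
Proof. by apply: ell2B; [exact: dom_action|exact: ell2Z]. Qed.

(** [E y - E x] commutes with [A], so it maps [h] to [(A - z) v] with [v] in the band, and there
    [A - z] differs from the scalar [x - z] by an operator of norm at most [y - x]. *)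
Lemma resolvent_band x y : x <= y ->
  (n x - (y - x)) * ell2_norm (E y u - E x u) <= ell2_norm (E y h - E x h)
    <= (n x + (y - x)) * ell2_norm (E y u - E x u).
Proof.
move=> xy; set v := E y u - E x u.
have hb : band x y v by exact: band_E.
have hvd := band_dom hb; have hv := dom_ell2 hvd; have hAv := dom_action hvd.
have hAu := dom_action u_dom; have hzu := ell2Z (l +i* e) hu.
have -> : E y h - E x h = (A v - cscale x%:C v) + cscale (x%:C - (l +i* e)) v.
  rewrite cscaleDl cscaleNl addrA subrK /h !E_B// !E_Z// -!action_E//.
  rewrite /v /A jacobi_actionB -/A cscaleDr cscaleN.
  by apply/funext => k; rewrite !fctE; ring.
have hw : ell2 (A v - cscale x%:C v) by apply: ell2B => //; exact: ell2Z.
have hzv := ell2Z (x%:C - (l +i* e)) hv.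
have bd := band_norm xy hb.
have nz : ell2_norm (cscale (x%:C - (l +i* e)) v) = n x * ell2_norm v.
  exact: ell2_normZ.
apply/andP; split.
  have := ell2_normB (ell2D hw hzv) hw.
  by rewrite addrC addKr nz; lra.
by have := ell2_normD hw hzv; rewrite nz; lra.
Qed.

Variable mu : {measure set (measurableTypeR R) -> \bar R}.
Hypothesis mu_ray : forall t, mu `]-oo, t]%classic = (rdot (E t h) h)%:E.

Let phi (t : R) : R := ((t - l) ^+ 2 + e ^+ 2)^-1.

Let phi_ge0 t : 0 <= phi t.
Proof. by rewrite invr_ge0 addr_ge0// sqr_ge0. Qed.

Let phiE t : phi t = (n t) ^- 2.
Proof. by rewrite /phi -sqr_n. Qed.

Let mphi : measurable_fun setT (phi : measurableTypeR R -> R).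
Proof. exact: measurable_lorentzian. Qed.

Let mphiE D : measurable_fun D (EFin \o phi : measurableTypeR R -> \bar R).
Proof. by apply: measurable_funTS; apply/measurable_EFinP. Qed.

Let nu := density_measure mu (fun t : measurableTypeR R => phi_ge0 t : (0 <= (EFin \o phi) t)%E)
  (@mphiE setT).

(** On []x, y]], both [|t - z|] and the ratio of the norms of the band parts of [h] and [u] lie
    within [y - x] of [n x]. Since [n x >= e], the resulting squared quotient is at most [K],
    whatever [x]. *)
Lemma resolvent_itv x y : x <= y -> y - x < e ->
  let K := ((e + (y - x)) / (e - (y - x))) ^+ 2 in
  let V := rdot (E y u - E x u) (E y u - E x u) in
  (nu `]x, y]%classic <= (K * V)%:E)%E /\
  (V%:E <= K%:E * nu `]x, y]%classic)%E.
Proof.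
move=> xy de K V; set d := y - x in de K *.
have d0 : 0 <= d by rewrite subr_ge0.
have nx := n_ge x; have V0 : 0 <= V.
  by apply: rdot_ge0; apply: ell2B; exact: E_ell2.
have muI := itv_measure xy hh mu_ray.
have /andP[b1 b2] := resolvent_band xy; rewrite -/d in b1 b2.
have bV : ell2_norm (E y u - E x u) ^+ 2 = V.
  by apply: sqr_ell2_norm; apply: ell2B; exact: E_ell2.
have hI : ell2 (E y h - E x h) by apply: ell2B; exact: E_ell2.
have np : 0 < n x + d by lra.
have nm : 0 < n x - d by lra.
have em : 0 < e - d by lra.
have ub : rdot (E y h - E x h) (E y h - E x h) <= (n x + d) ^+ 2 * V.
  rewrite -bV -sqr_ell2_norm// -exprMn ler_pXn2r// nnegrE ?ell2_norm_ge0//.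
  by rewrite mulr_ge0 ?ell2_norm_ge0// ltW.
have lb : (n x - d) ^+ 2 * V <= rdot (E y h - E x h) (E y h - E x h).
  rewrite -bV -sqr_ell2_norm// -exprMn ler_pXn2r// nnegrE ?ell2_norm_ge0//.
  by rewrite mulr_ge0 ?ell2_norm_ge0// ltW.
have KE : ((n x + d) / (n x - d)) ^+ 2 <= K.
  have q1 : 0 <= (n x + d) / (n x - d) by rewrite divr_ge0// ltW.
  have q2 : 0 <= (e + d) / (e - d).
    by rewrite divr_ge0 ?(ltW em)// addr_ge0// ltW.
  rewrite ler_pXn2r ?nnegrE// ler_pdivrMr// mulrAC ler_pdivlMr//; nra.
have mI : measurable (`]x, y]%classic : set (measurableTypeR R)).
  exact: measurable_itv.
have phi_cst (c : R) : (\int[mu]_(t in `]x, y]) (cst c%:E t) =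
    (c * rdot (E y h - E x h) (E y h - E x h))%:E)%E.
  by rewrite integral_cst// muI.
split.
- apply: (@le_trans _ _ (\int[mu]_(t in `]x, y]) (cst ((n x - d) ^- 2)%:E t))%E).
    apply: ge0_le_integral => //.
    + by move=> t _; rewrite lee_fin.
    + move=> t /=; rewrite in_itv/= => /andP[xt ty]; rewrite lee_fin phiE.
      rewrite lef_pV2 ?posrE ?exprn_gt0// ?(lt_le_trans e_gt0 (n_ge t))//.
      rewrite ler_pXn2r// ?nnegrE ?normc_ge0 ?(ltW nm)//.
      have := n_lip x t; rewrite distrC ger0_norm ?subr_ge0 ?(ltW xt)//.
      by rewrite /d; lra.
  rewrite phi_cst lee_fin (le_trans (ler_wpM2l _ ub))//.
    by rewrite invr_ge0 exprn_ge0// ltW.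
  rewrite mulrA (le_trans _ (ler_wpM2r V0 KE))//.
  by rewrite expr_div_n mulrC [_ ^- 2 * _]mulrC mulrC.
- apply: (@le_trans _ _ (K%:E * (\int[mu]_(t in `]x, y]) (cst ((n x + d) ^- 2)%:E t)))%E).
    rewrite phi_cst -EFinM lee_fin.
    apply: (@le_trans _ _ (((n x + d) / (n x - d)) ^+ 2 *
      ((n x + d) ^- 2 * ((n x - d) ^+ 2 * V)))).
      by rewrite le_eqVlt; apply/orP; left; apply/eqP; field; rewrite !gt_eqF.
    apply: ler_pM => //.
    + by rewrite exprn_ge0// divr_ge0// ltW.
    + by rewrite mulr_ge0 ?mulr_ge0 ?invr_ge0 ?exprn_ge0// ltW.
    + by apply: ler_wpM2l => //; rewrite invr_ge0 exprn_ge0// ltW.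
  rewrite lee_wpmul2l ?lee_fin ?sqr_ge0//.
  apply: ge0_le_integral => //.
  + by move=> t _; rewrite lee_fin invr_ge0 exprn_ge0// ltW.
  + move=> t /=; rewrite in_itv/= => /andP[xt ty]; rewrite lee_fin phiE.
    rewrite lef_pV2 ?posrE ?exprn_gt0// ?(lt_le_trans e_gt0 (n_ge t))//.
    rewrite ler_pXn2r// ?nnegrE ?normc_ge0 ?(ltW np)//.
    have := n_lip t x; rewrite ger0_norm ?subr_ge0 ?(ltW xt)//.
    by rewrite /d; lra.
Qed.

Let le_sqr_gt1 (r v : R) : 0 <= v -> (forall k, 1 < k -> r <= k ^+ 2 * v) -> r <= v.
Proof.
move=> v0 H; apply/ler_addgt0Pr => d d0.
(* For [c <= 1] one has [(1 + c)^2 v <= v + 3 c v]. *)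
set c := Num.min 1 (d / (3 * v + 1)).
have v1 : 0 < 3 * v + 1 by lra.
have c0 : 0 < c by rewrite lt_min ltr01 divr_gt0.
have c1 : c <= 1 by rewrite ge_min lexx.
have c2 : c * (3 * v + 1) <= d by rewrite -ler_pdivlMr// ge_min lexx orbT.
have := H (1 + c); rewrite ltrDl => /(_ c0) H1; nra.
Qed.

(** Comparison on bands of a common length [d] and [measure_le_grid] give both inequalities up to a
    factor [k^2], where [k] can be taken as close to 1 as desired. *)
Lemma resolvent_integral :
  (\int[mu]_t (((t - l) ^+ 2 + e ^+ 2)^-1)%:E = (rdot u u)%:E)%E.
Proof.
rewrite -[LHS]/(nu setT).
have [mu_u [ur uT _ _]] := spectral_integral hu.
have step k : 1 < k -> (nu setT <= (k ^+ 2)%:E * mu_u setT)%E /\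
                        (mu_u setT <= (k ^+ 2)%:E * nu setT)%E.
  (* This [d] solves [(e + d) / (e - d) = k]. *)
  move=> k1; set d := e * (k - 1) / (k + 1).
  have d0 : 0 < d by rewrite divr_gt0 ?mulr_gt0//; lra.
  have kp : k + 1 != 0 by rewrite gt_eqF//; lra.
  have de : d < e by rewrite /d ltr_pdivrMr ?ltr_pM2l//; lra.
  have K : (e + d) / (e - d) = k.
    rewrite /d; field; rewrite kp /=.
    by rewrite (_ : e * (k + 1) - e * (k - 1) = 2 * e) ?mulf_neq0 ?gt_eqF//; ring.
  split; apply: (@measure_le_grid _ _ _ _ d) => //; try exact: sqr_ge0;
    move=> x; have xd : x <= x + d by rewrite lerDl ltW.
  - have := (resolvent_itv xd); rewrite addrAC subrr add0r K => /(_ de)[+ _].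
    by rewrite (itv_measure xd hu ur).
  - have := (resolvent_itv xd); rewrite addrAC subrr add0r K => /(_ de)[_].
    by rewrite (itv_measure xd hu ur).
have V0 : 0 <= rdot u u by exact: rdot_ge0.
have [r rE] : exists r, nu setT = r%:E.
  have k2 : 1 < 2 :> R by rewrite ltr1n.
  have [h1 _] := step _ k2; exists (fine (nu setT)); rewrite fineK//.
  rewrite ge0_fin_numE ?measure_ge0// (le_lt_trans h1)// uT -EFinM ltry//.
have r0 : 0 <= r by rewrite -lee_fin -rE measure_ge0.
rewrite rE; congr EFin; apply/eqP; rewrite eq_le; apply/andP; split.
  by apply: le_sqr_gt1 => // k /step[+ _]; rewrite rE uT -EFinM lee_fin.
by apply: le_sqr_gt1 => // k /step[_]; rewrite rE uT -EFinM lee_fin.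
Qed.

End Resolvent.

End SpectralFamily.

(** * Inversion of the Poisson integral *)

Section PoissonInversion.
Variable R : realType.
Variable mu : {measure set (measurableTypeR R) -> \bar R}.
Hypothesis mu_fin : (mu setT < +oo)%E.
Implicit Types (l e x y t : R).

(** [pi] times the usual Poisson integral, as the kernel has total mass [pi]. *)
Definition poisson l e : R := (\int[mu]_t (e / ((t - l) ^+ 2 + e ^+ 2)))%R.

(** A primitive in [l] of the kernel. As [e] decreases to 0 it tends to [pi / 2] times the sign of
    [l - t], so that the increment of [G e] over an interval approximates [pi] times its measure. *)
Let K e l t : R := atan ((l - t) / e).
Let G e l : R := (\int[mu]_t (K e l t))%R.

Let mK e l : measurable_fun setT (K e l : measurableTypeR R -> R).
Proof.
apply: continuous_measurable_fun => t.
apply: (@continuous_comp _ _ _ (fun t => (l - t) / e) atan).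
  by apply: cvgMr_tmp; apply: cvgB; [exact: cvg_cst|exact: cvg_id].
exact: continuous_atan.
Qed.

Let iK e l : mu.-integrable setT (EFin \o (K e l : measurableTypeR R -> R)).
Proof.
apply: measurable_bounded_integrable => //.
exists (pi / 2); split; first exact: num_real.
move=> M piM t _ /=; rewrite (le_trans _ (ltW piM))// ler_norml.
by rewrite (ltW (atan_gtNpi2 _)) (ltW (atan_ltpi2 _)).
Qed.

Let icst (c : R) (B : set (measurableTypeR R)) : measurable B ->
  mu.-integrable B (EFin \o (cst c : measurableTypeR R -> R)).
Proof.
move=> mB; apply: measurable_bounded_integrable => //; last exact: bounded_cst.
by rewrite (le_lt_trans _ mu_fin)// le_measure// ?inE.
Qed.

Let dK e t l : 0 < e -> is_derive l 1 (fun l => K e l t) (e / ((t - l) ^+ 2 + e ^+ 2)).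
Proof.
move=> e0; have e1 : e != 0 by rewrite gt_eqF.
have h1 : is_derive l 1 (fun l : R => (l - t) / e) e^-1.
  apply: is_derive_eq; by rewrite ?subr0 ?scaler1 ?mulr1 ?scale1r ?scaler0 ?add0r.
have h := @is_derive1_comp _ atan (fun l : R => (l - t) / e) l _ _ (is_derive1_atan _) h1.
apply: (@is_derive_eq _ _ _ _ _ _ _ _ h).
have h2 : (l - t) ^+ 2 + e ^+ 2 != 0.
  by rewrite gt_eqF// ltr_wpDl ?sqr_ge0// exprn_gt0.
rewrite -[(t - l) ^+ 2]sqrrN opprB; field.
by rewrite h2 e1.
Qed.

Lemma poisson_derive e l : 0 < e -> is_derive l 1 (G e) (poisson l e).
Proof.
move=> e0.
have der t l' : derivable (fun l => K e l t) l' 1 by case: (dK t l' e0).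
have d1E t l' : partial1of2 (K e) l' t = e / ((t - l') ^+ 2 + e ^+ 2).
  by rewrite partial1of2E; have := dK t l' e0 => H; rewrite derive_val.
have bnd t l' : `|partial1of2 (K e) l' t| <= e^-1.
  have h2 : 0 < (t - l') ^+ 2 + e ^+ 2 by rewrite ltr_wpDl ?sqr_ge0// exprn_gt0.
  rewrite d1E ger0_norm ?divr_ge0 ?(ltW e0) ?(ltW h2)//.
  rewrite ler_pdivrMr// mulrDr -[X in X <= _]add0r lerD//.
    by rewrite mulr_ge0 ?sqr_ge0// invr_ge0 ltW.
  by rewrite expr2 mulKf// gt_eqF.
have lI : `]l - 1, l + 1[%classic l by rewrite /= in_itv/= ltrBlDr !ltrDl ltr01.
have e'0 : forall t : measurableTypeR R, 0 <= (fun=> e^-1) t by move=> _; rewrite invr_ge0 ltW.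
have D := @derivable_under_integral R _ (measurableTypeR R) mu (K e) setT
  measurableT l (l - 1) (l + 1) lI (fun l' _ => iK e l')
  (fun l' t _ _ => der t l') (fun=> e^-1) e'0 (icst _ measurableT)
  (fun l' t _ _ => bnd t l').
have V := @differentiation_under_integral R _ (measurableTypeR R) mu (K e) setT
  measurableT l (l - 1) (l + 1) lI (fun l' _ => iK e l')
  (fun l' t _ _ => der t l') (fun=> e^-1) e'0 (icst _ measurableT)
  (fun l' t _ _ => bnd t l').
apply: DeriveDef; first exact: D.
rewrite -derive1E V; apply: eq_Rintegral => t _.
by rewrite -[LHS]/(partial1of2 (K e) l t) d1E.
Qed.

Lemma poisson_MVT e x y : 0 < e -> x < y ->
  exists2 c, c \in `]x, y[ & G e y - G e x = poisson c e * (y - x).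
Proof.
move=> e0 xy; apply: (@MVT _ (G e) (fun l => poisson l e)) => //.
  by move=> c _; exact: poisson_derive.
apply: derivable_within_continuous => c _.
by case: (poisson_derive c e0).
Qed.

Let iKB e x' y' : mu.-integrable setT
  (EFin \o (fun t : measurableTypeR R => K e y' t - K e x' t)).
Proof.
rewrite /comp; under eq_fun do rewrite EFinB.
by apply: integrableB => //; exact: iK.
Qed.

Let G_split e x' y' x y : G e y' - G e x' =
  (\int[mu]_(t in `]x, y]) (K e y' t - K e x' t) +
   \int[mu]_(t in ~` `]x, y]) (K e y' t - K e x' t))%R.
Proof.
rewrite /G -RintegralB// -Rintegral_setU//.
- by rewrite setUCr.
- by apply: measurableC; exact: measurable_itv.
- by rewrite setUCr; exact: iKB.
- by rewrite disj_set2E setICr eqxx.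
Qed.

Let iB e x' y' (B : set (measurableTypeR R)) : measurable B ->
  mu.-integrable B (EFin \o (fun t : measurableTypeR R => K e y' t - K e x' t)).
Proof.
move=> mB; apply: (@integrableS _ _ _ mu setT) => //.
Qed.

Let int_ge (B : set (measurableTypeR R)) e x' y' c : measurable B ->
  (forall t, B t -> c <= K e y' t - K e x' t) ->
  c * fine (mu B) <= (\int[mu]_(t in B) (K e y' t - K e x' t))%R.
Proof.
move=> mB H; rewrite -Rintegral_cst//.
by apply: le_Rintegral; [exact: mB|exact: (icst c)|exact: iB|].
Qed.

Let int_le (B : set (measurableTypeR R)) e x' y' c : measurable B ->
  (forall t, B t -> K e y' t - K e x' t <= c) ->
  (\int[mu]_(t in B) (K e y' t - K e x' t))%R <= c * fine (mu B).
Proof.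
move=> mB H; rewrite -Rintegral_cst//.
by apply: le_Rintegral; [exact: mB|exact: iB|exact: (icst c)|].
Qed.

Let K_anti e s t l : 0 < e -> s <= l - t -> atan (s / e) <= K e l t.
Proof. by move=> e0 h; apply: le_atan; rewrite ler_pM2r ?invr_gt0. Qed.

Let K_antiN e s t l : 0 < e -> s <= t - l -> K e l t <= - atan (s / e).
Proof.
move=> e0 h; rewrite -atanN; apply: le_atan.
by rewrite -mulNr ler_pM2r ?invr_gt0//; lra.
Qed.

Let mI (x y : R) : measurable (`]x, y]%classic : set (measurableTypeR R)).
Proof. exact: measurable_itv. Qed.

Let mIC (x y : R) : measurable (~` `]x, y]%classic : set (measurableTypeR R)).
Proof. by apply: measurableC; exact: measurable_itv. Qed.

(** After widening by [s] on both sides, every [t] in []x, y]] is at distance at least [s] from both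
    new ends, which gives two arctangents of at least [atan (s / e)]; elsewhere the integrand is
    nonnegative. *)
Lemma poisson_upper e s x y : 0 < e -> 0 < s -> x <= y ->
  2 * atan (s / e) * fine (mu `]x, y]%classic) <= G e (y + s) - G e (x - s).
Proof.
move=> e0 s0 xy; rewrite (G_split e (x - s) (y + s) x y) -[leLHS]addr0 lerD//.
  apply: int_ge => // t /=; rewrite in_itv/= => /andP[xt ty].
  have h1 : s <= y + s - t by lra.
  have h2 : s <= t - (x - s) by lra.
  by have := K_anti e0 h1; have := K_antiN e0 h2; lra.
rewrite -[leLHS](mul0r (fine (mu (~` `]x, y]%classic)))); apply: int_ge => // t _.
by rewrite subr_ge0; apply: le_atan; rewrite ler_pM2r ?invr_gt0//; lra.
Qed.

(** After shrinking by [s], a point outside []x, y]] lies on the same side of both new ends at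
    distance at least [s], so the two arctangents differ by at most [pi / 2 - atan (s / e)]; inside
    they differ by at most [pi]. *)
Lemma poisson_lower e s x y : 0 < e -> 0 < s -> x + s <= y - s ->
  G e (y - s) - G e (x + s) <=
  pi * fine (mu `]x, y]%classic) + (pi / 2 - atan (s / e)) * fine (mu setT).
Proof.
move=> e0 s0 xy; rewrite (G_split e (x + s) (y - s) x y) lerD//.
  apply: int_le => // t _.
  have := atan_ltpi2 ((y - s - t) / e); have := atan_gtNpi2 ((x + s - t) / e).
  by rewrite -/(K e (y - s) t) -/(K e (x + s) t); lra.
apply: (@le_trans _ _ ((pi / 2 - atan (s / e)) * fine (mu (~` `]x, y]%classic)))).
  apply: int_le => // t /= /negP; rewrite in_itv/= negb_and -leNgt -ltNge.
  move=> /orP[tx|yt].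
    have h1 : s <= x + s - t by lra.
    have := K_anti e0 h1; have := atan_ltpi2 ((y - s - t) / e).
    by rewrite -/(K e (y - s) t); lra.
  have h1 : s <= t - (y - s) by lra.
  have := K_antiN e0 h1; have := atan_gtNpi2 ((x + s - t) / e).
  by rewrite -/(K e (x + s) t); lra.
apply: ler_wpM2l; first by rewrite subr_ge0 ltW// atan_ltpi2.
have fm (B : set (measurableTypeR R)) : measurable B -> mu B \is a fin_num.
  by move=> mB; rewrite ge0_fin_numE// (le_lt_trans _ mu_fin)// le_measure// ?inE.
by apply: fine_le; rewrite ?fm// le_measure// ?inE.
Qed.

Lemma atan_near s z : 0 < s -> 0 < z ->
  exists2 e1, 0 < e1 & forall e, 0 < e -> e < e1 -> pi / 2 - z <= atan (s / e).
Proof.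
move=> s0 z0; have /cvgrPdist_le/(_ z z0)[M [_ HM]] := @cvgy_atan R.
exists (s / (`|M| + 1)); first by rewrite divr_gt0// ltr_wpDl.
move=> e e0; rewrite ltr_pdivlMr ?ltr_wpDl// mulrC -ltr_pdivlMr// => h.
have := HM (s / e); rewrite /= ler_norml => /(_ _)/andP[]; last by lra.
by rewrite (le_lt_trans (ler_norm M))// (lt_trans _ h)// ltrDl.
Qed.

(** The mean value theorem turns the hypothesis into increments of [G e] close to [pi w] times the
    length; [poisson_upper] and [poisson_lower] transfer this to the measure. Both [x] and [y] are
    free, neither being tied to [l0], which yields a derivative in the two-point sense. *)
Lemma poisson_inversion (w l0 : R) :
  (forall z, 0 < z -> exists2 r, 0 < r & forall l e, `|l - l0| < r ->
     0 < e -> e < r -> `|poisson l e - pi * w| <= z) ->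
  forall z, 0 < z -> exists2 r, 0 < r & forall x y, `|x - l0| < r ->
    `|y - l0| < r -> x < y ->
    `|fine (mu `]x, y]%classic) - w * (y - x)| <= z * (y - x).
Proof.
move=> Hw z z0; have [r r0 Hr] := Hw (pi * z) (mulr_gt0 (pi_gt0 R) z0).
exists r => // x y xr yr xy.
set m := fine (mu `]x, y]%classic).
have m0 : 0 <= m by exact: fine_ge0.
set M := fine (mu setT); have M0 : 0 <= M by exact: fine_ge0.
have pi0 := pi_gt0 R.
have slope e x' y' : 0 < e -> e < r -> `|x' - l0| < r -> `|y' - l0| < r ->
    x' < y' -> `|(G e y' - G e x') - pi * w * (y' - x')| <= pi * z * (y' - x').
  move=> e0 er hx hy hxy; have [c] := poisson_MVT e0 hxy.
  rewrite in_itv/= => /andP[xc cy] ->.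
  rewrite -mulrBl normrM [X in _ * X]gtr0_norm ?subr_gt0// ler_pM2r ?subr_gt0//.
  apply: Hr => //; move: hx hy; rewrite !ltr_norml => /andP[? ?] /andP[? ?].
  by apply/andP; split; lra.
have half (t : R) : 0 < t -> t / 2 < t by move=> t0; lra.
have inside (u t : R) : 0 < t -> t <= (r - `|u - l0|) / 2 ->
    `|u + t - l0| < r /\ `|u - t - l0| < r.
  move=> t0 tu; have := ler_normD (u - l0) t; have := ler_normB (u - l0) t.
  by rewrite (gtr0_norm t0) ![u + _ - l0]addrAC; split; lra.
have gap (t : R) : 0 < t -> t <= (y - x) / 4 -> x + t < y - t /\ x - t < y + t.
  by move=> t0 ty; split; lra.
(* [x] and [y] are fixed from here on, so an arbitrary slack [d] can absorb the errors caused by [s]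
   and [e]. *)
suff H d : 0 < d -> `|m - w * (y - x)| <= z * (y - x) + d.
  by apply/ler_addgt0Pr.
move=> d0; set D := (`|w| + z).
have D0 : 0 < D by rewrite ltr_wpDl.
(* Moving the end points by [s] costs at most [d / 8] in each term, and keeps them ordered and
   inside the neighbourhood of [l0]. *)
pose s := Num.min (d / (8 * D)) (Num.min ((y - x) / 4)
  (Num.min ((r - `|x - l0|) / 2) ((r - `|y - l0|) / 2))).
have [s0 sd sxy sx sy] : [/\ 0 < s, s * D <= d / 8, s <= (y - x) / 4,
   s <= (r - `|x - l0|) / 2 & s <= (r - `|y - l0|) / 2].
  split.
  - by rewrite !lt_min !divr_gt0 ?mulr_gt0 ?subr_gt0.
  - rewrite -ler_pdivlMr// -mulrA -invfM ge_min lexx//.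
  - by rewrite !ge_min lexx orbT.
  - by rewrite !ge_min lexx !orbT.
  - by rewrite !ge_min lexx !orbT.
have [xsys xsys'] := gap s s0 sxy.
(* The tolerance for the defect of the arctangent from [pi / 2]: multiplied by the masses [m] and
   [M] it stays below [pi d / 4]. The summand 1 avoids a division by zero. *)
pose zz := pi * d / (4 * (m + M + 1)).
have mM : 0 < m + M + 1 by lra.
have zz0 : 0 < zz by rewrite divr_gt0 ?mulr_gt0.
have zzE : zz * (m + M + 1) = pi * d / 4.
  by rewrite /zz; field; rewrite gt_eqF.
have [e1 e10 He1] := atan_near s0 zz0.
pose e := Num.min (r / 2) (e1 / 2).
have e0 : 0 < e by rewrite lt_min !divr_gt0.
have er : e < r by rewrite (@le_lt_trans _ _ (r / 2)) ?ge_min ?lexx// half.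
have ee1 : e < e1 by rewrite (@le_lt_trans _ _ (e1 / 2)) ?ge_min ?lexx ?orbT// half.
have at1 := He1 _ e0 ee1; have at2 := atan_ltpi2 (s / e).
have [b3 b1] := inside x s s0 sx; have [b2 b4] := inside y s s0 sy.
have up := poisson_upper e0 s0 (ltW xy).
have lo := @poisson_lower e s x y e0 s0 (ltW xsys).
have sl1 := slope _ _ _ e0 er b1 b2 xsys'.
have sl2 := slope _ _ _ e0 er b3 b4 xsys.
rewrite -/m in up; rewrite -/m -/M in lo.
move: sl1 sl2; rewrite !ler_norml => /andP[u1 u2] /andP[v1 v2].
have sw : `|s * w| <= d / 8.
  rewrite normrM (ger0_norm (ltW s0)); apply: le_trans sd.
  by rewrite ler_pM2l// lerDl ltW.
have sz : s * z <= d / 8 by apply: le_trans sd; rewrite ler_pM2l// lerDr.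
move: sw; rewrite ler_norml => /andP[sw1 sw2].
apply/andP; split; rewrite -(ler_pM2l pi0).
- have h1 : (pi / 2 - atan (s / e)) * M <= zz * M by rewrite ler_wpM2r//; lra.
  have h2 : pi * (s * w) <= pi * (d / 8) by rewrite ler_pM2l.
  have h3 : 0 <= pi * (s * z) by rewrite !mulr_ge0// ltW.
  have h4 : 0 <= zz * m by rewrite mulr_ge0// ltW.
  have h5 : 0 < pi * d by rewrite mulr_gt0.
  move: v1 lo zzE h1 h2 h3 h4 h5 (ltW zz0); clear; lra.
- have h1 : 2 * (pi / 2 - zz) * m <= 2 * atan (s / e) * m.
    by rewrite ler_wpM2r// ler_pM2l.
  have h2 : pi * (s * w) <= pi * (d / 8) by rewrite ler_pM2l.
  have h3 : pi * (s * z) <= pi * (d / 8) by rewrite ler_pM2l.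
  have h4 : 0 <= zz * M by rewrite mulr_ge0// ltW.
  move: u2 up zzE h1 h2 h3 h4 (ltW zz0); clear; lra.
Qed.

End PoissonInversion.

(** * Recurrences with coefficients of bounded variation *)

Section Perturbation.
Variables (R : realType) (N : nat) (c k0 : R) (ze v : nat -> R[i]) (ka : nat -> R).
Local Notation nm := Normc.normc.
Hypotheses (c_gt0 : 0 < c) (k0_gt0 : 0 < k0).
Hypothesis ze_le1 : forall n, (N <= n)%N -> nm (ze n) <= 1.
Hypothesis ze_im : forall n, (N <= n)%N -> c <= `|complex.Im (ze n)|.
Hypothesis ka_ge : forall n, (N <= n)%N -> k0 <= ka n.+1.
Hypothesis v_rec : forall n, (N <= n)%N ->
  (ka n.+1)%:C * v n.+2 = (ze n.+1 + (ze n.+1)^-1) * v n.+1 - v n.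

Definition qprod (n : nat) : R[i] := \prod_(N <= k < n) ze k.
(** For constant [ze] and [ka = 1], each step divides [v_{n+1} - ze v_n] by [ze] and multiplies
    [v_{n+1} - ze^{-1} v_n] by [ze]. With the factor [qprod n.+1] the first becomes constant and the
    second is multiplied by [ze^2], of modulus at most 1, so that neither grows. *)
Definition dominant (n : nat) : R[i] := qprod n.+1 * (v n.+1 - ze n * v n).
Definition recessive (n : nat) : R[i] :=
  qprod n.+1 * (v n.+1 - (ze n)^-1 * v n).
Definition wave_size (n : nat) : R := nm (dominant n) + nm (recessive n).
Definition wave_error (n : nat) : R := nm (ze n.+1 - ze n) + `|ka n.+1 - 1|.
(** [c^{-2}] comes from the variation of [ze], the other term from [ka - 1] through the bound on
    [qprod n.+1 * v n.+2] in [value2]. *)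
Definition wave_const : R := c ^- 2 + 5 / (k0 * c ^+ 2).

Let ze_ge n : (N <= n)%N -> c <= nm (ze n).
Proof. by move=> Nn; rewrite (le_trans (ze_im Nn))// normc_Im. Qed.

Let ze_neq0 n : (N <= n)%N -> ze n != 0.
Proof. by move=> Nn; rewrite -normc_gt0 (lt_le_trans c_gt0)// ze_ge. Qed.

Let c_le1 : c <= 1.
Proof. exact: le_trans (ze_ge (leqnn N)) (ze_le1 (leqnn N)). Qed.

Lemma qprodS n : (N <= n)%N -> qprod n.+1 = qprod n * ze n.
Proof. by move=> Nn; rewrite /qprod big_nat_recr. Qed.

(** [ze^{-1}] and [- ze] have imaginary parts of the same sign, so these add up. The quantity is the
    determinant by which [v] is recovered from its dominant and recessive parts. *)
Lemma normc_invB n : (N <= n)%N -> c <= nm ((ze n)^-1 - ze n).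
Proof.
move=> Nn; rewrite (le_trans (ze_im Nn))// (le_trans _ (normc_Im _))//.
have := ze_neq0 Nn; case: (ze n) => x y; rewrite eq_complex/= negb_and => xy.
have r0 : 0 < x ^+ 2 + y ^+ 2.
  by case/orP: xy => h; [apply: ltr_pwDl|apply: ltr_wpDl];
    rewrite ?sqr_ge0// lt0r sqr_ge0 sqrf_eq0 h.
rewrite -mulNr -[X in _ + X]mulN1r -[- y]mulN1r -!mulrA -mulrDr normrM normrN1 mul1r.
have -> : y / (x ^+ 2 + y ^+ 2) + y = y * ((x ^+ 2 + y ^+ 2)^-1 + 1) by ring.
by rewrite normrM ler_peMr// ger0_norm ?addr_ge0 ?invr_ge0 ?(ltW r0)// lerDr invr_ge0 ltW.
Qed.

Lemma wave_value n : (N <= n)%N ->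
  nm (qprod n.+1 * v n) <= wave_size n / c.
Proof.
move=> Nn; rewrite ler_pdivlMr//.
have e : qprod n.+1 * v n * ((ze n)^-1 - ze n) = dominant n - recessive n.
  by rewrite /dominant /recessive; ring.
have := ler_normcB (dominant n) (recessive n); rewrite -e Normc.normcM.
by apply: le_trans; rewrite ler_wpM2l ?normc_ge0 ?normc_invB.
Qed.

Lemma wave_size_ge0 n : 0 <= wave_size n.
Proof. by rewrite addr_ge0// normc_ge0. Qed.

Lemma wave_error_ge0 n : 0 <= wave_error n.
Proof. by rewrite addr_ge0// normc_ge0. Qed.

Lemma wave_const_ge0 : 0 <= wave_const.
Proof.
by rewrite addr_ge0 ?divr_ge0 ?invr_ge0 ?mulr_ge0 ?exprn_ge0// ltW.
Qed.

Let value1 n : (N <= n)%N -> nm (qprod n.+1 * v n.+1) <= 2 * wave_size n / c.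
Proof.
move=> Nn; have e : qprod n.+1 * v n.+1 = dominant n + ze n * (qprod n.+1 * v n).
  by rewrite /dominant; ring.
rewrite e (le_trans (ler_normcD _ _))// [nm (ze n * _)]Normc.normcM.
have h1 : nm (ze n) * nm (qprod n.+1 * v n) <= wave_size n / c.
  apply: le_trans (wave_value Nn).
  by rewrite ler_piMl ?normc_ge0// ze_le1.
have h2 : wave_size n <= wave_size n / c.
  by rewrite ler_peMr ?wave_size_ge0// invf_ge1.
have : nm (dominant n) <= wave_size n by rewrite lerDl normc_ge0.
lra.
Qed.

Let value2 n : (N <= n)%N ->
  nm (qprod n.+1 * v n.+2) <= 5 / (k0 * c ^+ 2) * wave_size n.
Proof.
move=> Nn; have Nn1 : (N <= n.+1)%N by rewrite leqW.
have h := ka_ge Nn; have kp : 0 < ka n.+1 by rewrite (lt_le_trans k0_gt0).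
have e : nm (qprod n.+1 * v n.+2) * ka n.+1 =
    nm ((ze n.+1 + (ze n.+1)^-1) * (qprod n.+1 * v n.+1) - qprod n.+1 * v n).
  rewrite -[in LHS](gtr0_norm kp) -normc_real -Normc.normcM; congr nm.
  transitivity (qprod n.+1 * ((ka n.+1)%:C * v n.+2)); first ring.
  by rewrite v_rec//; ring.
have z2 : nm (ze n.+1 + (ze n.+1)^-1) <= 2 / c.
  rewrite (le_trans (ler_normcD _ _))// Normc.normcV.
  have h1 : nm (ze n.+1) <= c^-1.
    by rewrite (le_trans (ze_le1 Nn1))// invf_ge1.
  have h2 : (nm (ze n.+1))^-1 <= c^-1.
    by rewrite lef_pV2 ?posrE ?ze_ge// (lt_le_trans c_gt0)// ze_ge.
  lra.
have X0 := wave_size_ge0 n.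
(* Of the 5, 4 comes from the term in [v_{n+1}] and 1 from that in [v_n]. *)
have bound : nm (qprod n.+1 * v n.+2) * ka n.+1 <= 5 / c ^+ 2 * wave_size n.
  rewrite e (le_trans (ler_normcB _ _))// Normc.normcM.
  have h1 : nm (ze n.+1 + (ze n.+1)^-1) * nm (qprod n.+1 * v n.+1) <=
     2 / c * (2 * wave_size n / c).
    by rewrite ler_pM ?normc_ge0// value1.
  have h2 : wave_size n / c <= wave_size n / c ^+ 2.
    rewrite ler_wpM2l// lef_pV2 ?posrE ?exprn_gt0//.
    by rewrite expr2 ler_piMl// ltW.
  have := wave_value Nn.
  have e1 : 2 / c * (2 * wave_size n / c) = 4 * (wave_size n / c ^+ 2).
    by field; rewrite gt_eqF.
  have -> : 5 / c ^+ 2 * wave_size n = 5 * (wave_size n / c ^+ 2) by ring.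
  by rewrite e1 in h1; lra.
have -> : 5 / (k0 * c ^+ 2) * wave_size n = (5 / c ^+ 2 * wave_size n) / k0.
  by field; rewrite !gt_eqF.
rewrite ler_pdivlMr//; apply: le_trans bound.
by rewrite ler_wpM2l ?normc_ge0.
Qed.

Let error_bound n (f x : R[i]) : (N <= n)%N ->
  nm f <= nm (ze n.+1 - ze n) * c ^-1 -> nm x <= 1 ->
  nm (f * (qprod n.+1 * v n) +
      (1 - ka n.+1)%:C * (x * (qprod n.+1 * v n.+2))) <=
  wave_const * wave_error n * wave_size n.
Proof.
move=> Nn hf hx; have X0 := wave_size_ge0 n.
have h1 := wave_value Nn; have h2 := value2 Nn.
set W0 := qprod n.+1 * v n in h1 *; set W2 := qprod n.+1 * v n.+2 in h2 *.
have t1 : nm (f * W0) <= nm (ze n.+1 - ze n) * (c ^- 2 * wave_size n).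
  rewrite Normc.normcM; apply: le_trans (ler_pM _ _ hf h1) _; rewrite ?normc_ge0//.
  by rewrite le_eqVlt; apply/orP; left; apply/eqP; field; rewrite gt_eqF.
have t2 : nm ((1 - ka n.+1)%:C * (x * W2)) <=
    `|ka n.+1 - 1| * (5 / (k0 * c ^+ 2) * wave_size n).
  rewrite Normc.normcM normc_real distrC ler_wpM2l// Normc.normcM.
  by rewrite (le_trans _ h2)// ler_piMl ?normc_ge0.
rewrite (le_trans (ler_normcD _ _))// (le_trans (lerD t1 t2))//.
rewrite /wave_const /wave_error.
set E1 := nm (ze n.+1 - ze n); set E2 := `|_ - 1|.
set A := c ^- 2; set B := 5 / _.
have A0 : 0 <= A by rewrite invr_ge0 exprn_ge0// ltW.
have B0 : 0 <= B by rewrite divr_ge0// mulr_ge0 ?exprn_ge0 ?(ltW k0_gt0) ?(ltW c_gt0).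
have p1 : 0 <= E1 * (B * wave_size n).
  by apply: mulr_ge0; [exact: normc_ge0|exact: mulr_ge0].
have p2 : 0 <= E2 * (A * wave_size n).
  by apply: mulr_ge0; [exact: normr_ge0|exact: mulr_ge0].
have -> : (A + B) * (E1 + E2) * wave_size n = E1 * (A * wave_size n) +
  E2 * (B * wave_size n) + E1 * (B * wave_size n) + E2 * (A * wave_size n) by ring.
lra.
Qed.

(** Inserting the recurrence for [v_{n+2}] leaves only a term with the factor [ze n - ze n.+1] and
    one with [1 - ka n.+1], both summable in the application. *)
Lemma dominant_step n : (N <= n)%N ->
  nm (dominant n.+1 - dominant n) <= wave_const * wave_error n * wave_size n.
Proof.
move=> Nn; have Nn1 : (N <= n.+1)%N by rewrite leqW.
have zn := ze_neq0 Nn1.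
have -> : dominant n.+1 - dominant n = (ze n - ze n.+1) * (qprod n.+1 * v n) +
    (1 - ka n.+1)%:C * (ze n.+1 * (qprod n.+1 * v n.+2)).
  rewrite /dominant (qprodS Nn1) rmorphB/= rmorph1.
  transitivity (qprod n.+1 * (ze n.+1 * v n.+2 -
    ze n.+1 ^+ 2 * v n.+1 - v n.+1 + ze n * v n)); first ring.
  transitivity (qprod n.+1 * ((ze n - ze n.+1) * v n + ze n.+1 * v n.+2
     - ze n.+1 * ((ka n.+1)%:C * v n.+2))); last by ring.
  by rewrite v_rec//; field.
apply: error_bound => //; last exact: ze_le1.
by rewrite normc_distC ler_peMr ?normc_ge0// invf_ge1.
Qed.

Lemma recessive_step n : (N <= n)%N ->
  nm (recessive n.+1 - ze n.+1 ^+ 2 * recessive n) <=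
  wave_const * wave_error n * wave_size n.
Proof.
move=> Nn; have Nn1 : (N <= n.+1)%N by rewrite leqW.
have zn := ze_neq0 Nn; have zn1 := ze_neq0 Nn1.
have -> : recessive n.+1 - ze n.+1 ^+ 2 * recessive n =
    (ze n.+1 * (ze n.+1 - ze n) / ze n) * (qprod n.+1 * v n) +
    (1 - ka n.+1)%:C * (ze n.+1 * (qprod n.+1 * v n.+2)).
  rewrite /recessive (qprodS Nn1) rmorphB/= rmorph1.
  transitivity (qprod n.+1 * (ze n.+1 * v n.+2 - v n.+1 - ze n.+1 ^+ 2 * v n.+1
    + ze n.+1 ^+ 2 / ze n * v n)); first by field; rewrite zn zn1.
  transitivity (qprod n.+1 * (ze n.+1 * (ze n.+1 - ze n) / ze n * v n + ze n.+1 * v n.+2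
     - ze n.+1 * ((ka n.+1)%:C * v n.+2))); last by ring.
  by rewrite v_rec//; field; rewrite zn zn1.
apply: error_bound => //; last exact: ze_le1.
rewrite !Normc.normcM Normc.normcV ler_pM ?invr_ge0 ?mulr_ge0 ?normc_ge0//.
  by rewrite ler_piMl ?normc_ge0// ze_le1.
by rewrite lef_pV2 ?posrE ?ze_ge// (lt_le_trans c_gt0)// ze_ge.
Qed.

Lemma wave_size_step n : (N <= n)%N ->
  wave_size n.+1 <= wave_size n * (1 + 2 * wave_const * wave_error n).
Proof.
move=> Nn; have h1 := dominant_step Nn; have h2 := recessive_step Nn.
have h3 : nm (dominant n.+1) <= nm (dominant n.+1 - dominant n) + nm (dominant n).
  by rewrite (le_trans _ (ler_normcD _ _))// subrK.
have h4 : nm (recessive n.+1) <= nm (recessive n.+1 - ze n.+1 ^+ 2 * recessive n) +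
    nm (recessive n).
  have : nm (ze n.+1 ^+ 2 * recessive n) <= nm (recessive n).
    have z1 := ze_le1 (leqW Nn).
    rewrite Normc.normcM expr2 [nm (ze n.+1 * ze n.+1)]Normc.normcM.
    rewrite ler_piMl ?normc_ge0// -[leRHS]mulr1.
    by apply: ler_pM; rewrite ?normc_ge0.
  have := ler_normcD (recessive n.+1 - ze n.+1 ^+ 2 * recessive n)
     (ze n.+1 ^+ 2 * recessive n); rewrite subrK; lra.
rewrite {1}/wave_size mulrDr mulr1.
have -> : wave_size n * (2 * wave_const * wave_error n) =
  2 * (wave_const * wave_error n * wave_size n) by ring.
by rewrite {1}/wave_size; lra.
Qed.

(** Discrete Gronwall inequality, through [1 + x <= exp x]. *)
Lemma wave_size_bound n : (N <= n)%N -> wave_size n <=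
  wave_size N * expR (2 * wave_const * \sum_(N <= k < n) wave_error k).
Proof.
elim: n => [|n IH].
  by rewrite leqn0 => /eqP <-; rewrite big_geq// mulr0 expR0 mulr1.
rewrite leq_eqVlt => /orP[/eqP <-|]; first by rewrite big_geq// mulr0 expR0 mulr1.
rewrite ltnS => Nn; rewrite big_nat_recr//= mulrDr expRD mulrA.
rewrite (le_trans (wave_size_step Nn))// ler_pM ?wave_size_ge0 ?IH//.
  by rewrite addr_ge0// !mulr_ge0 ?wave_const_ge0 ?wave_error_ge0.
exact: expR_ge1Dx.
Qed.

Lemma dominant_cauchy n m B : (N <= n)%N -> (n <= m)%N ->
  (forall i, (N <= i)%N -> wave_size i <= B) ->
  nm (dominant m - dominant n) <=
    wave_const * B * \sum_(n <= k < m) wave_error k.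
Proof.
move=> Nn + HB; elim: m => [|m IH].
  by rewrite leqn0 => /eqP ->; rewrite subrr Normc.normc0 big_geq// mulr0.
rewrite leq_eqVlt => /orP[/eqP ->|].
  by rewrite subrr Normc.normc0 big_geq// mulr0.
rewrite ltnS => nm; rewrite big_nat_recr//= mulrDr.
have -> : dominant m.+1 - dominant n =
  (dominant m - dominant n) + (dominant m.+1 - dominant m) by ring.
have Nm := leq_trans Nn nm.
rewrite (le_trans (ler_normcD _ _))// lerD ?IH// (le_trans (dominant_step Nm))//.
rewrite mulrAC ler_wpM2r ?wave_error_ge0// ler_wpM2l ?wave_const_ge0// HB//.
Qed.

End Perturbation.

(** * The branch of the inverse Joukowsky map *)

Section JoukowskyBranch.
Variable R : realType.
Local Notation nm := Normc.normc.
Implicit Types (x t : R[i]).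

(* The root of [t ^ 2 - 2 x t + 1] in the closed lower half plane; for [x] in
   the closed upper half plane off the real rays [|x| >= 1] it is the branch
   [x - sqrt (x ^ 2 - 1)] of modulus at most 1. *)
Definition zeta x : R[i] :=
  let w := sqrtc (x ^+ 2 - 1) in
  if complex.Im (x - w) <= 0 then x - w else x + w.

Lemma zeta_root x : zeta x ^+ 2 - 2 * x * zeta x + 1 = 0.
Proof.
have := sqr_sqrtc (x ^+ 2 - 1); rewrite /zeta.
set w := sqrtc _ => e.
by case: ifP => _; apply/eqP; rewrite -subr_eq0 subr0; apply/eqP;
  rewrite -[RHS](subrr (x ^+ 2 - 1)) -{1}e; ring.
Qed.

Section Root.
Variables (x t : R[i]) (kp : R).
Hypothesis root_t : t ^+ 2 - 2 * x * t + 1 = 0.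
Hypotheses (kp_ge0 : 0 <= kp) (kp_lt1 : kp < 1).
Hypotheses (x_re : `|complex.Re x| <= kp) (x_norm : nm x <= 1).

Lemma root_neq0 : t != 0.
Proof.
apply/eqP => t0; move: root_t; rewrite t0 expr0n mulr0 subr0 add0r => /eqP.
by rewrite oner_eq0.
Qed.

Lemma root_inv : t^-1 = 2 * x - t.
Proof.
apply: (mulfI root_neq0); rewrite mulfV ?root_neq0//.
by apply/eqP; rewrite -subr_eq0; apply/eqP; rewrite -[RHS]root_t; ring.
Qed.

Lemma rootE : t + t^-1 = 2 * x.
Proof. by rewrite root_inv addrC subrK. Qed.

Let p := complex.Re t.
Let q := complex.Im t.
Let r := p ^+ 2 + q ^+ 2.

Let r_gt0 : 0 < r.
Proof. by rewrite /r -sqr_normcE exprn_gt0// normc_gt0 root_neq0. Qed.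

(** Real and imaginary parts of [t + 1 / t = 2 x], multiplied by [r = |t|^2]. *)
Let eqs : p * (r + 1) = 2 * complex.Re x * r /\ q * (r - 1) = 2 * complex.Im x * r.
Proof.
have e : (t * t - (x + x) * t + 1) * t^* = 0.
  by rewrite -(mul0r t^*) -root_t expr2 mulr_natl mulr2n.
have eR := congr1 (@complex.Re R) e; have eI := congr1 (@complex.Im R) e.
move: eR eI; rewrite !ReImE /= -/p -/q /r => eR eI.
by split; apply/eqP; rewrite -subr_eq0; apply/eqP;
  [rewrite -[RHS]eR|rewrite -[RHS]eI]; ring.
Qed.

(** From the first equation and [(r + 1)^2 >= 4 r]. It keeps [t] off the real axis, since it makes
    [q^2] at least [(1 - kp^2) r]. *)
Let p_le : p ^+ 2 <= kp ^+ 2 * r.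
Proof.
have [e _] := eqs; set X := complex.Re x in e.
have X2 : X ^+ 2 <= kp ^+ 2.
  by rewrite -real_normK ?num_real// ler_pXn2r// nnegrE.
have h : (p * (r + 1)) ^+ 2 = 4 * X ^+ 2 * r ^+ 2 by rewrite e; ring.
have h2 : 4 * r * p ^+ 2 <= 4 * r * (kp ^+ 2 * r).
  have : 0 <= (r - 1) ^+ 2 * p ^+ 2 by rewrite mulr_ge0// sqr_ge0.
  have : X ^+ 2 * r ^+ 2 <= kp ^+ 2 * r ^+ 2 by rewrite ler_wpM2r// sqr_ge0.
  move: h; lra.
by rewrite ler_pM2l in h2; rewrite ?mulr_gt0.
Qed.

Let r_norm : nm t ^+ 2 = r.
Proof. exact: sqr_normcE. Qed.

Let t_ge : nm t <= 1 -> 1 / 3 <= nm t.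
Proof.
move=> t1; have t0 : 0 < nm t by rewrite normc_gt0 root_neq0.
have : (nm t)^-1 <= 3.
  rewrite -Normc.normcV root_inv (le_trans (ler_normcB _ _))//.
  have : nm (2 * x) <= 2.
    rewrite mulr_natl mulr2n (le_trans (ler_normcD _ _))//.
    by rewrite -[leRHS]/(1 + 1) lerD.
  lra.
by move=> h; rewrite div1r -[nm t]invrK lef_pV2// posrE ?invr_gt0.
Qed.

Let q_ge : (1 - kp ^+ 2) * r <= q ^+ 2.
Proof. by have := p_le; rewrite /r; lra. Qed.

Let kp2 : 0 < 1 - kp ^+ 2.
Proof. by rewrite subr_gt0 expr_lt1. Qed.

Let q_neq0 : q != 0.
Proof. by rewrite -sqrf_eq0 gt_eqF// (lt_le_trans _ q_ge)// mulr_gt0. Qed.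

Lemma root_le1 : complex.Im t <= 0 -> 0 <= complex.Im x -> nm t <= 1.
Proof.
move=> tim xim; have [_ e] := eqs.
have q0 : q < 0 by rewrite lt_neqAle q_neq0.
rewrite -(@ler_pXn2r _ 2)// ?nnegrE ?normc_ge0// expr1n r_norm.
rewrite leNgt; apply/negP => r1.
have : q * (r - 1) < 0 by rewrite nmulr_rlt0// subr_gt0.
by rewrite e ltNge !mulr_ge0// ltW.
Qed.

(** The 3 comes from [1 / |t| = |2 x - t| <= 3], which bounds [r] below by [1 / 9]. *)
Lemma root_im : complex.Im t <= 0 -> 0 <= complex.Im x ->
  Num.sqrt (1 - kp ^+ 2) / 3 <= - complex.Im t.
Proof.
move=> tim xim; have t1 := root_le1 tim xim; have t3 := t_ge t1.
rewrite -(@ler_pXn2r _ 2)// ?nnegrE ?divr_ge0 ?sqrtr_ge0 ?oppr_ge0//.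
rewrite exprMn sqr_sqrtr ?(ltW kp2)// sqrrN.
apply: le_trans q_ge; rewrite ler_pM2l// -r_norm -[3^-1]div1r.
by rewrite ler_pXn2r// nnegrE ?normc_ge0// divr_ge0.
Qed.

Lemma root_im_real : complex.Im x = 0 -> nm t = 1.
Proof.
move=> x0; have [_ e] := eqs; move/eqP: e; rewrite x0 mulr0 mul0r mulf_eq0.
rewrite (negbTE q_neq0)/= subr_eq0 -r_norm => /eqP e.
by apply/eqP; rewrite -(@eqrXn2 _ 2)// ?normc_ge0// e expr1n.
Qed.

End Root.

(** The roots [x - w] and [x + w] are inverse to each other, and inversion reverses the sign of the
    imaginary part; so if the first lies above the real axis, the second lies below. *)
Lemma zeta_im_le0 x : `|complex.Re x| < 1 -> nm x <= 1 -> complex.Im (zeta x) <= 0.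
Proof.
move=> xre x1; rewrite /zeta; set w := sqrtc _; case: ifP => // /negbT; rewrite -ltNge => h.
have root_m : (x - w) ^+ 2 - 2 * x * (x - w) + 1 = 0.
  apply/eqP; rewrite -subr_eq0 subr0; apply/eqP.
  by rewrite -[RHS](subrr (x ^+ 2 - 1)) -{1}(sqr_sqrtc (x ^+ 2 - 1)) -/w; ring.
have e : (x - w) * (x + w) = 1.
  rewrite -[RHS](subKr (x ^+ 2)) -(sqr_sqrtc (x ^+ 2 - 1)) -/w; ring.
have e2 : complex.Im ((x - w) * (x + w)) * 1 = 0 by rewrite e mulr1.
have -> : x + w = (x - w)^-1.
  by apply: (mulfI (root_neq0 root_m)); rewrite e mulfV// (root_neq0 root_m).
have -> : complex.Im (x - w)^-1 = - complex.Im (x - w) / nm (x - w) ^+ 2.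
  by rewrite sqr_normcE; case: (x - w) => ? ?; rewrite /= mulNr.
by rewrite mulNr oppr_le0 divr_ge0 ?sqr_ge0// ltW.
Qed.

(** The identity [(t - t') (t' - 1 / t) = 2 (x - x') t'] avoids any derivative of the branch: [t']
    lies at least [c] below the real axis and [1 / t] on or above it, so the second factor has
    modulus at least [c]. *)
Lemma root_lip x x' t t' c : t ^+ 2 - 2 * x * t + 1 = 0 ->
  t' ^+ 2 - 2 * x' * t' + 1 = 0 -> 0 < c ->
  c <= - complex.Im t' -> complex.Im t <= 0 -> nm t' <= 1 ->
  nm (t - t') <= 2 / c * nm (x - x').
Proof.
move=> e e' c0 ct' t0 t'1.
have d : (t - t') * (t' - t^-1) = 2%:R * ((x - x') * t').
  rewrite (root_inv e).
  have h : t * (t - 2 * x) = -1.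
    by apply/eqP; rewrite -subr_eq0 opprK -[X in _ == X]e; apply/eqP; ring.
  have h' : t' * (t' - 2 * x') = -1.
    by apply/eqP; rewrite -subr_eq0 opprK -[X in _ == X]e'; apply/eqP; ring.
  transitivity (t * (t - 2 * x) - t' * (t' - 2 * x') + 2%:R * ((x - x') * t')); first ring.
  by rewrite h h' subrr add0r.
have im : c <= nm (t' - t^-1).
  rewrite (le_trans _ (normc_Im _))// ImD ImN.
  have : 0 <= complex.Im t^-1.
    have -> : complex.Im t^-1 = - complex.Im t / nm t ^+ 2.
      by rewrite sqr_normcE; case: (t) => ? ?; rewrite /= mulNr.
    by rewrite divr_ge0 ?sqr_ge0// oppr_ge0.
  by move=> h; rewrite ler0_norm; lra.
rewrite mulrAC ler_pdivlMr//.
apply: (@le_trans _ _ (nm (t - t') * nm (t' - t^-1))).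
  by rewrite ler_wpM2l ?normc_ge0.
rewrite -Normc.normcM d mulr_natl mulr2n (le_trans (ler_normcD _ _))//.
rewrite Normc.normcM.
have : nm (x - x') * nm t' <= nm (x - x') by rewrite ler_piMr ?normc_ge0.
lra.
Qed.

Lemma zeta_real (y : R) : `|y| < 1 -> zeta y%:C = zeta_edge true y.
Proof.
move=> y1; have y2 : 0 < 1 - y ^+ 2.
  by rewrite subr_gt0 -real_normK ?num_real// expr_lt1.
rewrite /zeta_edge /sqrt_edge (ltW y1) mul1r.
set s := Num.sqrt (1 - y ^+ 2); have s0 : 0 < s by rewrite sqrtr_gt0.
have s2 : s ^+ 2 = 1 - y ^+ 2 by rewrite sqr_sqrtr// ltW.
rewrite /zeta; set w := sqrtc _.
have e : (w - 0 +i* s) * (w + 0 +i* s) = 0.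
  transitivity (w ^+ 2 - (0 +i* s) ^+ 2); first by ring.
  rewrite sqr_sqrtc; apply: complexP; rewrite !expr2 !ReImE /=; last by ring.
  by move: s2; rewrite !expr2; lra.
move/eqP: e; rewrite mulf_eq0 subr_eq0 addr_eq0 => /orP[] /eqP ->.
  by rewrite !ReImE /= sub0r oppr_le0 (ltW s0).
by rewrite opprK !ReImE /= add0r leNgt s0.
Qed.

End JoukowskyBranch.

Section ComplexLimits.
Local Notation "z ^*" := (conjc z) : ring_scope.
Variable R : realType.
Local Notation nm := Normc.normc.
Implicit Types (x y : nat -> R[i]) (l m : R[i]).

Definition ccvg x l := nm (x n - l) @[n --> \oo] --> (0 : R).

Lemma ccvgP x l : ccvg x l <->
  complex.Re (x n) @[n --> \oo] --> complex.Re l /\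
  complex.Im (x n) @[n --> \oo] --> complex.Im l.
Proof.
split=> [xl|[xr xi]].
  have H e : 0 < e -> \forall n \near \oo, nm (x n - l) <= e.
    move=> e0; have /cvgrPdist_le/(_ e e0) := xl; apply: filterS => n.
    by rewrite sub0r normrN ger0_norm ?normc_ge0.
  split; apply/cvgrPdist_le => e /H; apply: filterS => n; apply: le_trans;
    rewrite distrC.
    by rewrite -ReN -ReD normc_Re.
  by rewrite -ImN -ImD normc_Im.
apply: (@squeeze_cvgr _ _ _ _ (fun=> 0)
  (fun n => `|complex.Re (x n) - complex.Re l| + `|complex.Im (x n) - complex.Im l|)).
- apply: nearW => n; rewrite normc_ge0/=.
  by rewrite (le_trans (normc_le_ReIm _))// ReD ReN ImD ImN.
- exact: cvg_cst.
- rewrite -[X in _ --> X](addr0 0); apply: cvgD.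
    by rewrite -(normr0 R); apply: cvg_norm; apply/subr_cvg0.
  by rewrite -(normr0 R); apply: cvg_norm; apply/subr_cvg0.
Qed.

Lemma ccvg_cst l : ccvg (fun=> l) l.
Proof. by apply/ccvgP; split; exact: cvg_cst. Qed.

Lemma ccvgD x y l m : ccvg x l -> ccvg y m -> ccvg (fun n => x n + y n) (l + m).
Proof.
move=> /ccvgP[xr xi] /ccvgP[yr yi]; apply/ccvgP; rewrite ReD ImD; split.
  by under eq_fun do rewrite ReD; apply: cvgD.
by under eq_fun do rewrite ImD; apply: cvgD.
Qed.

Lemma ccvgN x l : ccvg x l -> ccvg (fun n => - x n) (- l).
Proof.
move=> /ccvgP[xr xi]; apply/ccvgP; rewrite ReN ImN; split.
  by under eq_fun do rewrite ReN; apply: cvgN.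
by under eq_fun do rewrite ImN; apply: cvgN.
Qed.

Lemma ccvgB x y l m : ccvg x l -> ccvg y m -> ccvg (fun n => x n - y n) (l - m).
Proof. by move=> xl ym; apply: ccvgD => //; exact: ccvgN. Qed.

Lemma ccvgM x y l m : ccvg x l -> ccvg y m -> ccvg (fun n => x n * y n) (l * m).
Proof.
move=> /ccvgP[xr xi] /ccvgP[yr yi]; apply/ccvgP; rewrite ReM ImM; split.
  by under eq_fun do rewrite ReM; apply: cvgB; apply: cvgM.
by under eq_fun do rewrite ImM; apply: cvgD; apply: cvgM.
Qed.

Lemma ccvgJ x l : ccvg x l -> ccvg (fun n => (x n)^*) l^*.
Proof.
move=> /ccvgP[xr xi]; apply/ccvgP; rewrite ReJ ImJ; split.
  by under eq_fun do rewrite ReJ.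
by under eq_fun do rewrite ImJ; apply: cvgN.
Qed.

Lemma ccvg_norm x l : ccvg x l -> nm (x n) @[n --> \oo] --> nm l.
Proof.
move=> xl; apply/subr_cvg0; apply: norm_cvg0.
apply: (@squeeze_cvgr _ _ _ _ (fun=> 0) (fun n => nm (x n - l))) => //.
- apply: nearW => n; rewrite normr_ge0/= ler_norml; apply/andP; split.
    have := ler_normcD (l - x n) (x n); rewrite subrK normc_distC; lra.
  by have := ler_normcD (x n - l) l; rewrite subrK; lra.
- exact: cvg_cst.
Qed.

Lemma ccvg_real (r : nat -> R) (s : R) : r n @[n --> \oo] --> s ->
  ccvg (fun n => (r n)%:C) s%:C.
Proof. by move=> rs; apply/ccvgP; split => //=; exact: cvg_cst. Qed.

Lemma invcE (z : R[i]) : z^-1 = (nm z ^- 2)%:C * z^*.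
Proof.
have [->|z0] := eqVneq z 0; first by rewrite invr0 rmorph0 mulr0.
apply: (mulfI z0); rewrite mulfV// mulrCA.
have -> : z * z^* = (nm z ^+ 2)%:C.
  by apply: complexP; rewrite !ReImE sqr_normcE/=; ring.
by rewrite -rmorphM/= mulVf ?rmorph1// sqrf_eq0 normc_eq0.
Qed.

Lemma ccvgV x l : l != 0 -> ccvg x l -> ccvg (fun n => (x n)^-1) l^-1.
Proof.
move=> l0 xl; rewrite invcE; under eq_fun do rewrite invcE.
apply: ccvgM; last exact: ccvgJ.
apply: ccvg_real; apply: cvgV; first by rewrite sqrf_eq0 normc_eq0.
by rewrite expr2; under eq_fun do rewrite expr2; apply: cvgM; exact: ccvg_norm.
Qed.

Lemma ccvg_unique x l m : ccvg x l -> ccvg x m -> l = m.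
Proof.
move=> /ccvgP[xr xi] /ccvgP[yr yi].
by apply: complexP; [exact: cvg_unique xr yr|exact: cvg_unique xi yi].
Qed.

Lemma ccvg_near x y l : (\forall n \near \oo, x n = y n) -> ccvg x l -> ccvg y l.
Proof.
move=> xy; rewrite /ccvg => xl; apply: cvg_trans xl; apply: near_eq_cvg.
by apply: filterS xy => n ->.
Qed.

Lemma ccvg_bounded0 x y B : ccvg x 0 -> (forall n, nm (y n) <= B) ->
  ccvg (fun n => x n * y n) 0.
Proof.
move=> x0 yB; apply: (@squeeze_cvgr _ _ _ _ (fun=> 0) (fun n => nm (x n - 0) * B)).
- apply: nearW => n; rewrite normc_ge0/= !subr0 Normc.normcM.
  by rewrite ler_wpM2l ?normc_ge0.
- exact: cvg_cst.
- by rewrite -(mul0r B); apply: cvgMr_tmp.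
Qed.

Lemma ccvg_cauchy x : (forall e : R, 0 < e -> exists n0, forall n,
    (n0 <= n)%N -> nm (x n - x n0) <= e) -> exists l, ccvg x l.
Proof.
move=> H.
have C (f : R[i] -> R) : (forall z w, `|f z - f w| <= nm (z - w)) ->
    cvg (f (x n) @[n --> \oo]).
  move=> fl; apply/cauchy_cvgP; apply: cauchy_exP => e e0.
  have [n0 Hn0] := H (e / 2) (divr_gt0 e0 (ltr0n _ 2)).
  exists (f (x n0)); exists n0 => // n /= n0n; rewrite /ball/= distrC.
  by rewrite (le_lt_trans (fl _ _))// (le_lt_trans (Hn0 _ n0n))//; lra.
have cr := C (@complex.Re R) (fun z w => ltac:(rewrite -ReN -ReD; exact: normc_Re)).
have ci := C (@complex.Im R) (fun z w => ltac:(rewrite -ImN -ImD; exact: normc_Im)).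
exists (limn (fun n => complex.Re (x n)) +i* limn (fun n => complex.Im (x n))).
by apply/ccvgP.
Qed.

End ComplexLimits.

(** * Lipschitz dependence on the spectral parameter *)

Section BoundedLipschitz.
Variables (R : realType) (Om : set R[i]).
Local Notation nm := Normc.normc.
Implicit Types f g : R[i] -> R[i].

(** An algebra of functions containing the constants and, on a bounded set, the identity; it gives
    continuity in [z] of the finite expressions built from the recurrence. *)
Definition bounded_lipschitz f := exists2 B : R, 0 <= B &
  forall z z', Om z -> Om z' -> nm (f z) <= B /\ nm (f z - f z') <= B * nm (z - z').

Lemma bl_cst c : bounded_lipschitz (fun=> c).
Proof.
exists (nm c); rewrite ?normc_ge0// => z z' _ _; split=> //.
by rewrite subrr Normc.normc0 mulr_ge0 ?normc_ge0.
Qed.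

Lemma blD f g : bounded_lipschitz f -> bounded_lipschitz g ->
  bounded_lipschitz (fun z => f z + g z).
Proof.
move=> [B B0 Hf] [C C0 Hg]; exists (B + C); first exact: addr_ge0.
move=> z z' Oz Oz'; have [f1 f2] := Hf z z' Oz Oz'; have [g1 g2] := Hg z z' Oz Oz'.
split; first by rewrite (le_trans (ler_normcD _ _))// lerD.
rewrite opprD addrACA (le_trans (ler_normcD _ _))// mulrDl lerD//.
Qed.

Lemma blM f g : bounded_lipschitz f -> bounded_lipschitz g ->
  bounded_lipschitz (fun z => f z * g z).
Proof.
move=> [B B0 Hf] [C C0 Hg]; exists (B * C + B * C).
  by rewrite addr_ge0// mulr_ge0.
move=> z z' Oz Oz'; have [f1 f2] := Hf z z' Oz Oz'; have [g1 g2] := Hg z z' Oz Oz'.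
have [g1' _] := Hg z' z' Oz' Oz'; split.
  rewrite Normc.normcM (le_trans (ler_pM _ _ f1 g1)) ?normc_ge0//.
  by rewrite lerDl mulr_ge0.
rewrite (_ : _ - _ = f z * (g z - g z') + (f z - f z') * g z'); last by ring.
rewrite (le_trans (ler_normcD _ _))// !Normc.normcM mulrDl lerD//.
  by rewrite -mulrA ler_pM ?normc_ge0.
by rewrite mulrAC ler_pM ?normc_ge0.
Qed.

Lemma blN f : bounded_lipschitz f -> bounded_lipschitz (fun z => - f z).
Proof.
move=> Hf; have := blM (bl_cst (-1)) Hf; congr bounded_lipschitz.
by apply/funext => z; rewrite mulN1r.
Qed.

Lemma bl_id (rho : R) : 0 <= rho -> (forall z, Om z -> nm z <= rho) ->
  bounded_lipschitz id.
Proof.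
move=> r0 H; exists (rho + 1); first by rewrite addr_ge0.
move=> z z' Oz _; have := H _ Oz; split; first by lra.
by rewrite ler_peMl ?normc_ge0//; lra.
Qed.

Lemma bl_prod (I : Type) (r : seq I) (F : I -> R[i] -> R[i]) :
  (forall i, bounded_lipschitz (F i)) ->
  bounded_lipschitz (fun z => \prod_(i <- r) F i z).
Proof.
move=> H; elim: r => [|i r IH].
  by have := bl_cst 1; congr bounded_lipschitz; apply/funext => z; rewrite big_nil.
have := blM (H i) IH; congr bounded_lipschitz.
by apply/funext => z; rewrite big_cons.
Qed.

End BoundedLipschitz.

(** * The coefficients of the scaled recurrence *)

Section Coefficients.
Variables (R : realType) (a b : nat -> R) (am1 : R).
Hypotheses (a_gt0 : forall n, 0 < a n).
Local Notation nm := Normc.normc.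
Local Notation kappa := (kappa a am1).
Local Notation alpha := (alpha a am1).
Local Notation beta := (beta a am1 b).
Local Notation s n := (Num.sqrt (a n)).

Let s_gt0 n : 0 < s n. Proof. by rewrite sqrtr_gt0. Qed.
Let s_neq0 n : s n != 0. Proof. by rewrite gt_eqF. Qed.
Let sqr_s n : s n ^+ 2 = a n. Proof. by rewrite sqr_sqrtr// ltW. Qed.

Lemma kappaE n : kappa n.+1 = s n.+1 ^+ 2 / (s n * s n.+2).
Proof. by rewrite /kappa /= sqr_s sqrtrM// ltW. Qed.

Lemma alphaE n : alpha n.+1 = (2 * (s n * s n.+1))^-1.
Proof. by rewrite /alpha /= sqrtrM// ltW. Qed.

Lemma betaE n : beta n.+1 = - b n.+1 / (2 * (s n * s n.+1)).
Proof. by rewrite /beta /= sqrtrM// ltW. Qed.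

(* solutions of the Jacobi equation are normalized by [sqrt a_n] so that the
   coefficients of the resulting recurrence have bounded variation *)
Definition scaled (u : cseq R) (n : nat) : R[i] := (s n)%:C * u n.+1.

Lemma scaled_rec z u n : jacobi_equation a am1 b z u ->
  (kappa n.+1)%:C * scaled u n.+2 =
  2%:R * ((alpha n.+1)%:C * z + (beta n.+1)%:C) * scaled u n.+1 - scaled u n.
Proof.
move=> /(_ n.+1); rewrite /scaled kappaE alphaE betaE.
set s0 := s n; set s1 := s n.+1; set s2 := s n.+2.
rewrite -[aprev _ _ _]/(a n) -(sqr_s n) -(sqr_s n.+1) -/s0 -/s1 => h.
have c0 : s0%:C != 0 by rewrite -normc_gt0 normc_real gtr0_norm ?s_gt0.
have c1 : s1%:C != 0 by rewrite -normc_gt0 normc_real gtr0_norm ?s_gt0.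
have c2 : s2%:C != 0 by rewrite -normc_gt0 normc_real gtr0_norm ?s_gt0.
move: h; rewrite !(fmorph_div, fmorphV, rmorphM, rmorphN, rmorphXn, rmorph_nat) /=.
set S0 := s0%:C in c0 *; set S1 := s1%:C in c1 *; set S2 := s2%:C in c2 *.
set B := (b n.+1)%:C => h.
transitivity (S1 ^+ 2 * u n.+3 / S0); first by field; rewrite c0 c2.
transitivity ((z * u n.+2 - B * u n.+2 - S0 ^+ 2 * u n.+1) / S0); last first.
  by field; rewrite c0 c1.
by congr (_ / _); rewrite -h; ring.
Qed.

Lemma scaled_wronskian u v n : wronskian a am1 u v n.+1 =
  (s n / s n.+1)%:C * (scaled u n * scaled v n.+1 - scaled u n.+1 * scaled v n).
Proof.
rewrite /wronskian /scaled -[aprev _ _ _]/(a n).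
set s0 := s n; have -> : a n = s0 ^+ 2 by rewrite sqr_s.
have c1 : (s n.+1)%:C != 0 by rewrite -normc_gt0 normc_real gtr0_norm ?s_gt0.
rewrite !(fmorph_div, rmorphXn) /=; field; exact: c1.
Qed.

Lemma kappa_gt0 n : 0 < kappa n.+1.
Proof. by rewrite kappaE divr_gt0 ?exprn_gt0// mulr_gt0. Qed.

Hypothesis kappa_ell1 : ell1 (fun n => kappa n - 1).

Lemma kappa_sum_bound : exists2 S : R, 0 <= S &
  forall n, \sum_(0 <= k < n) `|kappa k.+1 - 1| <= S.
Proof.
exists (limn (series (fun n => `|kappa n - 1|))).
  apply: limr_ge => //; apply: nearW => n; exact: sumr_ge0.
move=> n; apply: (@le_trans _ _ (series (fun n => `|kappa n - 1|) n.+1)).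
  by rewrite /series/= big_nat_recl//= lerDr.
apply: nondecreasing_cvgn_le => //.
by apply: nondecreasing_series.
Qed.

Lemma kappa_cvg1 : kappa n @[n --> \oo] --> (1 : R).
Proof.
apply/subr_cvg0; apply: norm_cvg0.
exact: cvg_series_cvg_0.
Qed.

Lemma kappa_lower : exists2 k0 : R, 0 < k0 & forall n, k0 <= kappa n.+1.
Proof.
have /cvgrPdist_le/(_ (1 / 2)) := kappa_cvg1.
rewrite divr_gt0// => /(_ isT)[M _ HM].
have [k1 k1p Hk] : exists2 k1 : R, 0 < k1 & forall n, (n < M)%N -> k1 <= kappa n.+1.
  elim: (M) => [|m [k1 k1p Hk]]; first by exists 1.
  exists (Num.min k1 (kappa m.+1)); first by rewrite lt_min k1p kappa_gt0.
  move=> n; rewrite ltnS leq_eqVlt => /orP[/eqP ->|/Hk h].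
    by rewrite ge_min lexx orbT.
  by rewrite ge_min h.
exists (Num.min k1 (1 / 2)); first by rewrite lt_min k1p divr_gt0.
move=> n; rewrite ge_min; case: (ltnP n M) => [/Hk ->//|Mn].
apply/orP; right; have := HM n.+1 (leqW Mn); rewrite /= ler_norml; lra.
Qed.

(** The factor between the Wronskian and its expression in scaled solutions. By [ratioS] it is
    [ratio 0] times a product of values of [kappa], which is how it is shown to converge. *)
Definition ratio n := s n / s n.+1.

Lemma ratio_gt0 n : 0 < ratio n. Proof. exact: divr_gt0. Qed.

Lemma ratioS n : ratio n.+1 = kappa n.+1 * ratio n.
Proof. by rewrite /ratio kappaE; field; rewrite !s_neq0. Qed.

Hypotheses (a_infty : a n @[n --> \oo] --> +oo).
Hypothesis carleman : series (fun n => (a n)^-1) n @[n --> \oo] --> +oo.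

Let ratio_bound : exists2 B : R, 0 <= B & forall n, ratio n <= B.
Proof.
have [S S0 HS] := kappa_sum_bound.
exists (ratio 0 * expR S); first by rewrite mulr_ge0 ?expR_ge0// ltW ?ratio_gt0.
move=> n; apply: (@le_trans _ _ (ratio 0 * expR (\sum_(0 <= k < n) `|kappa k.+1 - 1|))).
  elim: n => [|n IH]; first by rewrite big_geq// expR0 mulr1.
  rewrite ratioS big_nat_recr//= expRD [leRHS]mulrA [leLHS]mulrC.
  apply: ler_pM IH _; first exact: ltW (ratio_gt0 n).
    exact: ltW (kappa_gt0 n).
  rewrite (le_trans _ (expR_ge1Dx _))//; have := ler_norm (kappa n.+1 - 1); lra.
by rewrite ler_pM2l ?ratio_gt0// ler_expR.
Qed.

(** The increments of the ratio are [(kappa - 1) ratio], a summable factor times a bounded one. *)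
Let ratio_is_cvg : cvgn ratio.
Proof.
have [B B0 HB] := ratio_bound.
have -> : ratio = (fun n => ratio 0 + series (fun k => ratio k.+1 - ratio k) n).
  by apply/funext => n; rewrite /series/= telescope_sumr// addrC subrK.
apply: is_cvgD; first exact: is_cvg_cst.
apply: normed_cvg; apply: (@series_le_cvg _ _ (fun n => B * `|kappa n.+1 - 1|)) => //=.
- by move=> n; rewrite mulr_ge0.
- move=> n; rewrite ratioS -[X in _ - X]mul1r -mulrBl normrM mulrC.
  by rewrite (gtr0_norm (ratio_gt0 n)) ler_wpM2r.
- have -> : (fun n => B * `|kappa n.+1 - 1|) = B *: (fun n => `|kappa n.+1 - 1|) by [].
  rewrite seriesZ; apply: is_cvgZr; apply: nondecreasing_is_cvgn.
    by apply: nondecreasing_series.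
  by have [S _ HS] := kappa_sum_bound; exists S => _ [n _ <-]; exact: HS.
Qed.

(* A limit [< 1] would make [1 / a_n] decay geometrically, against Carleman's
   condition; a limit [> 1] would make [a_n] eventually decreasing. *)
Lemma ratio_cvg1 : ratio n @[n --> \oo] --> (1 : R).
Proof.
have /cvg_ex[L rL] := ratio_is_cvg.
suff <- : L = 1 by [].
have L0 : 0 <= L.
  by apply: cvgr_to_ge rL _; apply: nearW => n; rewrite ltW ?ratio_gt0.
have aratio n : a n = ratio n ^+ 2 * a n.+1.
  by rewrite -(sqr_s n) -(sqr_s n.+1) /ratio; field; rewrite s_neq0.
apply/eqP; rewrite eq_le; apply/andP; split; rewrite leNgt; apply/negP => L1.
- have [M _ HM] : \forall n \near \oo, 1 < ratio n by exact: cvgr_gt rL _ L1.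
  have dec n : (M <= n)%N -> a n <= a M.
    elim: n => [|n IH]; first by rewrite leqn0 => /eqP <-.
    rewrite leq_eqVlt => /orP[/eqP <-//|]; rewrite ltnS => Mn.
    rewrite (le_trans _ (IH Mn))// [leRHS]aratio ler_peMl ?(ltW (a_gt0 _))//.
    by rewrite exprn_ege1// ltW// HM.
  have /cvgryPgt/(_ (a M))[M' _ HM'] := a_infty.
  have := HM' (maxn M M') (leq_maxr _ _); rewrite ltNge /=.
  by rewrite dec ?leq_maxl.
(* A number strictly between [L] and 1: eventually [1 / a_{n+1} <= th^2 / a_n], so the sum of
   [1 / a_n] is dominated by a telescoping one. *)
- set th := ((L + 1) / 2); have th1 : th < 1 by rewrite /th; lra.
  have th0 : 0 < th by rewrite /th; lra.
  have th2 : th ^+ 2 < 1 by rewrite expr_lt1// ltW.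
  have Lth : L < th by rewrite /th; lra.
  have [M _ HM] : \forall n \near \oo, ratio n < th by exact: cvgr_lt rL _ Lth.
  have step n : (M <= n)%N -> (a n)^-1 * (1 - th ^+ 2) <= (a n)^-1 - (a n.+1)^-1.
    move=> Mn; rewrite mulrBr mulr1 lerD2l lerN2.
    rewrite mulrC ler_pdivlMr// mulrC ler_pdivrMr// [leLHS]aratio.
    rewrite ler_wpM2r ?(ltW (a_gt0 _))//.
    by rewrite ler_pXn2r ?nnegrE ?(ltW th0) ?(ltW (ratio_gt0 _))// ltW// HM.
  have sum n : (M <= n)%N ->
     (1 - th ^+ 2) * \sum_(M <= k < n) (a k)^-1 <= (a M)^-1 - (a n)^-1.
    elim: n => [|n IH].
      by rewrite leqn0 => /eqP ->; rewrite big_geq// mulr0 subrr.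
    rewrite leq_eqVlt => /orP[/eqP <-|]; first by rewrite big_geq// mulr0 subrr.
    rewrite ltnS => Mn; rewrite big_nat_recr//= mulrDr.
    by have := step n Mn; have := IH Mn; rewrite mulrC; lra.
  have /cvgryPgt/(_ (series (fun n => (a n)^-1) M + (a M)^-1 / (1 - th ^+ 2)))[M' _ HM'] := carleman.
  have := HM' (maxn M M') (leq_maxr _ _); rewrite ltNge /=; apply/negP; rewrite negbK.
  rewrite /series/= (@big_cat_nat _ _ _ M)//= ?leq_maxl// lerD2l.
  rewrite ler_pdivlMr ?subr_gt0// mulrC (le_trans (sum _ (leq_maxl _ _)))//.
  by rewrite gerBl invr_ge0 ltW.
Qed.

Lemma alpha_cvg0 : alpha n @[n --> \oo] --> (0 : R).
Proof.
apply/cvgrPdist_le => e e0.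
have /cvgryPge/(_ e^-1)[M _ HM] := a_infty.
exists M.+1 => // -[//|n] /= Mn; rewrite sub0r normrN alphaE.
have h1 := HM n Mn; have h2 := HM n.+1 (leqW Mn).
have e1 : 0 < e^-1 by rewrite invr_gt0.
have h : e^-1 <= s n * s n.+1.
  rewrite -(@ler_pXn2r _ 2)// ?nnegrE ?mulr_ge0 ?sqrtr_ge0 ?(ltW e1)//.
  by rewrite exprMn !sqr_s expr2 ler_pM// ltW.
rewrite ger0_norm ?invr_ge0 ?mulr_ge0 ?sqrtr_ge0//.
rewrite -[e]invrK lef_pV2 ?posrE ?mulr_gt0//; lra.
Qed.

End Coefficients.

(** * Solutions of the Jacobi equation near a real point *)

Section Solutions.
Local Notation "z ^*" := (conjc z) : ring_scope.
Variables (R : realType) (a b : nat -> R) (am1 : R).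
Local Notation nm := Normc.normc.
Hypothesis a_gt0 : forall n, 0 < a n.

(* shifted, like [orthopoly_shift]; [u0] and [u1] are the values at -1 and 0 *)
Fixpoint jacobi_solution (u0 u1 z : R[i]) (n : nat) {struct n} : R[i] :=
  match n with
  | 0%N => u0
  | k.+1 => match k with
    | 0%N => u1
    | j.+1 => ((z - (b j)%:C) * jacobi_solution u0 u1 z k
                 - (aprev a am1 j)%:C * jacobi_solution u0 u1 z j) / (a j)%:C
    end
  end.

Lemma orthopolyE z : orthopoly_shift a am1 b z = jacobi_solution 0 1 z.
Proof.
apply/funext => n; suff : orthopoly_shift a am1 b z n = jacobi_solution 0 1 z n /\
  orthopoly_shift a am1 b z n.+1 = jacobi_solution 0 1 z n.+1 by case.
elim: n => [//|n [IH1 IH2]]; split=> //.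
rewrite -[LHS]/(((z - (b n)%:C) * orthopoly_shift a am1 b z n.+1
  - (aprev a am1 n)%:C * orthopoly_shift a am1 b z n) / (a n)%:C).
by rewrite IH1 IH2.
Qed.

Let ac n : (a n)%:C != 0 :> R[i].
Proof. by rewrite -normc_gt0 normc_real gtr0_norm. Qed.

Lemma jacobi_solutionP u0 u1 z : jacobi_equation a am1 b z (jacobi_solution u0 u1 z).
Proof.
move=> n; rewrite -[jacobi_solution _ _ _ n.+2]/(((z - (b n)%:C) *
  jacobi_solution u0 u1 z n.+1 - (aprev a am1 n)%:C * jacobi_solution u0 u1 z n)
  / (a n)%:C).
by field; exact: ac.
Qed.

Lemma jacobi_equation_unique z u : jacobi_equation a am1 b z u ->
  u = jacobi_solution (u 0%N) (u 1%N) z.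
Proof.
move=> hu; apply/funext => n.
suff : u n = jacobi_solution (u 0%N) (u 1%N) z n /\
  u n.+1 = jacobi_solution (u 0%N) (u 1%N) z n.+1 by case.
elim: n => [//|n [IH1 IH2]]; split=> //.
apply: (mulfI (ac n)); have := hu n; have := jacobi_solutionP (u 0%N) (u 1%N) z n.
by rewrite -IH1 -IH2 => <- /addrI.
Qed.

Lemma jacobi_equation_comb z u v (p q : R[i]) : jacobi_equation a am1 b z u ->
  jacobi_equation a am1 b z v ->
  jacobi_equation a am1 b z (fun n => p * u n + q * v n).
Proof.
move=> hu hv n; transitivity (p * ((aprev a am1 n)%:C * u n + (b n)%:C * u n.+1
   + (a n)%:C * u n.+2) + q * ((aprev a am1 n)%:C * v n + (b n)%:C * v n.+1
   + (a n)%:C * v n.+2)); first by ring.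
by rewrite hu hv; ring.
Qed.

Lemma jacobi_solution_real (u0 u1 z : R[i]) n : u0^* = u0 -> u1^* = u1 ->
  z^* = z -> (jacobi_solution u0 u1 z n)^* = jacobi_solution u0 u1 z n.
Proof.
move=> h0 h1 hz.
suff : (jacobi_solution u0 u1 z n)^* = jacobi_solution u0 u1 z n /\
  (jacobi_solution u0 u1 z n.+1)^* = jacobi_solution u0 u1 z n.+1 by case.
elim: n => [//|n [IH1 IH2]]; split=> //.
rewrite -[jacobi_solution _ _ _ n.+2]/(((z - (b n)%:C) *
  jacobi_solution u0 u1 z n.+1 - (aprev a am1 n)%:C * jacobi_solution u0 u1 z n)
  / (a n)%:C).
by rewrite fmorph_div rmorphB !rmorphM rmorphB /= IH1 IH2 hz oppr0.
Qed.

Lemma bl_solution (Om : set R[i]) (rho : R) u0 u1 n : 0 <= rho ->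
  (forall z, Om z -> nm z <= rho) ->
  bounded_lipschitz Om (fun z => jacobi_solution u0 u1 z n).
Proof.
move=> r0 Or.
suff : bounded_lipschitz Om (fun z => jacobi_solution u0 u1 z n) /\
  bounded_lipschitz Om (fun z => jacobi_solution u0 u1 z n.+1) by case.
elim: n => [|n [IH1 IH2]]; first by split; exact: bl_cst.
split=> //; apply: blM; last exact: bl_cst.
apply: blD; first by apply: blM => //; apply: blD; [exact: bl_id Or|exact: bl_cst].
by apply: blN; apply: blM => //; exact: bl_cst.
Qed.

Lemma scaled_comb (u v : cseq R) (p q : R[i]) n :
  scaled a (fun n => p * u n + q * v n) n = p * scaled a u n + q * scaled a v n.
Proof. by rewrite /scaled; ring. Qed.

End Solutions.

(** * Boundary values of the branch at real points *)

Section Edge.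
Local Notation "z ^*" := (conjc z) : ring_scope.
Variable R : realType.
Local Notation nm := Normc.normc.
Implicit Types (s : bool) (y : R).

Lemma zeta_edgeN y : `|y| <= 1 -> zeta_edge false y = (zeta_edge true y)^*.
Proof.
move=> y1; rewrite /zeta_edge /sqrt_edge y1.
by apply: complexP; rewrite !ReImE /=; ring.
Qed.

Lemma zeta_edge_im s y : `|y| <= 1 ->
  complex.Im (zeta_edge s y) = (if s then -1 else 1) * Num.sqrt (1 - y ^+ 2).
Proof.
by move=> y1; rewrite /zeta_edge /sqrt_edge y1; case: s; rewrite !ReImE /=; ring.
Qed.

Section Bounds.
Variables (kp : R).
Hypotheses (kp_ge0 : 0 <= kp) (kp_lt1 : kp < 1).

Let re_real y : `|y| <= kp -> `|complex.Re y%:C| <= kp. Proof. by []. Qed.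

Let nm_real y : `|y| <= kp -> nm y%:C <= 1.
Proof. by move=> h; rewrite normc_real (le_trans h)// ltW. Qed.

Let im_le0 y : `|y| <= kp -> complex.Im (zeta_edge true y) <= 0.
Proof.
by move=> h; rewrite zeta_edge_im ?mulN1r ?oppr_le0 ?sqrtr_ge0// (le_trans h)// ltW.
Qed.

Lemma zeta_edge_root y : `|y| <= kp ->
  zeta_edge true y ^+ 2 - 2 * y%:C * zeta_edge true y + 1 = 0.
Proof.
by move=> h; rewrite -zeta_real ?zeta_root// (le_lt_trans h).
Qed.

Lemma normc_zeta_edge s y : `|y| <= kp -> nm (zeta_edge s y) = 1.
Proof.
move=> h; have e : nm (zeta_edge true y) = 1.
  exact: (root_im_real (zeta_edge_root h) kp_ge0 kp_lt1 (re_real h)).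
by case: s => //; rewrite zeta_edgeN ?normcJ// (le_trans h)// ltW.
Qed.

Lemma zeta_edge_gap s y : `|y| <= kp ->
  Num.sqrt (1 - kp ^+ 2) / 3 <= `|complex.Im (zeta_edge s y)|.
Proof.
move=> h; have e : Num.sqrt (1 - kp ^+ 2) / 3 <= `|complex.Im (zeta_edge true y)|.
  rewrite ler0_norm ?im_le0//.
  exact: (root_im (zeta_edge_root h) kp_ge0 kp_lt1 (re_real h) (nm_real h) (im_le0 h)).
by case: s => //; rewrite zeta_edgeN ?ImJ ?normrN// (le_trans h)// ltW.
Qed.

Lemma zeta_edgeJ s y : `|y| <= kp -> (zeta_edge s y)^* = (zeta_edge s y)^-1.
Proof. by move=> h; rewrite invcE normc_zeta_edge// expr1n invr1 rmorph1 mul1r. Qed.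

Lemma zeta_edge_sum s y : `|y| <= kp ->
  zeta_edge s y + (zeta_edge s y)^-1 = 2%:R * y%:C.
Proof.
move=> h; have e : zeta_edge true y + (zeta_edge true y)^-1 = 2%:R * y%:C.
  by rewrite (rootE (zeta_edge_root h)).
have h1 : `|y| <= 1 by rewrite (le_trans h)// ltW.
case: s => //; rewrite zeta_edgeN// -conjc_inv -rmorphD e.
by apply: complexP; rewrite !ReImE /=; ring.
Qed.

Lemma zeta_edge_lip s y y' : `|y| <= kp -> `|y'| <= kp ->
  nm (zeta_edge s y - zeta_edge s y') <= 2 / (Num.sqrt (1 - kp ^+ 2) / 3) * `|y - y'|.
Proof.
move=> h h'; have e : nm (zeta_edge true y - zeta_edge true y') <=
    2 / (Num.sqrt (1 - kp ^+ 2) / 3) * nm (y%:C - y'%:C).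
  apply: root_lip; try exact: zeta_edge_root.
  - by rewrite divr_gt0// sqrtr_gt0 subr_gt0 expr_lt1.
  - by have := zeta_edge_gap true h'; rewrite ler0_norm ?im_le0.
  - exact: im_le0.
  - by rewrite normc_zeta_edge.
move: e; rewrite -rmorphB/= normc_real; case: s => //.
have J (z w : R[i]) : z^* - w^* = (z - w)^* by rewrite rmorphB.
have h1 : `|y| <= 1 by rewrite (le_trans h)// ltW.
have h1' : `|y'| <= 1 by rewrite (le_trans h')// ltW.
by rewrite !zeta_edgeN// J normcJ.
Qed.

End Bounds.
End Edge.

(** * Uniform estimates on a half disc *)

Section Region.
Local Notation "z ^*" := (conjc z) : ring_scope.
Variables (R : realType) (a b : nat -> R) (am1 binf : R).
Local Notation nm := Normc.normc.
Hypotheses (a_gt0 : forall n, 0 < a n) (am1_gt0 : 0 < am1).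
Hypothesis (beta_inf_lt1 : `|binf| < 1).
Local Notation kappa := (kappa a am1).
Local Notation alpha := (alpha a am1).
Local Notation beta := (beta a am1 b).
Hypothesis alpha_ell1 : ell1 (fun n => alpha n.+1 - alpha n).
Hypothesis beta_ell1 : ell1 (fun n => beta n.+1 - beta n).
Hypothesis kappa_ell1 : ell1 (fun n => kappa n - 1).
Variables (eps0 rho : R) (N : nat).
Hypotheses (eps0_gt0 : 0 < eps0) (eps0_lt : eps0 < 1 - `|binf|) (rho_gt0 : 0 < rho).
Hypothesis NP : forall n z, (N <= n)%N -> nm z < rho ->
  nm ((alpha n)%:C * z + (beta n)%:C - binf%:C) < eps0.

Definition jacobi_point n (z : R[i]) := (alpha n)%:C * z + (beta n)%:C.
Local Notation X := jacobi_point.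

(** Bounds the argument of [zeta] for all [n >= N] and [|z| < rho]; being less than 1, it keeps that
    argument away from the branch points 1 and -1, which is the purpose of [eps0 < 1 - |binf|]. *)
Let kp : R := `|binf| + eps0.
Definition branch_gap : R := Num.sqrt (1 - kp ^+ 2) / 3.
Local Notation c := branch_gap.

Let kp_ge0 : 0 <= kp. Proof. by rewrite addr_ge0// ltW. Qed.
Let kp_lt1 : kp < 1. Proof. by rewrite /kp -ltrBrDl. Qed.

Lemma branch_gap_gt0 : 0 < c.
Proof. by rewrite divr_gt0// sqrtr_gt0 subr_gt0 expr_lt1. Qed.

Lemma alpha_ge0 n : 0 <= alpha n.
Proof. by rewrite invr_ge0 mulr_ge0// sqrtr_ge0. Qed.

Lemma point_norm n z : (N <= n)%N -> nm z < rho -> nm (X n z) <= kp.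
Proof.
move=> Nn zr; have := NP Nn zr; rewrite -/(X n z) => h.
have := ler_normcD (X n z - binf%:C) binf%:C; rewrite subrK normc_real /kp; lra.
Qed.

Lemma point_re n z : (N <= n)%N -> nm z < rho -> `|complex.Re (X n z)| <= kp.
Proof. by move=> Nn zr; rewrite (le_trans (normc_Re _))// point_norm. Qed.

Lemma point_im n z : complex.Im (X n z) = alpha n * complex.Im z.
Proof. by rewrite !ReImE /=; ring. Qed.

Lemma point_im_ge0 n z : 0 <= complex.Im z -> 0 <= complex.Im (X n z).
Proof. by move=> z0; rewrite point_im mulr_ge0// alpha_ge0. Qed.

Let pn1 n z : (N <= n)%N -> nm z < rho -> nm (X n z) <= 1.
Proof. by move=> Nn zr; rewrite (le_trans (point_norm Nn zr))// ltW. Qed.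

Let pre1 n z : (N <= n)%N -> nm z < rho -> `|complex.Re (X n z)| < 1.
Proof. by move=> Nn zr; rewrite (le_lt_trans (point_re Nn zr)). Qed.

Lemma branch_le1 n z : (N <= n)%N -> nm z < rho -> 0 <= complex.Im z ->
  nm (zeta (X n z)) <= 1.
Proof.
move=> Nn zr z0; apply: (root_le1 (zeta_root _) kp_ge0 kp_lt1 (point_re Nn zr)).
  by apply: zeta_im_le0; [exact: pre1|exact: pn1].
exact: point_im_ge0.
Qed.

Lemma branch_im n z : (N <= n)%N -> nm z < rho -> 0 <= complex.Im z ->
  c <= - complex.Im (zeta (X n z)).
Proof.
move=> Nn zr z0.
apply: (root_im (zeta_root _) kp_ge0 kp_lt1 (point_re Nn zr) (pn1 Nn zr)).
  by apply: zeta_im_le0; [exact: pre1|exact: pn1].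
exact: point_im_ge0.
Qed.

Lemma branch_lip n m z w : (N <= n)%N -> (N <= m)%N -> nm z < rho ->
  nm w < rho -> 0 <= complex.Im z -> 0 <= complex.Im w ->
  nm (zeta (X n z) - zeta (X m w)) <= 2 / c * nm (X n z - X m w).
Proof.
move=> Nn Nm zr wr z0 w0; apply: root_lip; try exact: zeta_root.
- exact: branch_gap_gt0.
- exact: branch_im.
- by apply: zeta_im_le0; [exact: pre1|exact: pn1].
- exact: branch_le1.
Qed.

(** A bound for [wave_error] free of [z]: the Lipschitz constant [2 / c] of the branch times the
    variation of its argument on [|z| < rho], plus the deviation of [kappa] from 1. *)
Definition error_bound n : R :=
  2 / c * (`|alpha n.+1 - alpha n| * rho + `|beta n.+1 - beta n|) +
  `|kappa n.+1 - 1|.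
Local Notation err := error_bound.

Lemma error_bound_ge0 n : 0 <= err n.
Proof.
rewrite addr_ge0// mulr_ge0 ?divr_ge0 ?(ltW branch_gap_gt0)//.
by rewrite addr_ge0// mulr_ge0// ltW.
Qed.

Lemma branch_error n z : (N <= n)%N -> nm z < rho -> 0 <= complex.Im z ->
  wave_error (fun k => zeta (X k z)) kappa n <= err n.
Proof.
move=> Nn zr z0; rewrite /wave_error /error_bound lerD2r.
rewrite (le_trans (branch_lip (leqW Nn) Nn zr zr z0 z0))//.
rewrite ler_wpM2l ?divr_ge0 ?(ltW branch_gap_gt0)//.
have -> : X n.+1 z - X n z = (alpha n.+1 - alpha n)%:C * z + (beta n.+1 - beta n)%:C.
  by rewrite /jacobi_point !rmorphB/=; ring.
rewrite (le_trans (ler_normcD _ _))// Normc.normcM !normc_real lerD//.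
by rewrite ler_wpM2l// ltW.
Qed.

Lemma cvg_series_error : cvgn (series err).
Proof.
have -> : series err = (fun n => 2 / c * (series (fun n => `|alpha n.+1 - alpha n|) n * rho
    + series (fun n => `|beta n.+1 - beta n|) n) + series (fun n => `|kappa n.+1 - 1|) n).
  apply/funext => n; rewrite /series/= /err big_split/= -mulr_sumr big_split/=.
  by rewrite -mulr_suml.
apply: is_cvgD.
  apply: is_cvgMl_tmp; apply: is_cvgD => //.
  by apply: is_cvgMr_tmp.
apply: nondecreasing_is_cvgn; first exact: nondecreasing_series.
have [S _ HS] := kappa_sum_bound kappa_ell1.
by exists S => _ [n _ <-]; exact: HS.
Qed.

Definition error_total : R := limn (series err).

Lemma error_sum n : \sum_(N <= k < n) err k <= error_total.
Proof.
apply: (@le_trans _ _ (series err n)); last first.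
  apply: nondecreasing_cvgn_le; last exact: cvg_series_error.
  by apply: nondecreasing_series => i _ _; exact: error_bound_ge0.
rewrite /series/=; have [Nn|nN] := leqP N n.
  by rewrite [leRHS](@big_cat_nat _ _ _ N)//= lerDr sumr_ge0// => i _; exact: error_bound_ge0.
by rewrite big_geq ?(ltnW nN)// sumr_ge0// => i _; exact: error_bound_ge0.
Qed.

Lemma error_tail e : 0 < e -> exists2 n0, (N <= n0)%N &
  forall n m, (n0 <= n)%N -> (n <= m)%N -> \sum_(n <= k < m) err k <= e.
Proof.
move=> e0; have /cvgrPdist_le/(_ e e0)[n0 _ H] := cvg_series_error.
exists (maxn N n0); first exact: leq_maxl.
move=> n m hn nm; have n0n : (n0 <= n)%N by rewrite (leq_trans _ hn)// leq_maxr.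
have := H n n0n; rewrite /= ler_norml => /andP[_ h].
have : series err m <= limn (series err).
  apply: nondecreasing_cvgn_le; last exact: cvg_series_error.
  by apply: nondecreasing_series => i _ _; exact: error_bound_ge0.
have -> : series err m = series err n + \sum_(n <= k < m) err k.
  by rewrite /series/= (@big_cat_nat _ _ _ n).
by move: h; set L := limn _; lra.
Qed.

(** The real points are included: they stand for the edge [lambda + i0], and estimates valid up to
    them give the boundary values. *)
Definition upper_region : set R[i] := [set z | nm z < rho /\ 0 <= complex.Im z].

Let branch_bl k : (N <= k)%N -> bounded_lipschitz upper_region (fun z => zeta (X k z)).
Proof.
move=> Nk; have A0 : 0 <= 2 / c * alpha k.
  by rewrite mulr_ge0 ?alpha_ge0// divr_ge0// ltW// branch_gap_gt0.
exists (1 + 2 / c * alpha k); first by rewrite addr_ge0.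
move=> z z' [zr z0] [zr' z0']; split.
  by rewrite (le_trans (branch_le1 Nk zr z0))// lerDl.
rewrite (le_trans (branch_lip Nk Nk zr zr' z0 z0'))//.
have -> : X k z - X k z' = (alpha k)%:C * (z - z') by rewrite /jacobi_point; ring.
rewrite Normc.normcM normc_real ger0_norm ?alpha_ge0// mulrA.
by rewrite ler_wpM2r ?normc_ge0// lerDr.
Qed.

Definition dominant_at u0 u1 z n : R[i] :=
  dominant N (fun k => zeta (X k z)) (scaled a (jacobi_solution a b am1 u0 u1 z)) n.

Let dominant_bl u0 u1 n : (N <= n)%N ->
  bounded_lipschitz upper_region (fun z => dominant_at u0 u1 z n).
Proof.
move=> Nn.
have sol_bl m : bounded_lipschitz upper_region
    (fun z => scaled a (jacobi_solution a b am1 u0 u1 z) m).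
  apply: blM; first exact: bl_cst.
  by apply: (@bl_solution _ _ _ _ _ rho) => [|z [/ltW]//]; exact: ltW.
apply: blM.
  (* Factors below [N] are replaced by 1, because [bl_prod] asks for every factor to be bounded and
     Lipschitz; the range of the product never meets them. *)
  have := @bl_prod R upper_region _ (index_iota N n.+1)
    (fun k z => if (N <= k)%N then zeta (X k z) else 1) _.
  rewrite (_ : (fun z => \prod_(i <- _) _) = (fun z => qprod N (fun k => zeta (X k z)) n.+1)).
    by apply=> k; case: leqP => [/branch_bl//|_]; exact: bl_cst.
  by apply/funext => z; apply: eq_big_nat => k /andP[-> _].
by apply: blD => //; apply: blN; apply: blM => //; exact: branch_bl.
Qed.

Let k0_ex := kappa_lower a_gt0 kappa_ell1.

(** All constants are uniform on the half disc, so the dominant parts are uniformly Cauchy; each of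
    them is Lipschitz in [z], hence the limit is continuous up to the real points. *)
Lemma dominant_limit u0 u1 : exists dl : R[i] -> R[i],
  (forall e : R, 0 < e -> exists2 n0, (N <= n0)%N & forall n z, (n0 <= n)%N ->
     upper_region z -> nm (dominant_at u0 u1 z n - dl z) <= e) /\
  (forall z0, upper_region z0 -> forall e : R, 0 < e -> exists2 r : R, 0 < r &
     forall z, upper_region z -> nm (z - z0) < r -> nm (dl z - dl z0) <= e).
Proof.
have [k0 k0_gt0 Hk0] := k0_ex.
pose v z := scaled a (jacobi_solution a b am1 u0 u1 z).
have vrec z n : (kappa n.+1)%:C * v z n.+2 =
    (zeta (X n.+1 z) + (zeta (X n.+1 z))^-1) * v z n.+1 - v z n.
  by rewrite (rootE (zeta_root _)) (scaled_rec a_gt0 n (jacobi_solutionP b am1 a_gt0 _ _ _)).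
have ka n : (N <= n)%N -> k0 <= kappa n.+1 by [].
have im z n : upper_region z -> (N <= n)%N -> c <= `|complex.Im (zeta (X n z))|.
  move=> [zr z0] Nn; have h := branch_im Nn zr z0.
  by rewrite ler0_norm//; have := branch_gap_gt0; lra.
have le1 z n : upper_region z -> (N <= n)%N -> nm (zeta (X n z)) <= 1.
  by move=> [zr z0] Nn; exact: branch_le1.
have vbl m : exists2 B : R, 0 <= B & forall z, upper_region z -> nm (v z m) <= B.
  have [B B0 HB] : bounded_lipschitz upper_region (fun z => v z m).
    apply: blM; first exact: bl_cst.
    by apply: (@bl_solution _ _ _ _ _ rho) => [|z [/ltW]//]; exact: ltW.
  by exists B => // z Oz; have [] := HB z z Oz Oz.
have [B0 B0_ge0 HB0] := vbl N; have [B1 B1_ge0 HB1] := vbl N.+1.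
pose W := wave_const c k0.
have W0 : 0 <= W by apply: wave_const_ge0 => //; exact: branch_gap_gt0.
pose ze z k := zeta (X k z).
have size0 z : upper_region z -> wave_size N (ze z) (v z) N <= 2 * (B0 + B1).
  move=> Oz; rewrite /wave_size /dominant /recessive qprodS// /qprod big_geq// mul1r.
  have h1 := HB0 z Oz; have h2 := HB1 z Oz; have z1 := le1 z N Oz (leqnn N).
  have zn0 : ze z N != 0 by exact: root_neq0 (zeta_root _).
  have t1 : nm (ze z N * (v z N.+1 - ze z N * v z N)) <= B0 + B1.
    rewrite Normc.normcM (le_trans (ler_piMl (normc_ge0 _) z1))//.
    rewrite (le_trans (ler_normcB _ _))// addrC lerD// Normc.normcM.
    by rewrite (le_trans (ler_piMl (normc_ge0 _) z1)).
  have t2 : nm (ze z N * (v z N.+1 - (ze z N)^-1 * v z N)) <= B0 + B1.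
    rewrite mulrBr mulVKf// (le_trans (ler_normcB _ _))// addrC lerD//.
    by rewrite Normc.normcM (le_trans (ler_piMl (normc_ge0 _) z1)).
  lra.
pose Bs := 2 * (B0 + B1) * expR (2 * W * error_total).
have Bs0 : 0 <= Bs by rewrite mulr_ge0 ?expR_ge0// mulr_ge0// addr_ge0.
have sizeB z : upper_region z -> forall i, (N <= i)%N -> wave_size N (ze z) (v z) i <= Bs.
  move=> Oz i Ni.
  apply: (le_trans (wave_size_bound branch_gap_gt0 k0_gt0
    (le1 z ^~ Oz) (im z ^~ Oz) ka (fun n _ => vrec z n) Ni)).
  apply: ler_pM; rewrite ?expR_ge0 ?wave_size_ge0// ?size0// ler_expR ler_wpM2l ?mulr_ge0//.
  apply: le_trans (error_sum i); apply: ler_sum_nat => k /andP[Nk _].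
  by case: Oz => zr z0; exact: branch_error.
have cauchy e : 0 < e -> exists2 n0, (N <= n0)%N & forall n m z, (n0 <= n)%N -> (n <= m)%N ->
    upper_region z -> nm (dominant_at u0 u1 z m - dominant_at u0 u1 z n) <= e.
  move=> e0; have WB : 0 < W * Bs + 1 by rewrite ltr_wpDl// mulr_ge0.
  have [n0 Nn0 Hn0] := error_tail (divr_gt0 e0 WB).
  exists n0 => // n m z n0n nm Oz; have Nn := leq_trans Nn0 n0n.
  apply: (le_trans (dominant_cauchy branch_gap_gt0 k0_gt0
    (le1 z ^~ Oz) (im z ^~ Oz) ka (fun n _ => vrec z n) Nn nm (sizeB z Oz))).
  have h : \sum_(n <= k < m) wave_error (ze z) kappa k <= e / (W * Bs + 1).
    apply: le_trans (Hn0 n m n0n nm); apply: ler_sum_nat => k /andP[nk _].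
    by case: Oz => zr z0; apply: branch_error => //; exact: leq_trans nk.
  apply: (le_trans (ler_wpM2l (mulr_ge0 W0 Bs0) h)).
  rewrite mulrA ler_pdivrMr// mulrC ler_pM2l// lerDl//.
have /choice[dl Hdl] : forall z, exists l, upper_region z -> ccvg (dominant_at u0 u1 z) l.
  move=> z; have [Oz|nOz] := pselect (upper_region z); last by exists 0.
  have [l Hl] := @ccvg_cauchy _ (dominant_at u0 u1 z) (fun e e0 =>
    let: ex_intro2 n0 _ H := cauchy e e0 in
    ex_intro _ n0 (fun n h => H n0 n z (leqnn _) h Oz)).
  by exists l.
have unif e : 0 < e -> exists2 n0, (N <= n0)%N & forall n z, (n0 <= n)%N ->
    upper_region z -> nm (dominant_at u0 u1 z n - dl z) <= e.
  move=> e0; have [n0 Nn0 Hn0] := cauchy e e0; exists n0 => // n z n0n Oz.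
  have lim := ccvg_norm (ccvgB (Hdl z Oz) (ccvg_cst (dominant_at u0 u1 z n))).
  rewrite normc_distC; apply: cvgr_to_le lim _; exists n => // m /= nm.
  exact: Hn0.
exists dl; split=> // z0 Oz0 e e0; have e3 : 0 < e / 3 by rewrite divr_gt0.
have [n0 Nn0 Hn0] := unif _ e3; have [B B_ge0 HB] := dominant_bl u0 u1 Nn0.
exists (e / 3 / (B + 1)); first by rewrite divr_gt0// ltr_wpDl.
move=> z Oz zz0.
have -> : dl z - dl z0 = - (dominant_at u0 u1 z n0 - dl z) +
  (dominant_at u0 u1 z n0 - dominant_at u0 u1 z0 n0) + (dominant_at u0 u1 z0 n0 - dl z0).
  by ring.
have h1 := Hn0 n0 z (leqnn _) Oz; have h2 := Hn0 n0 z0 (leqnn _) Oz0.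
have [_ h3] := HB z z0 Oz Oz0.
have h4 : B * nm (z - z0) <= e / 3.
  apply: (@le_trans _ _ ((B + 1) * nm (z - z0))).
    by rewrite ler_wpM2r ?normc_ge0// lerDl.
  by rewrite mulrC -ler_pdivlMr ?ltr_wpDl// ltW.
rewrite (le_trans (ler_normcD _ _))//.
have := ler_normcD (- (dominant_at u0 u1 z n0 - dl z))
  (dominant_at u0 u1 z n0 - dominant_at u0 u1 z0 n0).
rewrite normcN; lra.
Qed.

(** * Solutions at a real point *)

Section RealPoint.
Hypothesis beta_cvg : beta n @[n --> \oo] --> binf.
Hypothesis a_infty : a n @[n --> \oo] --> +oo.
Hypothesis carleman : series (fun n => (a n)^-1) n @[n --> \oo] --> +oo.
Variables (lam : R) (s : bool).
Hypothesis lam_rho : `|lam| < rho.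

Let y n : R := alpha n * lam + beta n.
Let ze n : R[i] := zeta_edge s (y n).
Local Notation sol u0 u1 := (jacobi_solution a b am1 u0 u1 lam%:C).
Local Notation dom := (dominant N ze).

Let yE n : X n lam%:C = (y n)%:C.
Proof. by rewrite /jacobi_point; apply: complexP; rewrite !ReImE /= /y; ring. Qed.

Let lamC : nm lam%:C < rho. Proof. by rewrite normc_real. Qed.

Let y_kp n : (N <= n)%N -> `|y n| <= kp.
Proof. by move=> Nn; have := point_norm Nn lamC; rewrite yE normc_real. Qed.

Let ze1 n : (N <= n)%N -> nm (ze n) = 1.
Proof. by move=> Nn; apply: (normc_zeta_edge kp_ge0 kp_lt1); exact: y_kp. Qed.

Let ze_le1 n : (N <= n)%N -> nm (ze n) <= 1.
Proof. by move=> Nn; rewrite ze1. Qed.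

Let ze_im n : (N <= n)%N -> c <= `|complex.Im (ze n)|.
Proof. by move=> Nn; apply: (zeta_edge_gap kp_ge0 kp_lt1); exact: y_kp. Qed.

Let zeJ n : (N <= n)%N -> (ze n)^* = (ze n)^-1.
Proof. by move=> Nn; apply: (zeta_edgeJ kp_ge0 kp_lt1); exact: y_kp. Qed.

Let ze_neq0 n : (N <= n)%N -> ze n != 0.
Proof. by move=> Nn; rewrite -normc_gt0 ze1. Qed.

Let ze_error n : (N <= n)%N -> wave_error ze kappa n <= err n.
Proof.
move=> Nn; rewrite /wave_error /error_bound lerD2r.
rewrite (le_trans (zeta_edge_lip kp_ge0 kp_lt1 _ (y_kp (leqW Nn)) (y_kp Nn)))//.
rewrite ler_wpM2l ?divr_ge0 ?(ltW branch_gap_gt0)//.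
have -> : y n.+1 - y n = (alpha n.+1 - alpha n) * lam + (beta n.+1 - beta n).
  by rewrite /y; ring.
by rewrite (le_trans (ler_normD _ _))// lerD// normrM ler_wpM2l// ltW.
Qed.

Let q := qprod N ze.

Let q1 n : nm (q n) = 1.
Proof.
elim: n => [|n IH]; first by rewrite /q /qprod big_geq// Normc.normc1.
have [Nn|nN] := leqP N n; last by rewrite /q /qprod big_geq// Normc.normc1.
by rewrite /q qprodS// Normc.normcM -/q IH mul1r ze1.
Qed.

Let q_neq0 n : q n != 0. Proof. by rewrite -normc_gt0 q1. Qed.

Let qJ n : (q n)^* = (q n)^-1.
Proof. by rewrite invcE q1 expr1n invr1 rmorph1 mul1r. Qed.

Let ze_sum n : (N <= n)%N -> ze n + (ze n)^-1 = 2%:R * (y n)%:C.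
Proof. by move=> Nn; apply: (zeta_edge_sum kp_lt1); exact: y_kp. Qed.

Let real_rec u n : (N <= n)%N -> jacobi_equation a am1 b lam%:C u ->
  (kappa n.+1)%:C * scaled a u n.+2 =
  (ze n.+1 + (ze n.+1)^-1) * scaled a u n.+1 - scaled a u n.
Proof.
move=> Nn hu; rewrite (ze_sum (leqW Nn)) -yE.
exact: (scaled_rec a_gt0 n hu).
Qed.

(** At a real point [|zeta_n| = 1], so [q_n] has modulus 1 and the bound on the wave size becomes a
    bound on the scaled solution itself. *)
Lemma real_wave u : jacobi_equation a am1 b lam%:C u ->
  (exists d, ccvg (dom (scaled a u)) d) /\
  exists2 B : R, 0 <= B & forall n, nm (scaled a u n) <= B.
Proof.
move=> hu; have [k0 k0_gt0 Hk0] := k0_ex.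
have vrec n (Nn : (N <= n)%N) := real_rec Nn hu.
have ka n : (N <= n)%N -> k0 <= kappa n.+1 by [].
set v := scaled a u in vrec *.
pose W := wave_const c k0.
have W0 : 0 <= W by apply: wave_const_ge0 => //; exact: branch_gap_gt0.
pose Bs := wave_size N ze v N * expR (2 * W * error_total).
have Bs0 : 0 <= Bs by rewrite mulr_ge0 ?expR_ge0 ?wave_size_ge0.
have sizeB i : (N <= i)%N -> wave_size N ze v i <= Bs.
  move=> Ni.
  apply: (le_trans (wave_size_bound branch_gap_gt0 k0_gt0 ze_le1 ze_im ka vrec Ni)).
  apply: ler_pM; rewrite ?expR_ge0 ?wave_size_ge0// ler_expR ler_wpM2l ?mulr_ge0//.
  apply: le_trans (error_sum i); apply: ler_sum_nat => k /andP[Nk _].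
  exact: ze_error.
split.
- apply: ccvg_cauchy => e e0.
  have WB : 0 < W * Bs + 1 by rewrite ltr_wpDl// mulr_ge0.
  have [n0 Nn0 Hn0] := error_tail (divr_gt0 e0 WB).
  exists n0 => n n0n.
  apply: (le_trans (dominant_cauchy branch_gap_gt0 k0_gt0 ze_le1 ze_im ka vrec
     Nn0 n0n sizeB)).
  have h : \sum_(n0 <= k < n) wave_error ze kappa k <= e / (W * Bs + 1).
    apply: le_trans (Hn0 n0 n (leqnn _) n0n); apply: ler_sum_nat => k /andP[nk _].
    by apply: ze_error; exact: leq_trans nk.
  apply: (le_trans (ler_wpM2l (mulr_ge0 W0 Bs0) h)).
  by rewrite mulrA ler_pdivrMr// mulrC ler_pM2l// lerDl.
- have big n : (N <= n)%N -> nm (v n) <= Bs / c.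
    move=> Nn; have := @wave_value _ N c ze v branch_gap_gt0 ze_im n Nn.
    rewrite Normc.normcM -/q q1 mul1r => /le_trans; apply.
    by rewrite ler_wpM2r ?sizeB// invr_ge0 ltW// branch_gap_gt0.
  have [M M0 HM] : exists2 M : R, 0 <= M & forall n, (n < N)%N -> nm (v n) <= M.
    elim: (N) => [|m [M M0 HM]]; first by exists 0.
    exists (Num.max M (nm (v m))); first by rewrite le_max M0.
    move=> n; rewrite ltnS leq_eqVlt => /orP[/eqP ->|/HM h].
      by rewrite le_max lexx orbT.
    by rewrite le_max h.
  exists (Num.max M (Bs / c)); first by rewrite le_max M0.
  by move=> n; rewrite le_max; case: (ltnP n N) => [/HM ->//|/big ->]; rewrite orbT.
Qed.

Let ze_cvg : ccvg ze (zeta_edge s binf).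
Proof.
have binf_kp : `|binf| <= kp by rewrite /kp lerDl ltW.
have y_cvg : y n @[n --> \oo] --> binf.
  rewrite -[X in _ --> X]add0r -(mul0r lam); apply: cvgD => //.
  by apply: cvgMr_tmp; exact: alpha_cvg0.
rewrite /ccvg; have C0 : 0 <= 2 / (Num.sqrt (1 - kp ^+ 2) / 3).
  by rewrite !divr_ge0// sqrtr_ge0.
apply: (@squeeze_cvgr _ _ _ _ (fun=> 0)
  (fun n => 2 / (Num.sqrt (1 - kp ^+ 2) / 3) * `|y n - binf|)).
- exists N => // n /= Nn; rewrite normc_ge0/=.
  by apply: (zeta_edge_lip kp_ge0 kp_lt1) => //; exact: y_kp.
- exact: cvg_cst.
- rewrite -[X in _ --> X](mulr0 (2 / (Num.sqrt (1 - kp ^+ 2) / 3))).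
  apply: cvgMl_tmp; rewrite -(normr0 R); apply: cvg_norm; exact/subr_cvg0.
Qed.

Let P := sol 0 1.
Definition second_solution (z : R[i]) : cseq R :=
  jacobi_solution a b am1 (- am1^-1)%:C 0 z.
Let Q := second_solution lam%:C.

Lemma wronskianPQ z : wronskian a am1 (jacobi_solution a b am1 0 1 z) (second_solution z) 0 = 1.
Proof.
have am0 : am1 != 0 by exact: lt0r_neq0.
by apply: complexP; rewrite /wronskian !ReImE /=; [field|ring].
Qed.

Let hP : jacobi_equation a am1 b lam%:C P. Proof. exact: jacobi_solutionP. Qed.
Let hQ : jacobi_equation a am1 b lam%:C Q. Proof. exact: jacobi_solutionP. Qed.

Let realv u0 u1 n : u0^* = u0 -> u1^* = u1 ->
  scaled a (sol u0 u1) n = (complex.Re (scaled a (sol u0 u1) n))%:C.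
Proof.
move=> h0 h1; have : (scaled a (sol u0 u1) n)^* = scaled a (sol u0 u1) n.
  have cM (x1 x2 : R[i]) : (x1 * x2)^* = x1^* * x2^* by rewrite rmorphM.
  by rewrite /scaled cM jacobi_solution_real// conjc_real.
exact: conjc_fixed.
Qed.

Let vP n := scaled a P n.
Let vQ n := scaled a Q n.
Let realP n : vP n = (complex.Re (vP n))%:C.
Proof. by apply: realv; rewrite ?rmorph0 ?rmorph1. Qed.
Let realQ n : vQ n = (complex.Re (vQ n))%:C.
Proof. by apply: realv; rewrite ?rmorph0 ?conjc_real. Qed.

Let wPQ n : ratio a n * (complex.Re (vP n) * complex.Re (vQ n.+1) -
   complex.Re (vP n.+1) * complex.Re (vQ n)) = 1.
Proof.
have := scaled_wronskian am1 a_gt0 P Q n.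
rewrite (wronskian_const n.+1 hP hQ) wronskianPQ -/(vP n) -/(vQ n) -/(vP n.+1) -/(vQ n.+1).
rewrite (realP n) (realP n.+1) (realQ n) (realQ n.+1).
rewrite -/(ratio a n); move: (ratio a n) (complex.Re (vP n)) (complex.Re (vP n.+1))
  (complex.Re (vQ n)) (complex.Re (vQ n.+1)) => k x1 x2 x3 x4.
move=> /(congr1 (@complex.Re R)); rewrite !ReImE /= => h; rewrite [RHS]h; ring.
Qed.

Let dP := dom vP.
Let dQ := dom vQ.

(** The scaled [P] and [Q] are real, and the factors [q] cancel because they have modulus 1. In
    [vQ n.+1 - ze n * vQ n] times the conjugate of [vP n.+1 - ze n * vP n], only the terms linear in
    [ze n] or its conjugate have an imaginary part, and they combine to the Wronskian. *)
Let wave_wronskian n : (N <= n)%N ->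
  complex.Im (dQ n * (dP n)^*) * ratio a n = complex.Im (ze n).
Proof.
move=> Nn; have e : dQ n * (dP n)^* = (vQ n.+1 - ze n * vQ n) * (vP n.+1 - ze n * vP n)^*.
  rewrite /dQ /dP /dominant rmorphM/= -/q mulrACA qJ mulfV ?mul1r//.
rewrite e -[RHS]mulr1 -(wPQ n) (realP n) (realP n.+1) (realQ n) (realQ n.+1).
move: (ratio a n) (ze n) (complex.Re (vP n)) (complex.Re (vP n.+1))
  (complex.Re (vQ n)) (complex.Re (vQ n.+1)) => k w x1 x2 x3 x4.
by rewrite !ReImE /=; ring.
Qed.

Let zinf := zeta_edge s binf.
Let binf_kp : `|binf| <= kp. Proof. by rewrite /kp lerDl ltW. Qed.
Let zinf1 : nm zinf = 1. Proof. exact: (normc_zeta_edge kp_ge0 kp_lt1). Qed.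
Let zinfJ : zinf^* = zinf^-1. Proof. exact: (zeta_edgeJ kp_ge0 kp_lt1). Qed.
Let zinf_neq0 : zinf != 0. Proof. by rewrite -normc_gt0 zinf1. Qed.
Let zinf_im : complex.Im zinf != 0.
Proof.
rewrite -normr_gt0; apply: lt_le_trans (zeta_edge_gap kp_ge0 kp_lt1 s binf_kp).
exact: branch_gap_gt0.
Qed.

Variables (lP lQ : R[i]).
Hypotheses (limP : ccvg dP lP) (limQ : ccvg dQ lQ).

(** The branch value at [binf] is not real, so this identity forces [lP] to be nonzero; it is also
    the source of the factor [sqrt (1 - binf^2)] in the weight. *)
Lemma limit_wronskian : complex.Im (lQ * lP^*) = complex.Im (zeta_edge s binf).
Proof.
have /ccvgP[_ h1] := ccvgM limQ (ccvgJ limP).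
have /ccvgP[_ h2] := ze_cvg.
have h3 : complex.Im (dQ n * (dP n)^*) * ratio a n @[n --> \oo] -->
    complex.Im (lQ * lP^*).
  rewrite -[X in _ --> X]mulr1; apply: cvgM => //.
  exact: (ratio_cvg1 a_gt0 kappa_ell1 a_infty carleman).
have h4 : complex.Im (dQ n * (dP n)^*) * ratio a n @[n --> \oo] --> complex.Im zinf.
  apply: cvg_trans h2; apply: near_eq_cvg; exists N => // n /= Nn.
  by apply: esym; exact: wave_wronskian.
exact: cvg_unique h3 h4.
Qed.

Lemma limit_neq0 : lP != 0.
Proof.
apply/eqP => l0; have := limit_wronskian; rewrite l0 rmorph0 mulr0 => /esym/eqP.
by rewrite (negbTE zinf_im).
Qed.

(** With the scaled [f] written as [q g], where [g] tends to 1, the Wronskian of [P] and [f] becomes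
    the dominant part of [P] up to a factor tending to a number of modulus 1 and vanishing terms.
    The statement covers every Jost solution, hence the one picked by [xget] in [jost]. *)
Lemma jost_wronskian f : is_jost a am1 b N s lam f ->
  nm (wronskian a am1 P f 0) = nm lP.
Proof.
move=> [hf fq]; set Om := wronskian _ _ _ _ _.
have [_ [B B0 HB]] := real_wave hP.
pose g n := scaled a f n / q n.
have g1 : ccvg g 1 by exact: fq.
have g1S : ccvg (fun n => g n.+1) 1.
  have e := @cvg_shiftS _ (fun n => nm (g n - 1)) (nbhs (0 : R)).
  exact: (@eq_ind_r Prop _ (fun T => T) g1 _ e).
have g0 : ccvg (fun n => g n - 1) 0 by rewrite -(subrr 1); apply: ccvgB => //; exact: ccvg_cst.
have g0S : ccvg (fun n => (g n.+1 - 1) * ze n) 0.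
  rewrite -(mul0r zinf); apply: ccvgM ze_cvg; rewrite -(subrr 1).
  by apply: ccvgB => //; exact: ccvg_cst.
have OmE n : (N <= n)%N -> (ratio a n)%:C * (dP n + ((g n - 1) * (q n.+1 * vP n.+1)
     - (g n.+1 - 1) * ze n * (q n.+1 * vP n))) = - Om * ze n.
  move=> Nn; rewrite /Om -(wronskian_const n.+1 hP hf) (scaled_wronskian am1 a_gt0) -/(ratio a n).
  have fE k : scaled a f k = q k * g k by rewrite /g mulrC divfK.
  rewrite !fE -/(vP n) -/(vP n.+1) /dP /dominant -/q.
  have -> : q n.+1 = q n * ze n by exact: qprodS.
  ring.
have lim : ccvg (fun n => - Om * ze n) lP.
  apply: (@ccvg_near _ (fun n => (ratio a n)%:C * (dP n + ((g n - 1) * (q n.+1 * vP n.+1)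
     - (g n.+1 - 1) * ze n * (q n.+1 * vP n))))).
    by exists N.
  rewrite -[lP]mul1r; apply: ccvgM.
    by apply: ccvg_real; exact: (ratio_cvg1 a_gt0 kappa_ell1 a_infty carleman).
  rewrite -[lP]addr0; apply: ccvgD => //; rewrite -(subrr 0); apply: ccvgB.
    by apply: ccvg_bounded0 g0 _ => n; rewrite Normc.normcM q1 mul1r; exact: HB.
  by apply: ccvg_bounded0 g0S _ => n; rewrite Normc.normcM q1 mul1r; exact: HB.
have := ccvg_unique lim (ccvgM (ccvg_cst (- Om)) ze_cvg).
by move=> ->; rewrite [RHS]Normc.normcM normcN -/zinf zinf1 mulr1.
Qed.

Lemma jost_exists : exists f, is_jost a am1 b N s lam f.
Proof.
(* The dominant part of [lQ P - lP Q] tends to 0, so this combination behaves like a multiple of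
   [q]; [C] cancels the extra factor [ze n] between [q n.+1] and [q n]. *)
pose C := zinf^-1; pose f : cseq R := fun n => C * lQ * P n + (- (C * lP)) * Q n.
exists f; split; first exact: jacobi_equation_comb.
pose g n := scaled a f n / q n; rewrite -[X in X @ _ --> _]/(fun n => nm (g n - 1)) -/(ccvg g 1).
(* For real [v] the recessive part is [q^2] times the conjugate of the dominant one, so the dominant
   part alone determines [v]. *)
have waveE v n : (N <= n)%N -> (v n)^* = v n -> (v n.+1)^* = v n.+1 ->
    v n * ((ze n)^-1 - ze n) = (q n.+1)^-1 * dom v n - q n.+1 * (dom v n)^*.
  move=> Nn v0 v1; rewrite /dominant rmorphM rmorphB rmorphM /= v0 v1 -/q qJ zeJ//.
  by rewrite mulKf// mulVKf//; ring.
have gE n : (N <= n)%N -> g n * ((ze n)^-1 - ze n) =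
    ze n * C * (((lQ * dP n - lP * dQ n) * (q n.+1) ^- 2) -
      (lQ * (dP n)^* - lP * (dQ n)^*)).
  move=> Nn; have qn0 := q_neq0 n; have zn0 := ze_neq0 Nn.
  have -> : g n * ((ze n)^-1 - ze n) = C * (lQ * (vP n * ((ze n)^-1 - ze n)) -
       lP * (vQ n * ((ze n)^-1 - ze n))) / q n.
    by rewrite /g scaled_comb -/(vP n) -/(vQ n); ring.
  rewrite (@waveE vP)//; try by rewrite [vP _]realP conjc_real.
  rewrite (@waveE vQ)//; try by rewrite [vQ _]realQ conjc_real.
  rewrite -/dP -/dQ; have -> : q n.+1 = q n * ze n by exact: qprodS.
  by field; rewrite qn0 zn0.
have wE : lQ * lP^* - lP * lQ^* = zinf - zinf^*.
  have := limit_wronskian; rewrite -/zinf => h.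
  have -> : lP * lQ^* = (lQ * lP^*)^* by rewrite rmorphM/= conjcK mulrC.
  have key (w z : R[i]) : complex.Im w = complex.Im z -> w - w^* = z - z^*.
    by move=> wz; apply: complexP; rewrite !ReImE ?wz; ring.
  exact: key.
have dz : zinf^* - zinf != 0.
  apply/eqP => /(congr1 (@complex.Im R)); rewrite ImD ImJ ImN => h.
  have /eqP : - complex.Im zinf - complex.Im zinf = 0 by exact: h.
  by rewrite -opprD oppr_eq0 -mulr2n mulrn_eq0/= (negbTE zinf_im).
have q2 n : nm ((q n.+1) ^- 2) <= 1.
  by rewrite Normc.normcV expr2 Normc.normcM q1 mul1r invr1.
have lim0 : ccvg (fun n => (lQ * dP n - lP * dQ n) * (q n.+1) ^- 2) 0.
  apply: ccvg_bounded0 q2; rewrite (_ : 0 = lQ * lP - lP * lQ); last by ring.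
  by apply: ccvgB; apply: ccvgM => //; exact: ccvg_cst.
have lim1 : ccvg (fun n => ze n * C * (((lQ * dP n - lP * dQ n) * (q n.+1) ^- 2) -
      (lQ * (dP n)^* - lP * (dQ n)^*))) (zinf * C * (0 - (lQ * lP^* - lP * lQ^*))).
  apply: ccvgM; first by apply: ccvgM; [exact: ze_cvg|exact: ccvg_cst].
  apply: ccvgB => //; apply: ccvgB; apply: ccvgM; try exact: ccvg_cst; exact: ccvgJ.
have lim2 : ccvg (fun n => ((ze n)^-1 - ze n)^-1) (zinf^* - zinf)^-1.
  apply: ccvgV => //; rewrite zinfJ; apply: ccvgB; last exact: ze_cvg.
  by apply: ccvgV => //; exact: ze_cvg.
have := ccvgM lim1 lim2.
have -> : zinf * C * (0 - (lQ * lP^* - lP * lQ^*)) * (zinf^* - zinf)^-1 = 1.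
  by rewrite wE mulfV// mul1r sub0r opprB mulfV.
apply: ccvg_near; exists N => // n /= Nn; rewrite -gE// mulfK//.
rewrite -normc_gt0; apply: lt_le_trans (normc_invB branch_gap_gt0 ze_im Nn).
exact: branch_gap_gt0.
Qed.

Lemma normc_Omega : nm (Omega a am1 b N s lam) = nm lP.
Proof.
rewrite /Omega /jost orthopolyE; apply: jost_wronskian.
have [f hf] := jost_exists; case: xgetP => [g -> //|H].
by have := H f; rewrite /= => /(_ hf).
Qed.

End RealPoint.

(** * The square summable solution in the upper half plane *)

Section WeylSolution.
Hypothesis beta_cvg : beta n @[n --> \oo] --> binf.
Hypothesis a_infty : a n @[n --> \oo] --> +oo.
Hypothesis carleman : series (fun n => (a n)^-1) n @[n --> \oo] --> +oo.
Local Notation P z := (jacobi_solution a b am1 0 1 z).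
Local Notation Q z := (second_solution z).
Local Notation domP z := (dominant_at 0 1 z).
Local Notation domQ z := (dominant_at (- am1^-1)%:C 0 z).

(** Multiply the equation by the conjugate of [u] and take imaginary parts: the real coefficients
    leave a telescoping flux. *)
Lemma green_identity z u n : jacobi_equation a am1 b z u ->
  complex.Im z * \sum_(0 <= k < n) nm (u k.+1) ^+ 2 =
  complex.Im ((aprev a am1 n)%:C * ((u n)^* * u n.+1)) -
  complex.Im (am1%:C * ((u 0%N)^* * u 1%N)).
Proof.
move=> hu; elim: n => [|n IH]; first by rewrite big_geq// mulr0 subrr.
rewrite big_nat_recr//= mulrDr IH.
have := congr1 (fun w => complex.Im ((u n.+1)^* * w)) (hu n).
rewrite sqr_normcE !ReImE /=; lra.
Qed.

Lemma dominant_at_eq0 u0 u1 z n : (N <= n)%N -> dominant_at u0 u1 z n = 0 ->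
  scaled a (jacobi_solution a b am1 u0 u1 z) n.+1 =
  zeta (X n z) * scaled a (jacobi_solution a b am1 u0 u1 z) n.
Proof.
move=> Nn /eqP; rewrite /dominant_at /dominant mulf_eq0 subr_eq0 => /orP[|/eqP//].
rewrite /qprod prodf_seq_eq0 => /hasP[k _ /=].
by rewrite (negbTE (root_neq0 (zeta_root _))).
Qed.

(** The flux is a nonnegative multiple of the imaginary part of [zeta_n], which is negative on the
    half disc. *)
Let flux_le0 z u n : (N <= n)%N -> upper_region z ->
  scaled a u n.+1 = zeta (X n z) * scaled a u n ->
  complex.Im ((aprev a am1 n.+1)%:C * ((u n.+1)^* * u n.+2)) <= 0.
Proof.
move=> Nn [zr z0]; rewrite /scaled -[aprev _ _ _]/(a n).
set s0 := Num.sqrt (a n); set s1 := Num.sqrt (a n.+1) => e.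
have s0p : 0 < s0 by rewrite sqrtr_gt0.
have s1p : 0 < s1 by rewrite sqrtr_gt0.
have im : complex.Im (zeta (X n z)) <= 0.
  by have := branch_im Nn zr z0; have := branch_gap_gt0; lra.
have -> : complex.Im ((a n)%:C * ((u n.+1)^* * u n.+2)) =
    a n / s1 * complex.Im ((u n.+1)^* * (s1%:C * u n.+2)).
  by rewrite !ReImE /=; field; rewrite gt_eqF.
rewrite e mulr_ge0_le0 ?divr_ge0 ?(ltW s1p) ?(ltW (a_gt0 n))//.
have -> : complex.Im ((u n.+1)^* * (zeta (X n z) * (s0%:C * u n.+1))) =
    s0 * nm (u n.+1) ^+ 2 * complex.Im (zeta (X n z)).
  by rewrite sqr_normcE !ReImE /=; ring.
by rewrite mulr_ge0_le0// mulr_ge0 ?sqr_ge0// ltW.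
Qed.

(** For [P] the flux at -1 vanishes, so Green's identity makes its flux at the far end strictly
    positive, whereas a vanishing dominant part would make it nonpositive. The quotient [m] of
    [weyl_bound] divides by this quantity. *)
Lemma dominant_atP_neq0 z n : (N <= n)%N -> nm z < rho -> 0 < complex.Im z ->
  domP z n != 0.
Proof.
move=> Nn zr z0; apply/eqP => /(dominant_at_eq0 Nn) e.
have Oz : upper_region z by split => //; exact: ltW.
have := flux_le0 Nn Oz e.
have := green_identity n.+1 (jacobi_solutionP b am1 a_gt0 0 1 z).
have -> : complex.Im (am1%:C * ((P z 0%N)^* * P z 1%N)) = 0 by rewrite !ReImE /=; ring.
rewrite subr0 => <-; apply/negP; rewrite -ltNge mulr_gt0//.
rewrite big_nat_recl//= ltr_pwDl ?sumr_ge0// => [|i _]; last exact: sqr_ge0.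
by rewrite Normc.normc1 expr1n.
Qed.

(** Its values at -1 and 0 are [- 1 / a_{-1}] and [m], so read from index 0 on it solves
    [(A - z) u = e_0] with [u_0 = m]. The factor 1 fits the shape of [jacobi_equation_comb]. *)
Let comb z m := (fun n => 1 * Q z n + m * P z n) : cseq R.

Let combE z m : jacobi_equation a am1 b z (comb z m).
Proof. by apply: jacobi_equation_comb; exact: jacobi_solutionP. Qed.

Let comb_sol z m : comb z m = jacobi_solution a b am1 (- am1^-1)%:C m z.
Proof.
rewrite (jacobi_equation_unique a_gt0 (combE z m)); congr jacobi_solution.
  by rewrite /comb /second_solution /= mulr0 addr0 mul1r.
by rewrite /comb /second_solution /= mulr0 add0r mulr1.
Qed.

(** This [m] makes the dominant part of [Q + m P] vanish at [n], so the flux at the far end is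
    nonpositive, while the flux at -1 equals [- Im m]. The length [K] is kept apart from [n], which
    tends to infinity in [weyl_limit]. *)
Lemma weyl_bound z n K m : (N <= n)%N -> (K <= n.+1)%N -> nm z < rho ->
  0 < complex.Im z -> m = - domQ z n / domP z n ->
  complex.Im z * \sum_(0 <= k < K) nm (comb z m k.+1) ^+ 2 <= complex.Im m.
Proof.
move=> Nn Kn zr z0 mE; have Oz : upper_region z by split => //; exact: ltW.
have d0 : dominant_at (- am1^-1)%:C m z n = 0.
  rewrite /dominant_at /dominant -comb_sol !scaled_comb -/(domQ z n).
  transitivity (domQ z n + m * domP z n).
    by rewrite /dominant_at /dominant /second_solution; ring.
  by rewrite mE divfK ?dominant_atP_neq0// addrN.
have := flux_le0 Nn Oz (dominant_at_eq0 Nn d0); rewrite -comb_sol.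
have := green_identity n.+1 (combE z m).
have -> : complex.Im (am1%:C * ((comb z m 0%N)^* * comb z m 1%N)) = - complex.Im m.
  have am0 : am1 != 0 by exact: lt0r_neq0.
  rewrite comb_sol -[jacobi_solution _ _ _ _ _ _ 0%N]/((- am1^-1)%:C).
  rewrite -[jacobi_solution _ _ _ _ _ _ 1%N]/m !ReImE /=; field.
  exact: am0.
have : \sum_(0 <= k < K) nm (comb z m k.+1) ^+ 2 <=
       \sum_(0 <= k < n.+1) nm (comb z m k.+1) ^+ 2.
  rewrite [leRHS](@big_cat_nat _ _ _ K)//= lerDl sumr_ge0// => i _; exact: sqr_ge0.
move=> /(ler_wpM2l (ltW z0)) h1 h2 h3; lra.
Qed.

Variables (dlP dlQ : R[i] -> R[i]).
Hypothesis limP : forall e : R, 0 < e -> exists2 n0, (N <= n0)%N &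
  forall n z, (n0 <= n)%N -> upper_region z -> nm (domP z n - dlP z) <= e.
Hypothesis limQ : forall e : R, 0 < e -> exists2 n0, (N <= n0)%N &
  forall n z, (n0 <= n)%N -> upper_region z -> nm (domQ z n - dlQ z) <= e.

Let pointwise (f : R[i] -> nat -> R[i]) (g : R[i] -> R[i]) z :
  (forall e : R, 0 < e -> exists2 n0, (N <= n0)%N &
     forall n z, (n0 <= n)%N -> upper_region z -> nm (f z n - g z) <= e) ->
  upper_region z -> ccvg (f z) (g z).
Proof.
move=> H Oz; apply/cvgrPdist_le => e e0; have [n0 _ Hn0] := H e e0.
exists n0 => // n /= n0n; rewrite sub0r normrN ger0_norm ?normc_ge0//.
exact: Hn0.
Qed.

Lemma weyl_limit z K m : nm z < rho -> 0 < complex.Im z -> dlP z != 0 ->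
  m = - dlQ z / dlP z ->
  complex.Im z * \sum_(0 <= k < K) nm (comb z m k.+1) ^+ 2 <= complex.Im m.
Proof.
move=> zr z0 d0 mE; have Oz : upper_region z by split => //; exact: ltW.
pose mn n := - domQ z n / domP z n.
have m_cvg : ccvg mn m.
  rewrite mE; apply: ccvgM; first by apply: ccvgN; exact: pointwise.
  by apply: ccvgV => //; exact: pointwise.
have /ccvgP[_ im_cvg] := m_cvg.
have sum_cvg : complex.Im z * \sum_(0 <= k < K) nm (comb z (mn n) k.+1) ^+ 2
    @[n --> \oo] --> complex.Im z * \sum_(0 <= k < K) nm (comb z m k.+1) ^+ 2.
  apply: cvgMl_tmp; elim: K => [|k IH].
    by rewrite big_geq//; under eq_fun do rewrite big_geq//; exact: cvg_cst.
  rewrite big_nat_recr//=; under eq_fun do rewrite big_nat_recr//=.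
  apply: cvgD => //; rewrite expr2; under eq_fun do rewrite expr2.
  by apply: cvgM; apply: ccvg_norm; apply: ccvgD; try exact: ccvg_cst;
    apply: ccvgM => //; exact: ccvg_cst.
apply: ler_cvg_to sum_cvg im_cvg _; exists (maxn N K) => // n /=.
rewrite geq_max => /andP[Nn Kn]; by apply: (@weyl_bound z n) => //; exact: leqW.
Qed.

Lemma weyl_solution z : nm z < rho -> 0 < complex.Im z -> dlP z != 0 ->
  exists u : cseq R, [/\ ell2 u, jacobi_action a b u = basis_vec R 0 + cscale z u &
    u 0%N = - dlQ z / dlP z].
Proof.
move=> zr z0 d0; set m := - dlQ z / dlP z.
pose u : cseq R := fun n => comb z m n.+1; exists u; split.
- have [] // := @ell2_bound _ u (complex.Im m / complex.Im z) => n.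
  by rewrite ler_pdivlMr// mulrC; exact: weyl_limit.
- apply/funext => -[|n]; have := combE z m _.
    move=> /(_ 0%N); rewrite -/(u 0%N) -/(u 1%N) /=.
    have -> : comb z m 0%N = (- am1^-1)%:C by rewrite comb_sol.
    have -> : am1%:C * (- am1^-1)%:C = -1 :> R[i].
      have am0 : am1 != 0 by exact: lt0r_neq0.
      by apply: complexP; rewrite !ReImE /=; [field|ring].
    rewrite -addrA => h.
    transitivity (1 + (-1 + ((b 0%N)%:C * u 0%N + (a 0%N)%:C * u 1%N))); first by ring.
    by rewrite h.
  move=> /(_ n.+1); rewrite -/(u n) -/(u n.+1) -/(u n.+2) /= => ->.
  by rewrite -[RHS]/(0 + z * u n.+1) add0r.
- by rewrite /u comb_sol.
Qed.

End WeylSolution.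

(** * Boundary values of the Weyl function *)

Section LocalSpectralData.
Hypothesis beta_cvg : beta n @[n --> \oo] --> binf.
Hypothesis a_infty : a n @[n --> \oo] --> +oo.
Hypothesis carleman : series (fun n => (a n)^-1) n @[n --> \oo] --> +oo.
Variables (lam : R) (s : bool).
Hypothesis lam_rho : `|lam| < rho.
Let y n : R := alpha n * lam + beta n.
Let edge t n : R[i] := zeta_edge t (y n).

Let lamC : nm lam%:C < rho. Proof. by rewrite normc_real. Qed.

Let y_kp n : (N <= n)%N -> `|y n| <= kp.
Proof.
move=> Nn; have := point_norm Nn lamC; rewrite /jacobi_point.
by rewrite -rmorphM -rmorphD normc_real.
Qed.

Let dominant_edge u0 u1 n : (N <= n)%N -> dominant_at u0 u1 lam%:C n =
  dominant N (edge true) (scaled a (jacobi_solution a b am1 u0 u1 lam%:C)) n.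
Proof.
move=> Nn; have ze k : (N <= k)%N -> zeta (X k lam%:C) = edge true k.
  move=> Nk; rewrite /jacobi_point -rmorphM -rmorphD /edge -zeta_real//.
  by rewrite (le_lt_trans (y_kp Nk)).
rewrite /dominant_at /dominant ze//; congr (_ * _).
by apply: eq_big_nat => k /andP[Nk _]; exact: ze.
Qed.

Let Q_init := (- am1^-1)%:C : R[i].

Let edge_conj k : (N <= k)%N -> edge false k = (edge true k)^*.
Proof. by move=> Nk; rewrite /edge zeta_edgeN// (le_trans (y_kp Nk))// ltW. Qed.

(** Solutions with real initial values are real at real [lambda], so passing to the lower edge
    conjugates every dominant part and leaves the modulus of its limit unchanged. *)
Let Omega_limit lP lQ :
  ccvg (dominant N (edge true) (scaled a (jacobi_solution a b am1 0 1 lam%:C))) lP ->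
  ccvg (dominant N (edge true) (scaled a (second_solution lam%:C))) lQ ->
  nm (Omega a am1 b N s lam) = nm lP.
Proof.
case: s => limP limQ.
  exact: (normc_Omega beta_cvg a_infty carleman lam_rho limP limQ).
have conj u0 u1 l : u0^* = u0 -> u1^* = u1 ->
   ccvg (dominant N (edge true) (scaled a (jacobi_solution a b am1 u0 u1 lam%:C))) l ->
   ccvg (dominant N (edge false) (scaled a (jacobi_solution a b am1 u0 u1 lam%:C))) l^*.
  move=> h0 h1 /ccvgJ; apply: ccvg_near; exists N => // n /= Nn.
  have cM (x1 x2 : R[i]) : (x1 * x2)^* = x1^* * x2^* by rewrite rmorphM.
  have cB (x1 x2 : R[i]) : (x1 - x2)^* = x1^* - x2^* by rewrite rmorphB.
  have vJ k : (scaled a (jacobi_solution a b am1 u0 u1 lam%:C) k)^* =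
      scaled a (jacobi_solution a b am1 u0 u1 lam%:C) k.
    by rewrite /scaled cM jacobi_solution_real// conjc_real.
  rewrite /dominant cM cB [(edge true n * _)^*]cM !vJ -edge_conj//; congr (_ * _).
  rewrite /qprod (@rmorph_prod _ _ (@conjc R)); apply: eq_big_nat => k /andP[Nk _].
  by rewrite edge_conj.
rewrite -(normcJ lP).
apply: (normc_Omega beta_cvg a_infty carleman lam_rho (lQ := lQ^*)).
  by apply: conj limP; rewrite ?rmorph0 ?rmorph1.
by apply: conj limQ; rewrite ?conjc_real ?rmorph0.
Qed.

Let quotient_near (f g f0 g0 : R[i]) (d : R) : g0 != 0 -> 0 <= d ->
  d <= nm g0 / 2 -> nm (f - f0) <= d -> nm (g - g0) <= d ->
  g != 0 /\ nm (f / g - f0 / g0) <= 2 * d * (nm f0 + nm g0) / nm g0 ^+ 2.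
Proof.
move=> g0_neq0 d0 dg hf hg; have G0 : 0 < nm g0 by rewrite normc_gt0.
have gg : nm g0 / 2 <= nm g.
  by have := ler_normcD (g0 - g) g; rewrite subrK normc_distC; lra.
have gp : 0 < nm g by lra.
have g_neq0 : g != 0 by rewrite -normc_gt0.
split=> //.
have -> : f / g - f0 / g0 = ((f - f0) * g0 - f0 * (g - g0)) / (g * g0).
  field; by rewrite g_neq0 g0_neq0.
rewrite Normc.normcM Normc.normcV Normc.normcM ler_pdivrMr ?mulr_gt0//.
have num : nm ((f - f0) * g0 - f0 * (g - g0)) <= d * (nm f0 + nm g0).
  rewrite (le_trans (ler_normcB _ _))// !Normc.normcM mulrDr addrC lerD//.
    by rewrite mulrC ler_wpM2r ?normc_ge0.
  by rewrite ler_wpM2r ?normc_ge0.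
apply: (le_trans num).
have -> : 2 * d * (nm f0 + nm g0) / nm g0 ^+ 2 * (nm g * nm g0) =
   d * (nm f0 + nm g0) * (nm g / (nm g0 / 2)) by field; rewrite gt_eqF.
rewrite ler_peMr ?mulr_ge0 ?addr_ge0 ?normc_ge0//.
by rewrite ler_pdivlMr ?mul1r// divr_gt0.
Qed.

(** [u 0] is the quotient [- dlQ z / dlP z], continuous up to [lam] because [dlP] is nonzero there;
    the imaginary part of its boundary value follows from [limit_wronskian]. The estimate is uniform
    in the direction of approach, as [poisson_inversion] demands. *)
Lemma weyl_near : Omega a am1 b N s lam != 0 /\
  forall e : R, 0 < e -> exists2 r : R, 0 < r & forall z : R[i],
    nm (z - lam%:C) < r -> 0 < complex.Im z ->
    exists u : cseq R, [/\ ell2 u,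
      jacobi_action a b u = basis_vec R 0 + cscale z u &
      `|complex.Im (u 0%N) -
        Num.sqrt (1 - binf ^+ 2) * nm (Omega a am1 b N s lam) ^- 2| <= e].
Proof.
have [dlP [limP contP]] := dominant_limit 0 1.
have [dlQ [limQ contQ]] := dominant_limit Q_init 0.
have Ol : upper_region lam%:C by split.
have pt u0 u1 (dl : R[i] -> R[i]) : (forall e : R, 0 < e -> exists2 n0, (N <= n0)%N &
    forall n z, (n0 <= n)%N -> upper_region z -> nm (dominant_at u0 u1 z n - dl z) <= e) ->
    ccvg (dominant N (edge true) (scaled a (jacobi_solution a b am1 u0 u1 lam%:C))) (dl lam%:C).
  move=> H; apply/cvgrPdist_le => e e0; have [n0 Nn0 Hn0] := H e e0.
  exists n0 => // n /= n0n; rewrite sub0r normrN ger0_norm ?normc_ge0//.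
  by rewrite -dominant_edge ?Hn0// (leq_trans Nn0).
have lP := pt _ _ _ limP; have lQ := pt _ _ _ limQ.
have OmE := Omega_limit lP lQ.
set P0 := dlP lam%:C in lP OmE; set Q0 := dlQ lam%:C in lQ.
have P0_neq0 : P0 != 0 := limit_neq0 beta_cvg a_infty carleman lam_rho lP lQ.
have WE : complex.Im (Q0 * P0^*) = complex.Im (zeta_edge true binf) :=
  limit_wronskian beta_cvg a_infty carleman lam_rho lP lQ.
have G0 : 0 < nm P0 by rewrite normc_gt0.
split; first by rewrite -normc_gt0 OmE.
move=> e e0; rewrite OmE.
have target : complex.Im (- Q0 / P0) = Num.sqrt (1 - binf ^+ 2) * nm P0 ^- 2.
  have -> : - Q0 / P0 = - ((nm P0 ^- 2)%:C * (Q0 * P0^*)).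
    by rewrite invcE; ring.
  have -> : complex.Im (- ((nm P0 ^- 2)%:C * (Q0 * P0^*))) =
      - (nm P0 ^- 2 * complex.Im (Q0 * P0^*)).
    by case: (Q0 * P0^*) => x1 x2 /=; ring.
  by rewrite WE zeta_edge_im ?ltW//; ring.
pose F := nm P0 + nm Q0 + 1.
have F0 : 0 < F by rewrite ltr_wpDl// addr_ge0// normc_ge0.
pose d := Num.min (nm P0 / 2) (e * nm P0 ^+ 2 / (2 * F)).
have d0 : 0 < d by rewrite lt_min !divr_gt0 ?mulr_gt0 ?exprn_gt0.
have dP : d <= nm P0 / 2 by rewrite ge_min lexx.
have dF : 2 * d * F <= e * nm P0 ^+ 2.
  by rewrite mulrAC mulrC -ler_pdivlMr ?mulr_gt0// ge_min lexx orbT.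
have [r1 r10 Hr1] := contP _ Ol d d0; have [r2 r20 Hr2] := contQ _ Ol d d0.
exists (Num.min (rho - `|lam|) (Num.min r1 r2)); first by rewrite !lt_min subr_gt0 lam_rho r10.
move=> z; rewrite !lt_min => /and3P[h0 h1 h2] z0.
have zr : nm z < rho.
  by have := ler_normcD (z - lam%:C) lam%:C; rewrite subrK normc_real; lra.
have Oz : upper_region z by split => //; exact: ltW.
have [gz near] := quotient_near P0_neq0 (ltW d0) dP (Hr2 z Oz h2) (Hr1 z Oz h1).
have [u [hu hJ u0]] := weyl_solution limP limQ zr z0 gz.
exists u; split=> //; rewrite -target u0 -ImN -ImD (le_trans (normc_Im _))//.
rewrite (_ : _ - _ = - (dlQ z / dlP z - Q0 / P0)); last by rewrite !mulNr; ring.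
rewrite normcN (le_trans near)// ler_pdivrMr ?exprn_gt0// (le_trans _ dF)//.
rewrite ler_wpM2l ?mulr_ge0 ?(ltW d0)// /F; lra.
Qed.

Lemma real_not_ell2 (u : cseq R) :
  jacobi_action a b u = basis_vec R 0 + cscale lam%:C u -> ~ ell2 u.
Proof.
move=> hJ hu; have am0 : am1 != 0 by exact: lt0r_neq0.
(* With the value [- 1 / a_{-1}] at -1 the inhomogeneous equation at index 0 becomes homogeneous,
   and the Wronskian with [P] is 1. *)
pose us : cseq R := fun n => if n is m.+1 then u m else Q_init.
have hus : jacobi_equation a am1 b lam%:C us.
  have h0 : (b 0%N)%:C * u 0%N + (a 0%N)%:C * u 1%N = 1 + lam%:C * u 0%N :=
    congr1 (fun f : cseq R => f 0%N) hJ.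
  have hS n : (a n)%:C * u n + (b n.+1)%:C * u n.+1 + (a n.+1)%:C * u n.+2 =
      0 + lam%:C * u n.+1 := congr1 (fun f : cseq R => f n.+1) hJ.
  move=> [|n]; last by rewrite /us/= hS add0r.
  rewrite -addrA /us/= h0 (_ : am1%:C * Q_init = -1) ?addKr//.
  by apply: complexP; rewrite !ReImE /=; [field|ring].
have [_ [B B0 HB]] := real_wave true lam_rho (jacobi_solutionP b am1 a_gt0 0 1 lam%:C).
set P := jacobi_solution a b am1 0 1 lam%:C in HB.
have W n : (ratio a n)%:C * (scaled a P n * scaled a us n.+1 -
    scaled a P n.+1 * scaled a us n) = 1.
  rewrite /ratio -(scaled_wronskian am1 a_gt0).
  rewrite (wronskian_const n.+1 (jacobi_solutionP b am1 a_gt0 0 1 lam%:C) hus).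
  by apply: complexP; rewrite /wronskian /us /Q_init !ReImE /=; [field|ring].
have rc := ratio_cvg1 a_gt0 kappa_ell1 a_infty carleman.
have [M1 _ HM1] : \forall n \near \oo, ratio a n < 2.
  by apply: cvgr_lt rc _ _; rewrite ltr1n.
have [M2 _ HM2] : \forall n \near \oo, 1 / 2 < ratio a n.
  by apply: cvgr_gt rc _ _; lra.
(* In [D], the 2 bounds the ratio and [B] the scaled [P]. In [C], the 2 comes from
   [(p + p')^2 <= 2 (p^2 + p'^2)] and the 4 from [a_{n+1} <= 4 a_n]. *)
pose M := maxn M1 M2; pose D := 2 * (B + 1).
have D0 : 0 < D by rewrite /D; lra.
pose C := 2 * D ^+ 2 * 4.
have C0 : 0 < C by apply: mulr_gt0 => //; apply: mulr_gt0 => //; exact: exprn_gt0.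
have step n : (M <= n)%N -> (a n)^-1 <= C * (nm (u n) ^+ 2 + nm (u n.+1) ^+ 2).
  rewrite geq_max => /andP[/HM1 /= r2 /HM2 /= r1].
  have r0 := ratio_gt0 a_gt0 n.
  set p := nm (scaled a us n); set p' := nm (scaled a us n.+1).
  have p0 : 0 <= p by exact: normc_ge0.
  have p'0 : 0 <= p' by exact: normc_ge0.
  have h1 : 1 <= D * (p + p').
    have := congr1 (@Normc.normc R) (W n); rewrite Normc.normcM Normc.normc1.
    rewrite normc_real gtr0_norm// => e1; rewrite -[leLHS]e1.
    have t : nm (scaled a P n * scaled a us n.+1 - scaled a P n.+1 * scaled a us n)
        <= (B + 1) * (p + p').
      rewrite (le_trans (ler_normcB _ _))// [nm (_ * scaled a us n.+1)]Normc.normcM.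
      rewrite [nm (_ * scaled a us n)]Normc.normcM -/p -/p'.
      have := ler_wpM2r p'0 (HB n); have := ler_wpM2r p0 (HB n.+1); nra.
    by rewrite /D -mulrA; apply: ler_pM => //; [exact: ltW|exact: normc_ge0|exact: ltW].
  have h2 : 1 <= 2 * D ^+ 2 * (p ^+ 2 + p' ^+ 2).
    have := sqr_ge0 (p - p'); have := sqr_ge0 D.
    have h3 : 1 <= (D * (p + p')) ^+ 2 by rewrite exprn_ege1.
    move=> h4 h5; apply: (le_trans h3); rewrite exprMn -subr_ge0.
    rewrite (_ : _ - _ = D ^+ 2 * (p - p') ^+ 2); last by ring.
    exact: mulr_ge0.
  have pE : p ^+ 2 = a n * nm (u n) ^+ 2.
    by rewrite /p /scaled Normc.normcM normc_real exprMn ger0_norm ?sqrtr_ge0// sqr_sqrtr// ltW.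
  have p'E : p' ^+ 2 = a n.+1 * nm (u n.+1) ^+ 2.
    by rewrite /p' /scaled Normc.normcM normc_real exprMn ger0_norm ?sqrtr_ge0// sqr_sqrtr// ltW.
  have aE : a n.+1 <= 4 * a n.
    have e : a n = ratio a n ^+ 2 * a n.+1.
      by rewrite /ratio exprMn exprVn !sqr_sqrtr ?(ltW (a_gt0 _))// divfK// gt_eqF.
    have := a_gt0 n.+1 => ap; rewrite e.
    have : 1 / 4 <= ratio a n ^+ 2 by nra.
    by move=> h; rewrite mulrA ler_peMl ?(ltW ap)//; lra.
  rewrite -[leLHS]mul1r ler_pdivrMr//.
  have h3 : p ^+ 2 + p' ^+ 2 <= 4 * ((nm (u n) ^+ 2 + nm (u n.+1) ^+ 2) * a n).
    rewrite pE p'E; have := a_gt0 n; have := sqr_ge0 (nm (u n)).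
    have := sqr_ge0 (nm (u n.+1)); nra.
  have h4 := ler_wpM2l (ltW (mulr_gt0 (ltr0n R 2) (exprn_gt0 2 D0))) h3.
  by rewrite /C; lra.
have sum n : \sum_(M <= k < n) (a k)^-1 <= 2 * C * rdot u u.
  apply: (@le_trans _ _ (\sum_(M <= k < n) C * (nm (u k) ^+ 2 + nm (u k.+1) ^+ 2))).
    by apply: ler_sum_nat => k /andP[Mk _]; exact: step.
  rewrite -mulr_sumr (_ : 2 * C * rdot u u = C * (2 * rdot u u)) ?ler_pM2l//; last by ring.
  apply: (@le_trans _ _ (\sum_(0 <= k < n) (nm (u k) ^+ 2 + nm (u k.+1) ^+ 2))).
    have [Mn|nM] := leqP M n.
      rewrite [leRHS](@big_cat_nat _ _ _ M)//= lerDr sumr_ge0// => k _.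
      by rewrite addr_ge0// sqr_ge0.
    rewrite big_geq ?(ltnW nM)// sumr_ge0// => k _; by rewrite addr_ge0// sqr_ge0.
  rewrite big_split/=; have := rdot_sum_le n hu; have := rdot_sum_le n.+1 hu.
  rewrite [X in X <= _ -> _]big_nat_recl//=; have := sqr_ge0 (nm (u 0%N)); lra.
have /cvgryPgt/(_ (series (fun n => (a n)^-1) M + 2 * C * rdot u u))[M' _ HM'] := carleman.
have := HM' (maxn M M') (leq_maxr _ _); rewrite ltNge /=; apply/negP; rewrite negbK.
by rewrite /series/= (@big_cat_nat _ _ _ M)//= ?leq_maxl// lerD2l.
Qed.

End LocalSpectralData.

End Region.

(** * Differentiation of the spectral family *)

Section StrictDerivative.
Variable R : realType.
Implicit Types (f : R -> R) (x y l w z r : R).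

(** Both end points move, unlike in the ordinary derivative at [l]. This is stronger: a derivative
    that exists everywhere in this sense is continuous. *)
Definition strict_derivative f l w := forall z, 0 < z -> exists2 r, 0 < r &
  forall x y, `|x - l| < r -> `|y - l| < r -> x < y ->
    `|f y - f x - w * (y - x)| <= z * (y - x).

Lemma strict_derivative_is_derive f l w :
  strict_derivative f l w -> is_derive l 1 f w.
Proof.
move=> H.
have c : h^-1 *: ((f \o shift l) (h *: 1) - f l) @[h --> 0^'] --> w.
  apply/cvgrPdist_le => z z0; have [r r0 Hr] := H z z0.
  exists r => //= h /=; rewrite sub0r normrN => hr h0.
  rewrite /shift/= /GRing.scale/= mulr1 distrC.
  have hn : 0 < `|h| by rewrite normr_gt0.
  rewrite -(ler_pM2l hn) -normrM mulrBr mulVKf//.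
  have hl : `|h + l - l| < r by rewrite addrK.
  have ll : `|l - l| < r by rewrite subrr normr0.
  have [hp|hm|he] := ltgtP 0 h; last by rewrite -he eqxx in h0.
    have := Hr l (h + l) ll hl; rewrite ltrDr => /(_ hp).
    by rewrite addrK (gtr0_norm hp) [h * w]mulrC [h * z]mulrC.
  have := Hr (h + l) l hl ll; rewrite gtrDr => /(_ hm).
  rewrite (ltr0_norm hm) (_ : l - (h + l) = - h); last by ring.
  rewrite -normrN.

  rewrite (_ : - (f l - f (h + l) - w * - h) = f (h + l) - f l - h * w); last by ring.
  by rewrite [- h * z]mulrC.
exact: DeriveDef (cvgP _ c) (cvg_lim _ c).
Qed.

(** A short interval starting at [x] near [l] has a difference quotient within [z / 2] of both [w l]
    and [w x]. *)
Lemma strict_derivative_continuous f (w : R -> R) :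
  (forall l, strict_derivative f l (w l)) -> continuous w.
Proof.
move=> H l; apply/cvgrPdist_le => z z0.
have z2 : 0 < z / 2 by rewrite divr_gt0.
have [r r0 Hr] := H l _ z2; exists (r / 2) => /=; first by rewrite divr_gt0.
move=> x /= xl; have [r' r'0 Hr'] := H x _ z2.
pose d := Num.min (r / 2) (r' / 2).
have d0 : 0 < d by rewrite lt_min !divr_gt0.
have d1 : d <= r / 2 by rewrite ge_min lexx.
have d2 : d <= r' / 2 by rewrite ge_min lexx orbT.
have xd : x < x + d by rewrite ltrDl.
rewrite distrC in xl; have xlr : `|x - l| < r by lra.
have ydl : `|x + d - l| < r.
  have := ler_normD (x - l) d; rewrite (gtr0_norm d0) addrAC; lra.
have x0 : `|x - x| < r' by rewrite subrr normr0.
have y0 : `|x + d - x| < r' by rewrite addrAC subrr add0r (gtr0_norm d0); lra.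
have := Hr _ _ xlr ydl xd; have := Hr' _ _ x0 y0 xd.
rewrite (_ : x + d - x = d); last by ring.
rewrite !ler_norml => /andP[h1 h2] /andP[h3 h4].
have e1 : (w l - w x) * d <= z * d by nra.
have e2 : (- z) * d <= (w l - w x) * d by nra.
by rewrite !ler_pM2r// in e1 e2; apply/andP.
Qed.

Lemma strict_derivative_integral f (w : R -> R) x y :
  (forall l, strict_derivative f l (w l)) -> x < y ->
  (\int[lebesgue_measure]_(t in `]x, y]) (w t)%:E = (f y - f x)%:E)%E.
Proof.
move=> H xy; have cw := strict_derivative_continuous H.
have df (t : R) : is_derive t 1 f (w t) := strict_derivative_is_derive (H t).
have cf t : {for t, continuous f}.
  by apply/differentiable_continuous/derivable1_diffP; case: (df t).
rewrite integral_itv_obnd_cbnd; last first.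
  by apply: measurable_funTS; apply/measurable_EFinP; exact: continuous_measurable_fun.
rewrite (@continuous_FTC2 _ w f)//.
- by apply: continuous_subspaceT => t; exact: cw.
- split; first by move=> t _; case: (df t).
  + by apply: cvg_at_right_filter; exact: cf.
  + by apply: cvg_at_left_filter; exact: cf.
- by move=> t _; rewrite derive1E; exact: (@derive_val _ _ _ _ _ _ _ (df t)).
Qed.

Lemma measure_eq_itv (m1 m2 : {measure set (measurableTypeR R) -> \bar R}) :
  (m1 setT < +oo)%E ->
  (forall x y, x < y -> m1 `]x, y]%classic = m2 `]x, y]%classic) ->
  forall B, measurable B -> m1 B = m2 B.
Proof.
move=> m1oo m12.
have lim (m : {measure set (measurableTypeR R) -> \bar R}) x :
    m `](x - n%:R)%R, x]%classic @[n --> \oo] --> m `]-oo, x]%classic.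
  have -> : `]-oo, x]%classic = \bigcup_n `](x - n%:R)%R, x]%classic :> set R.
    apply/seteqP; split=> t /=; last by move=> [n _ /=]; rewrite !in_itv/= => /andP[].
    rewrite in_itv/= => tx; exists (Num.bound `|x - t|) => //=.
    rewrite in_itv/= tx andbT; have := archi_boundP (normr_ge0 (x - t)).
    by have := ler_norm (x - t); lra.
  apply: nondecreasing_cvg_mu; first by move=> n; exact: measurable_itv.
    by apply: bigcupT_measurable => n; exact: measurable_itv.
  move=> p q pq; apply/subsetPset => t /=; rewrite !in_itv/= => /andP[h ->].
  rewrite andbT; have : (p%:R : R) <= q%:R by rewrite ler_nat.
  by move: h; lra.
have limT (m : {measure set (measurableTypeR R) -> \bar R}) :
    m `]-oo, n%:R]%classic @[n --> \oo] --> m setT.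
  have -> : [set: R] = \bigcup_n `]-oo, (n%:R : R)]%classic.
    apply/seteqP; split=> // x _; exists (Num.bound `|x|) => //=.
    by rewrite in_itv/= ltW// (le_lt_trans (ler_norm x))// archi_boundP.
  apply: nondecreasing_cvg_mu; first by [].
    exact: bigcupT_measurable.
  move=> p q pq.
  by apply/subsetPset => x /=; rewrite !in_itv/= => /le_trans; apply; rewrite ler_nat.
have ray x : m1 `]-oo, x]%classic = m2 `]-oo, x]%classic.
  have h := lim m1 x; apply: (cvg_unique (@ereal_hausdorff R) h).
  apply: cvg_trans (lim m2 x); apply: near_eq_cvg; exists 1%N => // n /= n0.
  by rewrite m12// gtrBl ltr0n.
apply: measure_eq_rays => //.
have h := limT m1; apply: (cvg_unique (@ereal_hausdorff R) h).
apply: cvg_trans (limT m2); apply: near_eq_cvg; apply: nearW => n; exact/esym/ray.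
Qed.

End StrictDerivative.

(** * Differentiation of the matrix elements *)

Section SpectralDerivative.
Variables (R : realType) (a b : nat -> R) (am1 : R).
Hypothesis a_gt0 : forall n, 0 < a n.
Hypothesis carleman : series (fun n => (a n)^-1) n @[n --> \oo] --> +oo.
Variable E : R -> cseq R -> cseq R.
Hypothesis hE : spectral_family (jacobi_operator a b) E.
Local Notation e_ := (basis_vec R).
Local Notation A := (jacobi_action a b).
Local Notation nm := Normc.normc.

(** By [resolvent_integral], applied to [(A - z) u = e_0], the Poisson integral is [e |u|^2]. As
    [<Au, u>] is real, the imaginary part of the equation tested against [u] gives
    [e |u|^2 = Im u_0]. *)
Lemma poisson_weyl (mu : {measure set (measurableTypeR R) -> \bar R}) l e u :
  spectral_measure E (e_ 0) mu -> 0 < e -> ell2 u ->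
  A u = e_ 0 + cscale (l +i* e) u -> poisson mu l e = complex.Im (u 0%N).
Proof.
move=> hmu e0 hu Au; have he := @ell2_basis R 0.
have hzu := ell2Z (l +i* e) hu.
have du : jacobi_domain a b u by split; rewrite // Au; exact: ell2D.
have hE0 : A u - cscale (l +i* e) u = e_ 0 by rewrite Au addrK.
have ray t : mu `]-oo, t]%classic =
    (rdot (E t (A u - cscale (l +i* e) u)) (A u - cscale (l +i* e) u))%:E.
  by rewrite hE0; exact: spectral_measureE.
have int := resolvent_integral a_gt0 carleman hE e0 du ray.
have -> : poisson mu l e = e * rdot u u.
  rewrite /poisson /Rintegral; under eq_integral do rewrite EFinM.
  rewrite ge0_integralZl_EFin//; last 1 first.
  - exact: ltW.
  - by rewrite int.
  - by move=> t _; rewrite lee_fin invr_ge0 addr_ge0// sqr_ge0.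
  - by apply/measurable_EFinP; exact: measurable_lorentzian.
have [nu [_ _ _ /(_ du)[_]]] := spectral_integral a_gt0 carleman hE hu.
have hiu := ell2Z 'i hu.
rewrite Au rdotDl// rdotC rdot_basis (_ : cscale (l +i* e) u =
  cscale l%:C u + cscale e%:C (cscale 'i u)); last first.
  rewrite cscaleA -cscaleDl; congr cscale.
  by apply: complexP; rewrite !ReImE /=; ring.
rewrite rdotDl//; [|exact: ell2Z|exact: ell2Z].
rewrite !rdotZl// rdotII.
have -> : rdot u (cscale 'i u) = 0.
  by have := rdotIl hu hu; rewrite rdotC; lra.
by rewrite /cscale ReI; lra.
Qed.

(** Shifted, with the zero vector at index -1, so that the three-term formula for [A e_n] holds for
    [n = 0] too. *)
Let bs (k : nat) : cseq R := if k is j.+1 then e_ j else 0.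

Lemma jacobi_action_basis n : A (e_ n) =
  cscale (aprev a am1 n)%:C (bs n) + cscale (b n)%:C (bs n.+1)
  + cscale (a n)%:C (bs n.+2).
Proof.
apply/funext => k; rewrite !fctE /cscale.
case: n => [|n]; case: k => [|k]; rewrite /= /basis_vec ?eqSS//=; first ring.
- by case: k => [|k] /=; rewrite ?eqSS/=; ring.
- by case: n => [|n] /=; rewrite ?eqSS/= ?(eq_sym 0%N)/=; ring.
- have -> : (a k)%:C * (k == n.+1)%:R = (a n.+1)%:C * (k == n.+1)%:R :> R[i].
    by have [->//|_] := eqVneq k n.+1; rewrite !mulr0.
  have -> : (b k.+1)%:C * (k == n)%:R = (b n.+1)%:C * (k == n)%:R :> R[i].
    by have [->//|_] := eqVneq k n; rewrite !mulr0.
  have -> : (a k.+1)%:C * (k.+1 == n)%:R = (a n)%:C * (k.+1 == n)%:R :> R[i].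
    by have [->//|_] := eqVneq k.+1 n; rewrite !mulr0.
  by ring.
Qed.

Section LocalDerivative.
Variables (lam w : R).
Let F x := rdot (E x (e_ 0)) (e_ 0).
Hypothesis law : strict_derivative F lam w.
Let P k : R[i] := orthopoly_shift a am1 b lam%:C k.
Let g (x y : R) n : cseq R := E y (e_ n) - E x (e_ n).
Let G x y k : cseq R := if k is j.+1 then g x y j else 0.

Let band_g x y n : x <= y -> band E x y (g x y n).
Proof. by move=> xy; apply: (band_E hE xy); exact: ell2_basis. Qed.

Let band_G x y k : x <= y -> band E x y (G x y k).
Proof.
case: k => [|k] xy; last exact: band_g.
by split; [exact: ell2_0| |]; rewrite (E_0 hE).
Qed.

Let action_g x y n : x <= y -> A (g x y n) =
  cscale (aprev a am1 n)%:C (G x y n) + cscale (b n)%:C (G x y n.+1)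
  + cscale (a n)%:C (G x y n.+2).
Proof.
move=> xy; have bsE k : E y (bs k) - E x (bs k) = G x y k.
  by case: k => [|//] /=; rewrite !(E_0 hE) subrr.
have lb k : ell2 (bs k) by case: k => [|k]; [exact: ell2_0|exact: ell2_basis].
have lz c k : ell2 (cscale c (bs k)) by exact: ell2Z.
have lD : ell2 (cscale (aprev a am1 n)%:C (bs n) + cscale (b n)%:C (bs n.+1)) by exact: ell2D.
rewrite /g jacobi_actionB !(action_E a_gt0 carleman hE); do ?exact: dom_basis.
rewrite jacobi_action_basis !(E_D hE)// !(E_Z hE)// -!bsE !cscaleDr !cscaleN.
apply/funext => k; rewrite !fctE; ring.
Qed.

Let basis_near k : exists2 C : R, 0 <= C & forall x y d : R, 0 <= d <= 1 -> x <= y ->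
  `|x - lam| <= d -> `|y - lam| <= d ->
  ell2_norm (G x y k - cscale (P k) (G x y 1)) <= C * d * ell2_norm (G x y 1).
Proof.
pose S k := exists2 C : R, 0 <= C & forall x y d : R, 0 <= d <= 1 -> x <= y ->
  `|x - lam| <= d -> `|y - lam| <= d ->
  ell2_norm (G x y k - cscale (P k) (G x y 1)) <= C * d * ell2_norm (G x y 1).
rewrite -/(S k); suff : S k /\ S k.+1 by case.
have n0 : ell2_norm (0 : cseq R) = 0 by rewrite ell2_normE rdot0l sqrtr0.
elim: k => [|k [[C1 C10 IH1] [C2 C20 IH2]]].
  split; exists 0 => // x y d d01 xy _ _; rewrite !mul0r /P/=.
    by rewrite (_ : _ - _ = 0) ?n0//; apply/funext => j; rewrite !fctE /cscale mul0r subrr.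
  by rewrite cscale1 subrr n0.
split; first by exists C2.
set p := nm (P k.+1).
(* The 3 collects the width [y - x <= 2 d] of the band and [|x - lam| <= d]. *)
pose C := (a k)^-1 * (3 * (p + C2) + (`|lam| + `|b k|) * C2 + `|aprev a am1 k| * C1).
have p0 : 0 <= p by exact: normc_ge0.
have ai : 0 < (a k)^-1 by rewrite invr_gt0.
exists C.
  by apply: mulr_ge0; rewrite ?(ltW ai)// !addr_ge0// mulr_ge0// addr_ge0.
move=> x y d /andP[d0 d1] xy xl yl.
have := IH1 x y d; rewrite d0 d1 => /(_ isT xy xl yl) {}IH1.
have := IH2 x y d; rewrite d0 d1 => /(_ isT xy xl yl) {}IH2.
have lG j : ell2 (G x y j) by case: (band_G j xy).
set V := G x y 1 in IH1 IH2 *; have lV : ell2 V by exact: lG.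
set D1 := G x y k - _ in IH1; set D2 := G x y k.+1 - _ in IH2.
have lD1 : ell2 D1 by apply: ell2B => //; exact: ell2Z.
have lD2 : ell2 D2 by apply: ell2B => //; exact: ell2Z.
set v := ell2_norm V in IH1 IH2 *; have v0 : 0 <= v by exact: ell2_norm_ge0.
pose W := A (g x y k) - cscale x%:C (g x y k).
have lg : ell2 (g x y k) by exact: (lG k.+1).
have lA : ell2 (A (g x y k)).
  exact: (dom_action (band_dom a_gt0 carleman hE (band_g k xy))).
have lW : ell2 W by apply: ell2B => //; exact: ell2Z.
have gv : ell2_norm (g x y k) <= (p + C2) * v.
  have -> : g x y k = D2 + cscale (P k.+1) V by rewrite /D2 subrK.
  apply: le_trans (ell2_normD lD2 (ell2Z _ lV)) _; rewrite ell2_normZ//.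
  rewrite -/v -/p mulrDl addrC lerD2l (le_trans IH2)// ler_wpM2r//.
  by rewrite ler_piMr.
have Wv : ell2_norm W <= 2 * d * ((p + C2) * v).
  apply: le_trans (band_norm a_gt0 carleman hE xy (band_g k xy)) _.
  apply: ler_pM => //; rewrite ?subr_ge0 ?ell2_norm_ge0//.
  by move: xl yl; rewrite !ler_norml => /andP[? ?] /andP[? ?]; lra.
have ak0 : (a k)%:C != 0 :> R[i] by rewrite (inj_eq (@complexI R) (a k) 0) gt_eqF.
(* The recurrence for the vectors [G], with [x] as approximate eigenvalue, minus the recurrence for
   [P] at [lam]: [W] and the term in [x - lam] are of order [d], and the rest are the two previous
   errors. *)
have -> : G x y k.+2 - cscale (P k.+2) V =
    cscale (a k)^-1%:C (W + cscale (x - lam)%:C (g x y k)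
      + cscale (lam - b k)%:C D2 - cscale (aprev a am1 k)%:C D1).
  have Ag := action_g k xy.
  apply/funext => j; have := congr1 (fun f : cseq R => f j) Ag.
  rewrite !fctE /cscale /W /D1 /D2 !fctE /cscale => ->.
  rewrite -[G x y k.+1]/(g x y k) fmorphV !rmorphB/=.
  rewrite -[P k.+2]/(((lam%:C - (b k)%:C) * P k.+1 - (aprev a am1 k)%:C * P k) / (a k)%:C).
  by field.
have l1 := ell2Z (x - lam)%:C lg; have l2 := ell2Z (lam - b k)%:C lD2.
have l3 := ell2Z (aprev a am1 k)%:C lD1.
rewrite ell2_normZ; last by apply: ell2B => //; apply: ell2D => //; exact: ell2D.
rewrite normc_real (gtr0_norm ai) /C -!mulrA ler_pM2l//.
apply: le_trans (ell2_normB (ell2D (ell2D lW l1) l2) l3) _.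
apply: le_trans (lerD (ell2_normD (ell2D lW l1) l2) (lexx _)) _.
apply: le_trans (lerD (lerD (ell2_normD lW l1) (lexx _)) (lexx _)) _.
rewrite !ell2_normZ// !normc_real.
have h1 : `|x - lam| * ell2_norm (g x y k) <= d * ((p + C2) * v).
  by apply: ler_pM; rewrite ?ell2_norm_ge0.
have h2 : `|lam - b k| * ell2_norm D2 <= (`|lam| + `|b k|) * (C2 * d * v).
  by apply: ler_pM; rewrite ?ell2_norm_ge0// ler_normB.
have h3 : `|aprev a am1 k| * ell2_norm D1 <= `|aprev a am1 k| * (C1 * d * v).
  by apply: ler_wpM2l.
lra.
Qed.

Let p k : R := complex.Re (P k).
Let P_real k : P k = (p k)%:C.
Proof.
apply: conjc_fixed; rewrite /P orthopolyE.
by apply: jacobi_solution_real; rewrite ?rmorph0 ?rmorph1 ?conjc_real.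
Qed.

(** The unimodular [c] is 1 for the real part and ['i] for the imaginary part of a matrix element,
    so one estimate serves both. *)
Let matrix_near (c : R[i]) n m : nm c = 1 ->
  exists2 K : R, 0 <= K & forall x y d : R, 0 <= d <= 1 -> x <= y ->
    `|x - lam| <= d -> `|y - lam| <= d ->
    `|rdot (g x y n) (cscale c (g x y m)) -
      p n.+1 * p m.+1 * rdot (g x y 0) (cscale c (g x y 0))| <=
    K * d * rdot (g x y 0) (g x y 0).
Proof.
move=> c1; have [C C0 HC] := basis_near n.+1; have [D D0 HD] := basis_near m.+1.
exists (C * (D + `|p m.+1|) + `|p n.+1| * D); first by rewrite addr_ge0 ?mulr_ge0 ?addr_ge0.
move=> x y d d01 xy xl yl; have := HC x y d d01 xy xl yl; have := HD x y d d01 xy xl yl.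
move: d01 => /andP[d0 d1]; rewrite !P_real /G.
have l j : ell2 (g x y j) by case: (band_g j xy).
move: (g x y n) (g x y m) (g x y 0) (l n) (l m) (l 0%N) => u u' V lu lu' lV.
set D1 := u' - _; set D2 := u - _; set pn := p n.+1; set pm := p m.+1 in D1 *.
have lD1 : ell2 D1 by apply: ell2B => //; exact: ell2Z.
have lD2 : ell2 D2 by apply: ell2B => //; exact: ell2Z.
rewrite -sqr_ell2_norm//; set v := ell2_norm V.
have v0 : 0 <= v by exact: ell2_norm_ge0.
move=> h1 h2.
have h3 : ell2_norm u' <= (D + `|pm|) * v.
  rewrite (_ : u' = D1 + cscale pm%:C V); last by rewrite /D1 subrK.
  apply: le_trans (ell2_normD lD1 (ell2Z _ lV)) _; rewrite ell2_normZ// normc_real.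
  by rewrite -/v mulrDl lerD2r (le_trans h1)// ler_wpM2r// ler_piMr.
have lcu' := ell2Z c lu'; have lcV := ell2Z c lV; have lcD1 := ell2Z c lD1.
have -> : rdot u (cscale c u') - pn * pm * rdot V (cscale c V) =
    rdot D2 (cscale c u') + pn * rdot V (cscale c D1).
  have -> : cscale c D1 = cscale c u' - cscale pm%:C (cscale c V).
    by rewrite /D1 cscaleDr cscaleN !cscaleA [c * _]mulrC.
  have lpV := ell2Z pn%:C lV; have lpcV := ell2Z pm%:C lcV.
  by rewrite (rdotBl lu lpV lcu') (rdotBr lcu' lpcV lV) rdotZl// rdotZr//; ring.
apply: le_trans (ler_normD _ _) _; rewrite normrM.
apply: le_trans (lerD (rdot_CS lD2 lcu') (ler_wpM2l _ (rdot_CS lV lcD1))) _ => //.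
rewrite !ell2_normZ// c1 !mul1r -/v.
have h4 : ell2_norm D2 * ell2_norm u' <= C * d * v * ((D + `|pm|) * v).
  by apply: ler_pM; rewrite ?ell2_norm_ge0.
have h5 : `|pn| * (v * ell2_norm D1) <= `|pn| * (v * (D * d * v)).
  by apply: ler_wpM2l => //; apply: ler_wpM2l.
lra.
Qed.

(** Here [s] is 1 for [c = 1] and 0 for [c = 'i], as [<u, u>] is real. *)
Let matrix_strict (c : R[i]) (s : R) n m : nm c = 1 ->
  (forall u : cseq R, ell2 u -> rdot u (cscale c u) = s * rdot u u) ->
  strict_derivative (fun x => rdot (E x (e_ n)) (cscale c (e_ m))) lam
    (p n.+1 * p m.+1 * s * w).
Proof.
move=> c1 cs z z0; have [K K0 HK] := matrix_near n m c1.
set q := p n.+1 * p m.+1 * s.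
pose z1 := z / (2 * (`|q| + 1)).
have q1 : 0 < `|q| + 1 by rewrite ltr_wpDl.
have z10 : 0 < z1 by rewrite divr_gt0// mulr_gt0.
(* The law with tolerance 1 bounds the increment of [F] by [(|w| + 1) (y - x)], so that the error of
   [matrix_near] becomes small relative to [y - x]. *)
have [r1 r10 Hr1] := law z10; have [r2 r20 Hr2] := law ltr01.
pose T := K * (`|w| + 1) + 1.
have T0 : 0 < T by rewrite ltr_wpDl// mulr_ge0// addr_ge0.
pose d := Num.min (Num.min 1 (z / (2 * T))) (Num.min r1 r2).
have d0 : 0 < d by rewrite !lt_min ltr01 r10 r20 divr_gt0// mulr_gt0.
exists d => // x y xl yl xy.
have xy' := ltW xy; have h0 : 0 < y - x by rewrite subr_gt0.
have d1 : d <= 1 by rewrite !ge_min lexx.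
have d2 : d * T <= z / 2.
  have : d <= z / (2 * T) by rewrite !ge_min lexx !orbT.
  move=> /(ler_wpM2r (ltW T0)) /le_trans; apply.
  by rewrite le_eqVlt; apply/orP; left; apply/eqP; field; rewrite gt_eqF.
have d3 : d <= r1 by rewrite !ge_min lexx !orbT.
have d4 : d <= r2 by rewrite !ge_min lexx !orbT.
have le0 j : ell2 (e_ j) by exact: ell2_basis.
have d01 : 0 <= d <= 1 by rewrite (ltW d0).
have := HK x y d d01 xy' (ltW xl) (ltW yl).
have := Hr1 x y (lt_le_trans xl d3) (lt_le_trans yl d3) xy.
have := Hr2 x y (lt_le_trans xl d4) (lt_le_trans yl d4) xy.
have lg : ell2 (g x y 0) by case: (band_g 0 xy').
rewrite cs// -(rdot_band hE xy' (le0 n) (ell2Z c (le0 m))) !(E_Z hE)// -cscaleN -cscaleDr.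
rewrite /F -(rdot_band hE xy' (le0 0%N) (le0 0%N)) -/(g x y 0) -/(g x y n) -/(g x y m).
have V0 := rdot_ge0 lg; move: (rdot (g x y 0) _) V0 => V V0 hV1 hV2 hf.
have hV : V <= (`|w| + 1) * (y - x).
  move: hV1; rewrite ler_norml => /andP[_ h].
  have := ler_wpM2r (ltW h0) (ler_norm w); lra.
have h1 : K * d * V <= z / 2 * (y - x).
  apply: (@le_trans _ _ (K * d * ((`|w| + 1) * (y - x)))).
    by rewrite ler_wpM2l// mulr_ge0// ltW.
  by rewrite mulrA ler_pM2r// (le_trans _ d2)// /T [leRHS]mulrDr mulr1 [K * d]mulrC -mulrA lerDl ltW.
have h2 : `|q * (V - w * (y - x))| <= z / 2 * (y - x).
  rewrite normrM (le_trans (ler_wpM2l _ hV2))// mulrA ler_pM2r//.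
  apply: (@le_trans _ _ ((`|q| + 1) * z1)); first by rewrite ler_pM2r// lerDl.
  by rewrite le_eqVlt; apply/orP; left; apply/eqP; rewrite /z1; field; rewrite gt_eqF.
set f := rdot _ _ in hf *.
rewrite (_ : f - _ = (f - p n.+1 * p m.+1 * (s * V)) + q * (V - w * (y - x))).
  apply: le_trans (ler_normD _ _) _; apply: le_trans (lerD (le_trans hf h1) h2) _.
  by rewrite -mulrDl -splitr.
by rewrite /q; ring.
Qed.

Lemma spectral_cderive n m :
  is_cderive (fun x => ell2_dot (E x (e_ n)) (e_ m)) lam
    (w%:C * orthopoly a am1 b n lam%:C * orthopoly a am1 b m lam%:C).
Proof.
rewrite /orthopoly -/(P n.+1) -/(P m.+1) !P_real.
set l := _ * _; have [lR lI] : complex.Re l = w * p n.+1 * p m.+1 /\ complex.Im l = 0.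
  by rewrite /l !ReImE /=; split; ring.
split.
- rewrite lR (_ : (fun t => _) = fun x => rdot (E x (e_ n)) (cscale 1 (e_ m))); last first.
    by apply/funext => t; rewrite ell2_dotE cscale1.
  rewrite (_ : w * _ * _ = p n.+1 * p m.+1 * 1 * w); last by ring.
  apply/strict_derivative_is_derive/matrix_strict; first exact: Normc.normc1.
  by move=> u _; rewrite cscale1 mul1r.
- rewrite lI (_ : (fun t => _) = fun x => rdot (E x (e_ n)) (cscale 'i (e_ m))); last first.
    by apply/funext => t; rewrite ell2_dotE.
  rewrite [X in is_derive _ _ _ X](_ : 0 = p n.+1 * p m.+1 * 0 * w); last by ring.
  apply/strict_derivative_is_derive/matrix_strict.
    by have := @normcI R 1; rewrite mulr1 Normc.normc1.
  move=> u hu; rewrite mul0r.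
  by have := rdotIl hu hu; rewrite rdotC; lra.
Qed.

End LocalDerivative.

End SpectralDerivative.

Theorem theorem5p10 (R : realType) (a b : nat -> R) (am1 beta_inf : R)
    (a_gt0 : forall n, 0 < a n) (am1_gt0 : 0 < am1)
    (a_infty : a n @[n --> \oo] --> +oo)
    (beta_cvg : beta a am1 b n @[n --> \oo] --> beta_inf)
    (beta_inf_lt1 : `|beta_inf| < 1)
    (alpha_ell1 : ell1 (fun n => alpha a am1 n.+1 - alpha a am1 n))
    (beta_ell1 : ell1 (fun n => beta a am1 b n.+1 - beta a am1 b n))
    (kappa_ell1 : ell1 (fun n => kappa a am1 n - 1))
    (carleman : series (fun n => (a n)^-1) n @[n --> \oo] --> +oo) :
  [set lam%:C | lam in [set: R]] `<=` spectrum (jacobi_operator a b) /\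
  forall (E : R -> cseq R -> cseq R)
    (E_spectral : spectral_family (jacobi_operator a b) E)
    (eps0 : R) (eps0_gt0 : 0 < eps0) (eps0_lt : eps0 < 1 - `|beta_inf|)
    (N0 : R -> nat)
    (N0P : forall rho : R, 0 < rho -> (1 <= N0 rho)%N /\
      forall (n : nat) (z : R[i]), (N0 rho <= n)%N -> Normc.normc z < rho ->
        Normc.normc ((alpha a am1 n)%:C * z + (beta a am1 b n)%:C
                       - beta_inf%:C) < eps0)
    (rho0 : R -> R) (rho0P : forall lam, `|lam| < rho0 lam)
    (s : bool),
  let tau := fun lam : R =>
    spectral_weight a am1 b beta_inf (N0 (rho0 lam)) s lam in
  [/\ forall lam, Omega a am1 b (N0 (rho0 lam)) s lam != 0,
      forall (n m : nat) (lam : R),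
        is_cderive
          (fun x => ell2_dot (E x (basis_vec R n)) (basis_vec R m)) lam
          ((tau lam)%:C * orthopoly a am1 b n lam%:C
                        * orthopoly a am1 b m lam%:C),
      measurable_fun [set: R] tau &
      forall rho : {measure set (measurableTypeR R) -> \bar R},
        spectral_measure E (basis_vec R 0) rho ->
        forall B : set R, measurable B ->
          rho B = (\int[lebesgue_measure]_(x in B) (tau x)%:E)%E].
Proof.
split.
  (* Solvability is tested on [e_0]: its preimage would be a square summable sequence excluded by
     [real_not_ell2]. *)
  move=> _ [lam _ <-] [Hsol _].
  have [g [Jg _]] := Hsol _ (@ell2_basis R 0).
  have [hg _ Ag] := jacobi_operator_action a_gt0 Jg.
  (* No [N0] is given in this half, so admissible parameters are built; [eps] is then shared equally
     between [alpha n * z] and [beta n - beta_inf]. *)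
  pose eps := (1 - `|beta_inf|) / 2; pose rho := `|lam| + 1.
  have eps0 : 0 < eps by rewrite divr_gt0// subr_gt0.
  have epsl : eps < 1 - `|beta_inf| by rewrite /eps; lra.
  have rho0 : 0 < rho by rewrite ltr_wpDl.
  have lamr : `|lam| < rho by rewrite ltrDl.
  have /cvgrPdist_lt/(_ (eps / (2 * rho)))[| N1 _ HN1] := alpha_cvg0 am1 a_gt0 a_infty.
    by rewrite divr_gt0// mulr_gt0.
  have /cvgrPdist_lt/(_ (eps / 2))[| N2 _ HN2] := beta_cvg; first by rewrite divr_gt0.
  have NP n z : (maxn N1 N2 <= n)%N -> Normc.normc z < rho ->
      Normc.normc ((alpha a am1 n)%:C * z + (beta a am1 b n)%:C - beta_inf%:C) < eps.
    rewrite geq_max => /andP[/HN1 /= h1 /HN2 /= h2] zr.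
    rewrite -addrA -rmorphB/= (le_lt_trans (ler_normcD _ _))//.
    rewrite Normc.normcM !normc_real distrC.
    have : `|alpha a am1 n| * Normc.normc z <= eps / (2 * rho) * rho.
      apply: ler_pM; rewrite ?normc_ge0 ?(ltW zr)//.
      by move: h1; rewrite sub0r normrN => /ltW.
    by rewrite (_ : eps / (2 * rho) * rho = eps / 2); [lra|field; rewrite gt_eqF].
  have Ag' : jacobi_action a b g = basis_vec R 0 + cscale lam%:C g by rewrite -Ag.
  exact: (real_not_ell2 a_gt0 am1_gt0 alpha_ell1 beta_ell1 kappa_ell1
    eps0 epsl rho0 NP a_infty carleman lamr Ag' hg).
move=> E hE eps0 eps0_gt0 eps0_lt N0 N0P rho0 rho0P s tau.
have rho_gt0 lam : 0 < rho0 lam by exact: le_lt_trans (rho0P lam).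
have near lam := weyl_near a_gt0 am1_gt0 beta_inf_lt1 alpha_ell1 beta_ell1 kappa_ell1
  eps0_gt0 eps0_lt (rho_gt0 lam) (N0P _ (rho_gt0 lam)).2 beta_cvg a_infty carleman s (rho0P lam).
have he := @ell2_basis R 0.
pose F x := rdot (E x (basis_vec R 0)) (basis_vec R 0).
have [mu [mu_spec _ _]] := sf_integral hE he.
have muE x y : x < y -> mu `]x, y]%classic = (F y - F x)%:E.
  move=> xy; rewrite (itv_measure hE (ltW xy) he) ?(rdot_band hE (ltW xy) he he)//.
have mu_fin : (mu setT < +oo)%E by rewrite (spectral_measureT hE he mu_spec) ltry.
have law lam : strict_derivative F lam (tau lam).
  have [_ nr] := near lam.
  move=> z z0; have [|r r0 Hr] := poisson_inversion mu_fin (w := tau lam) (l0 := lam) _ z0.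
    move=> e e0; have [r r0 Hr] := nr e e0; exists (r / 2); first by rewrite divr_gt0.
    move=> l h ll h0 hr.
    have [|//|u [hu Au le]] := Hr (l +i* h).
      apply: le_lt_trans (normc_le_ReIm _) _; rewrite /= subr0 (gtr0_norm h0); lra.
    rewrite (poisson_weyl a_gt0 carleman hE mu_spec h0 hu Au) /tau /spectral_weight.
    by rewrite !mulrA mulfV ?mul1r// gt_eqF// pi_gt0.
  exists r => // x y xl yl xy; have := Hr x y xl yl xy.
  by rewrite muE.
(* Continuity holds although [N0 (rho0 lam)] may vary arbitrarily with [lam]: [tau] is the two-point
   derivative of [F], which involves neither. *)
have tau_cont := strict_derivative_continuous law.
split.
- by move=> lam; have [] := near lam.
- move=> n m lam; exact: (spectral_cderive am1 a_gt0 carleman hE (law lam)).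
- exact: continuous_measurable_fun tau_cont.
- move=> rho rho_spec B mB.
  have mtau : measurable_fun setT (EFin \o tau : measurableTypeR R -> \bar R).
    by apply/measurable_EFinP; exact: continuous_measurable_fun tau_cont.
  have tau0 x : (0 <= (EFin \o tau) x)%E.
    by rewrite lee_fin !mulr_ge0 ?invr_ge0 ?pi_ge0 ?sqrtr_ge0 ?exprn_ge0 ?normc_ge0.
  (* Agreement on intervals, where the integral of [tau] is the increment of [F], excludes a
     singular part. *)
  apply: (@measure_eq_itv _ rho (density_measure lebesgue_measure tau0 mtau)) mB.
    by rewrite (spectral_measureT hE he rho_spec) ltry.
  move=> x y xy; apply: etrans (esym (strict_derivative_integral law xy)).
  rewrite (itv_measure hE (ltW xy) he) ?(rdot_band hE (ltW xy) he he)//.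
Qed.
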